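(* Let $(\xi_k)_{k\ge1}$ be independent $\{0,1\}$-valued random variables with $\mathbb E(\xi_k)=\frac{\log k}{k}$, and let $T=\{k\in\mathbb N:\xi_k=1\}$. Almost surely, the random set $T$ contains a subset $T'$ of positive lower density in $T$, i.e. $\underline d(T',T)>0$, such that (1) $T'$ is a $\frac43$-Rider set; (2) $T'$ is a $\Lambda(q)$-set for all $2<q<\infty$.
   Context: $\mathbb N=\{1,2,\ldots\}$. For $E'\subset E\subset\mathbb N$, $\underline d(E',E)=\liminf_{N\to\infty}\frac{|E'\cap[1,N]|}{|E\cap[1,N]|}$. $\mathbb T=\mathbb R/\mathbb Z$ with Lebesgue probability measure, $e_k(x)=e^{2i\pi kx}$. For $\Lambda\subset\mathbb N$, $L^2_\Lambda$ is the space of $f\in L^2(\mathbb T)$ with $\widehat f(n)=0$ for $n\notin\Lambda$; $\Lambda$ is a $\Lambda(q)$-set ($2<q<\infty$) if there is a constant $C_q$ with $\|f\|_q\le C_q\|f\|_2$ for all $f\in L^2_\Lambda$. $\mathcal P_\Lambda$ is the set of trigonometric polynomials $f=\sum_{k\in\Lambda}a_ke_k$ with spectrum in $\Lambda$. If $(\varepsilon_k)$ is a Rademacher sequence (i.i.d., values $\pm1$ with probability $1/2$), put $f_\omega=\sum_k\varepsilon_k(\omega)a_ke_k$ and $[f]=\mathbb E(\|f_\omega\|_\infty)$. For $1\le p<2$, $\Lambda$ is $p$-Rider if there is a constant $C$ such that $\big(\sum_k|\widehat f(k)|^p\big)^{1/p}\le C[f]$ for every $f\in\mathcal P_\Lambda$.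 *)

(* Defs.v *)
From HB Require Import structures.
From mathcomp Require Import all_boot all_order all_algebra finmap.
From mathcomp Require Import all_classical all_reals all_analysis.
From mathcomp Require Import complex.

Set Implicit Arguments.
Unset Strict Implicit.
Unset Printing Implicit Defensive.

Import Order.TTheory GRing.Theory Num.Theory.
Import numFieldNormedType.Exports.

Local Open Scope classical_set_scope.
Local Open Scope ring_scope.

(* The natural numbers start at 1 here. *)
Definition posnat : set nat := [set k | (0 < k)%N].

Section LowerDensity.
Context (R : realType).

Definition counting_upto (E : set nat) (N : nat) : nat :=
  (\sum_(1 <= k < N.+1) (k \in E))%N.

(* While E `&` [1, N] is empty the quotient is 0 / 0 = 0; when E is non-empty
   this concerns finitely many N only, so the liminf does not see it. *)
Definition lower_density (E' E : set nat) : \bar R :=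
  limn_einf (fun N => ((counting_upto E' N)%:R / (counting_upto E N)%:R)%:E).

End LowerDensity.
Arguments lower_density : clear implicits.

Section Random.
Context (R : realType) (d : measure_display) (Omega : measurableType d).
Context (P : probability Omega R).

Definition mutually_independent (I : choiceType) (D : set I)
    (X : I -> {RV P >-> R}) : Prop :=
  forall (J : {fset I}) (A : I -> set R),
    [set` J] `<=` D -> (forall j, j \in J -> measurable (A j)) ->
    P (\bigcap_(j in [set` J]) (X j @^-1` A j)) =
    (\prod_(j <- J) P (X j @^-1` A j))%E.

Definition rademacher (eps : nat -> {RV P >-> R}) : Prop :=
  [/\ mutually_independent posnat eps,
      forall k, (0 < k)%N -> P [set w | eps k w = 1] = (2^-1)%:E
    & forall k, (0 < k)%N -> P [set w | eps k w = - 1] = (2^-1)%:E].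

End Random.

(* A function on the circle T = R/Z is a 1-periodic function on R. *)
Section Circle.
Context (R : realType).
Implicit Types (f : R -> R[i]) (q p : R) (n : int) (Lambda : set nat).

Definition circle_measure : {measure set (measurableTypeR R) -> \bar R} :=
  mrestr (@lebesgue_measure R) (measurable_itv `[0 : R, 1 : R[).

Definition expc n (x : R) : R[i] :=
  (cos (2 * pi * n%:~R * x) +i* sin (2 * pi * n%:~R * x))%C.

Definition circle_integral f : R[i] :=
  (Rintegral circle_measure setT (fun x => complex.Re (f x)) +i*
   Rintegral circle_measure setT (fun x => complex.Im (f x)))%C.

Definition fourier f n : R[i] := circle_integral (fun x => f x * expc (- n) x).

Definition normL q f : \bar R :=
  Lnorm circle_measure q%:E (fun x => (ComplexField.Normc.normc (f x))%:E).

Definition L2circle f : Prop :=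
  [/\ forall x, f (x + 1) = f x,
      measurable_fun setT (fun x => complex.Re (f x)),
      measurable_fun setT (fun x => complex.Im (f x))
    & (normL 2 f < +oo)%E].

Definition L2spectrum Lambda f : Prop :=
  L2circle f /\ forall n, ~ (Posz @` Lambda) n -> fourier f n = 0.

Definition Lambda_set q Lambda : Prop :=
  exists C : R, forall f, L2spectrum Lambda f ->
    (normL q f <= C%:E * normL 2 f)%E.

(* An element of P_Lambda is [trigpoly A a] with A a finite subset of Lambda. *)
Definition trigpoly (A : {fset nat}) (a : nat -> R[i]) (x : R) : R[i] :=
  \sum_(k <- A) a k * expc k%:Z x.

Definition supnorm f : R := sup (range (fun x => ComplexField.Normc.normc (f x))).

Definition bracket (d : measure_display) (Omega : measurableType d)
    (P : probability Omega R) (eps : nat -> {RV P >-> R})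
    (A : {fset nat}) (a : nat -> R[i]) : \bar R :=
  'E_P[fun w => supnorm (trigpoly A (fun k => ((eps k w)%:C%C * a k)%R))]%E.

(* The bracket depends only on the law of the Rademacher sequence, so the
   constant C is required to serve for every such sequence. The coefficients
   of [trigpoly A a] outside A vanish, so the sum is restricted to A. *)
Definition Rider p Lambda : Prop :=
  exists C : R,
    forall (d : measure_display) (Omega : measurableType d)
      (P : probability Omega R) (eps : nat -> {RV P >-> R}),
    rademacher eps ->
    forall (A : {fset nat}) (a : nat -> R[i]), [set` A] `<=` Lambda ->
      (((\sum_(k <- A)
          ComplexField.Normc.normc (fourier (trigpoly A a) k%:Z) `^ p)
        `^ p^-1)%:E <= C%:E * bracket eps A a)%E.

End Circle.

(* Main.v *)
(* T' keeps, from some random rank on, the part of T lying in the intervals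
   J_n = [2^n, 2^n + 2^(n-2)).  A union bound over sign patterns with one pivot
   removed gives P(T /\ J_n is not quasi-independent) <= q_n prod (1 + 2 p_k)
   with q_n about n 2^-n and prod (1 + 2 p_k) at most 2^((n+1)/2), which is
   summable; Chebyshev's inequality at the scales 2^n shows that T' keeps a
   positive proportion of T.  So almost surely every dyadic block of T' is
   quasi-independent, and everything rests on one estimate for such sets: when
   sum |b_k|^2 is small, the mean of exp (sum Re (b_k e_k)) is bounded.  A single
   block is subgaussian by Riesz products.  For several blocks one splits
   sum b_k e_k into its means over windows of length 2^-u of a grid; the
   successive increments see block n only with weight 2^-|u - n|, so they are
   subgaussian with summable constants, and are integrated out one at a time.
   Lambda(q): the estimate bounds the moments of trigonometric polynomials, hence
   those of the Fejer means of f, and Fatou's lemma passes to f.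
   4/3-Rider: test the random polynomial f_omega against the random Riesz product
   prod (1 + eps_k c_k Re (u_k e_k)) with c_k proportional to |a_k|^(1/3); its
   total mass has bounded second moment by the same estimate, because
   sum c_k^4 is small. *)

Require Import Defs.
From mathcomp Require Import all_boot all_order all_algebra finmap.
From mathcomp Require Import all_classical all_reals all_analysis.
From mathcomp Require Import complex measurable_realfun.
From mathcomp Require Import ring lra zify.

Set Implicit Arguments.
Unset Strict Implicit.
Unset Printing Implicit Defensive.

Import Order.TTheory GRing.Theory Num.Theory.
Import numFieldNormedType.Exports.

Local Open Scope classical_set_scope.
Local Open Scope ring_scope.

Local Notation normc := ComplexField.Normc.normc.

(** * Exponentials and quasi-independent sets *)

Section Expc.
Context {R : realType}.
Implicit Types (x y : R) (m n : int).

(** Counting shows what can be expected. A set without relations over {-1, 0, 1} has distinct subset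
    sums, hence O(log N) elements up to N, whereas T has of the order of log^2 N. So T' cannot be
    quasi-independent as a whole; only its dyadic blocks, with about n elements each, can be, and
    the interaction of blocks has to be controlled analytically. The exponent 4/3 comes from this
    control by duality: the second moment of the mass of a random Riesz product involves the
    coefficients c_k^2, whose l^2 norm is governed by sum c_k^4, and 4/3 is conjugate to 4. Why a
    quarter of each block: over a proportion theta of block n the bound for prod (1 + 2 p_k) is 2^(2
    theta (n+1)), and the pivot gains only about 2^-n, so theta < 1/2 is required. The estimates are
    proved for means over the multiples of 2^-M instead of integrals: such means are finite sums,
    are invariant under grid shifts, and agree with the integral as soon as the grid is finer than
    all frequencies in play. *)

Lemma expc0 x : expc 0 x = 1.
Proof. by rewrite /expc mulr0z mulr0 mul0r cos0 sin0. Qed.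

Lemma expcD m n x : expc (m + n) x = expc m x * expc n x.
Proof.
rewrite /expc intrD mulrDr mulrDl cosD sinD.
by apply/eqP; rewrite eq_complex /= eqxx /= [X in _ == X]addrC eqxx.
Qed.

Lemma expcDx n x y : expc n (x + y) = expc n x * expc n y.
Proof.
rewrite /expc mulrDr cosD sinD.
by apply/eqP; rewrite eq_complex /= eqxx /= [X in _ == X]addrC eqxx.
Qed.

Lemma expcx0 n : expc n (0 : R) = 1.
Proof. by rewrite /expc mulr0 cos0 sin0. Qed.

Lemma expcMn n (k : nat) x : expc n (k%:R * x) = expc n x ^+ k.
Proof.
elim: k => [|k IH]; first by rewrite mul0r expcx0.
by rewrite exprSr -IH -[in LHS]natr1 mulrDl mul1r expcDx.
Qed.

Lemma expc_muln n (k : nat) x : expc (k%:Z * n) x = expc n x ^+ k.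
Proof. by rewrite -expcMn /expc intrM; congr (cos _ +i* sin _)%C; ring. Qed.

Lemma normc_expc n x : normc (expc n x) = 1.
Proof. by rewrite /= cos2Dsin2 sqrtr1. Qed.

Lemma expcN n x : expc (- n) x = conjc (expc n x).
Proof. by rewrite /expc mulrNz mulrN mulNr cosN sinN. Qed.

Lemma expcNx n x : expc n (- x) = conjc (expc n x).
Proof. by rewrite /expc mulrN cosN sinN. Qed.

Lemma expc_1 n : expc n (1 : R) = 1.
Proof.
have e1 : expc 1 (1 : R) = 1.
  by rewrite /expc !mulr1 mulr_natl cos2pi sin2pi.
have en k : expc k%:Z (1 : R) = 1 by rewrite -[k%:Z]mulr1 expc_muln e1 expr1n.
by case: n => k; [exact: en|rewrite NegzE expcN en rmorph1].
Qed.

Lemma expc_period n x : expc n (x + 1) = expc n x.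
Proof. by rewrite expcDx expc_1 mulr1. Qed.

End Expc.

(** * Exponentials and Riesz products on a finite grid *)

Section Grid.
Context {R : realType}.
Implicit Types (x y : R) (m n : int).

Lemma normc_1Bexpc n x : normc (1 - expc n x) = 2 * `|sin (pi * n%:~R * x)|.
Proof.
rewrite /expc; set t := pi * _ * _.
have -> : 2 * pi * n%:~R * x = t *+ 2 by rewrite /t; ring.
rewrite /= sub0r cos_mulr2n sin_mulr2n.
have -> : (1 - (cos t ^+ 2 *+ 2 - 1)) ^+ 2 + (- ((cos t * sin t) *+ 2)) ^+ 2
   = (2 * sin t) ^+ 2.
  have := cos2Dsin2 t; set c := cos t; set s := sin t => cs.
  have -> : c ^+ 2 = 1 - s ^+ 2 by rewrite -cs; ring.
  have -> : (- ((c * s) *+ 2)) ^+ 2 = 4 * (c ^+ 2) * s ^+ 2 by ring.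
  have -> : c ^+ 2 = 1 - s ^+ 2 by rewrite -cs; ring.
  ring.
by rewrite sqrtr_sqr normrM ger0_norm.
Qed.

(** The mean value theorem on [[0, x/2]] and the double angle formula give [sin x >= x cos^2(x/2)],
    and [2 cos^2(x/2) = 1 + cos x >= 1]. *)
Lemma sin_ge_half x : 0 <= x <= pi / 2 -> x / 2 <= sin x.
Proof.
move=> /andP[x0 xpi].
have [->|xn0] := eqVneq x 0; first by rewrite mul0r sin0.
have xp : 0 < x by rewrite lt_def xn0.
have h : x / 2 * cos (x / 2) <= sin (x / 2).
  have cts : {within `[0, x / 2], continuous (@sin R)}.
    by apply/continuous_subspaceT => z; exact: continuous_sin.
  have x20 : 0 < x / 2 by rewrite divr_gt0.
  have [c cI e] := MVT x20 (fun y _ => is_derive_sin y) cts.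
  move: e; rewrite sin0 !subr0 => ->.
  rewrite mulrC ler_wpM2r ?divr_ge0 //.
  move: cI; rewrite in_itv /= => /andP[c0 cx].
  have := pi_ge0 R => pi0.
  by rewrite ltW// ltr_cos ?in_itv /= //; apply/andP; split; lra.
have xE : (x / 2) *+ 2 = x by rewrite -[_ *+ 2]mulr_natr; field.
rewrite -[X in sin X]xE sin_mulr2n.
have pi0 := pi_ge0 R.
have cx : 0 <= cos (x / 2 *+ 2).
  by apply: cos_ge0_pihalf; rewrite xE; apply/andP; split; lra.
have c2 : 0 <= cos (x / 2) by apply: cos_ge0_pihalf; apply/andP; split; lra.
move: cx; rewrite cos_mulr2n => cx.
have cx' : 1 <= cos (x / 2) ^+ 2 *+ 2 by lra.
have : x / 2 * cos (x / 2) ^+ 2 <= cos (x / 2) * sin (x / 2).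
  by rewrite expr2 mulrA mulrC ler_wpM2l.
set a := cos (x / 2) * sin (x / 2) => ha.
have : x / 2 <= x / 2 * (cos (x / 2) ^+ 2 + cos (x / 2) ^+ 2).
  by rewrite ler_peMr ?divr_ge0 //; lra.
rewrite mulrDr; lra.
Qed.

Lemma sin_le_id x : 0 <= x -> sin x <= x.
Proof.
move=> x0; have [->|xn0] := eqVneq x 0; first by rewrite sin0.
have xp : 0 < x by rewrite lt_def xn0.
have cts : {within `[0, x], continuous (@sin R)}.
  by apply/continuous_subspaceT => z; exact: continuous_sin.
have [c cI e] := MVT xp (fun y _ => is_derive_sin y) cts.
move: e; rewrite sin0 !subr0 => ->.
by rewrite ler_piMl // cos_le1.
Qed.

Lemma normc_1Bexpc_ge (k : nat) x : 0 <= k%:R * x <= 2^-1 ->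
  2 * (k%:R * x) <= normc (1 - expc k x).
Proof.
move=> /andP[h0 h1]; rewrite normc_1Bexpc.
have pi2 := pi_ge2 R.
have -> : pi * k%:~R * x = pi * (k%:R * x) by rewrite mulrA.
set u := k%:R * x in h0 h1 *.
have h : (pi * u) / 2 <= sin (pi * u).
  by apply: sin_ge_half; rewrite mulr_ge0 ?pi_ge0//= ler_wpM2l ?pi_ge0.
have h2 : 2 * u <= pi * u by rewrite ler_wpM2r.
have := ler_norm (sin (pi * u)); lra.
Qed.

Lemma normc_1Bexpc_le (k : nat) x : 0 <= k%:R * x ->
  normc (1 - expc k x) <= 8 * (k%:R * x).
Proof.
move=> h0; rewrite normc_1Bexpc.
have pi2 := pihalf_lt2 R; have pi0 := pi_ge0 R.
have t0 : 0 <= pi * k%:~R * x by rewrite -mulrA mulr_ge0.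
have st : `|sin (pi * k%:~R * x)| <= pi * k%:~R * x.
  set t := pi * _ * _ in t0 *.
  have [st|st] := leP 0 (sin t); first by rewrite ?ger0_norm// sin_le_id.
  rewrite ltr0_norm// -sinN.
  have [tp|tp] := leP t pi.
    by have := sin_ge0_pi (introT andP (conj t0 tp)); rewrite leNgt st.
  by have := sin_le1 (- t); have := pi_ge2 R; lra.
have -> : 8 * (k%:R * x) = 2 * (4 * (k%:R * x)) by ring.
rewrite ler_pM2l// (le_trans st)// -mulrA ler_wpM2r//; lra.
Qed.

Lemma expc_grid_neq1 (N : nat) (s : int) : (0 < N)%N -> ~~ (N%:Z %| s)%Z ->
  expc s (N%:R^-1 : R) != 1.
Proof.
move=> N0 Ns; apply/negP => /eqP es.
have NR0 : (N%:R : R) != 0 by rewrite pnatr_eq0 -lt0n.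
set r := (s %% N%:Z)%Z.
have r0 : 0 < r by rewrite lt_def modz_ge0 -?lt0n//; rewrite -dvdz0Pmod// Ns || rewrite /r; case: eqP => // /dvdz_mod0P; rewrite (negbTE Ns).
have rN : r < N%:Z by exact: ltz_pmod.
have er : expc r (N%:R^-1 : R) = 1.
  move: es; rewrite (divz_eq s N%:Z) -/r expcD.
  suff -> : expc ((s %/ N%:Z)%Z * N%:Z) (N%:R^-1 : R) = 1 by rewrite mul1r.
  by rewrite mulrC expc_muln -expcMn divff// expc_1.
have := normc_1Bexpc r (N%:R^-1 : R); rewrite er subrr ComplexField.Normc.normc0.
have rr : (0 : R) < r%:~R by rewrite ltr0z.
have rNr : (r%:~R : R) < N%:R by rewrite -[N%:R]/(N%:~R) ltr_int.
have NR : (0 : R) < N%:R by rewrite ltr0n.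
have : 0 < sin (pi * r%:~R * N%:R^-1 : R).
  apply: sin_gt0_pi; rewrite -mulrA mulr_gt0 ?pi_gt0 ?divr_gt0//=.
  by rewrite gtr_pMr ?pi_gt0// ltr_pdivrMr// mul1r.
move=> sp /esym/eqP; rewrite mulf_eq0 normr_eq0 (gt_eqF sp) pnatr_eq0.
by [].
Qed.

Lemma sum_expc_grid (N : nat) (s : int) : (0 < N)%N ->
  \sum_(y < N) expc s ((y : nat)%:R / N%:R : R) =
  if (N%:Z %| s)%Z then N%:R else 0.
Proof.
move=> N0; have NR0 : (N%:R : R) != 0 by rewrite pnatr_eq0 -lt0n.
under eq_bigr do rewrite expcMn.
case: ifPn => Ns.
  have -> : expc s (N%:R^-1 : R) = 1.
    move/dvdzP: Ns => [q ->]; rewrite mulrC expc_muln -expcMn divff//.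
    exact: expc_1.
  under eq_bigr do rewrite expr1n.
  by rewrite sumr_const card_ord.
have /eqP zn1 := expc_grid_neq1 N0 Ns.
set z := expc _ _ in zn1 *.
have := subrX1 z N; rewrite -expcMn divff// expc_1 subrr => /esym/eqP.
by rewrite mulf_eq0 subr_eq0 => /orP[/eqP//|/eqP].
Qed.

Definition quasi_independent (A : {fset nat}) := forall eta : nat -> int,
  (forall k, k \in A -> `|eta k| <= 1) ->
  \sum_(k <- A) eta k * k%:Z = 0 -> forall k, k \in A -> eta k = 0.

Definition sgn3 (j : 'I_3) : int := if j == 0 then 0 else if j == 1 then 1 else -1.

(** Expanding the product gives one exponential per pattern in {-1, 0, 1}^A. Quasi-independence
    leaves frequency 0 to the zero pattern alone, and [sum k < N] prevents any other frequency from
    being a multiple of [N]. *)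
Lemma sum_riesz_grid (A : {fset nat}) (N : nat) (al p q : nat -> R[i]) :
  quasi_independent A -> (\sum_(k <- A) k < N)%N ->
  \sum_(y < N) \prod_(k <- A)
     (al k + p k * expc k ((y : nat)%:R / N%:R : R)
           + q k * expc (- k%:Z) ((y : nat)%:R / N%:R : R))
  = N%:R * \prod_(k <- A) al k.
Proof.
move=> qA AN; have N0 : (0 < N)%N by apply: leq_ltn_trans AN.
pose c (k : A) (j : 'I_3) : R[i] :=
  if j == 0 then al (val k) else if j == 1 then p (val k) else q (val k).
transitivity (\sum_(f : {ffun A -> 'I_3}) (\prod_(k : A) c k (f k)) *
    \sum_(y < N) expc (\sum_(k : A) sgn3 (f k) * (val k)%:Z)
       ((y : nat)%:R / N%:R : R)).
  under [RHS]eq_bigr do rewrite mulr_sumr.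
  rewrite exchange_big /=; apply: eq_bigr => y _.
  rewrite big_seq_fsetE /=.
  transitivity (\prod_(k : A) \sum_(j < 3) (c k j *
       expc (sgn3 j * (val k)%:Z) ((y : nat)%:R / N%:R : R))).
    apply: eq_bigr => k _; rewrite !big_ord_recl big_ord0 /c /sgn3 /=.
    by rewrite mul0r expc0 mulr1 mul1r mulN1r addr0 addrA.
  rewrite bigA_distr_bigA; apply: eq_bigr => f _.
  rewrite big_split /=; congr (_ * _).
  by rewrite (big_morph (fun s => expc s _) (fun m n => expcD m n _) (expc0 _)).
pose f0 : {ffun A -> 'I_3} := [ffun=> 0].
rewrite (bigD1 f0) //= [X in _ + X]big1 => [|f ff0].
  have -> : \sum_(k : A) sgn3 (f0 k) * (val k)%:Z = 0.
    by rewrite big1 // => k _; rewrite ffunE mul0r.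
  rewrite addr0 sum_expc_grid//.
  rewrite dvdz0 mulrC; congr (_ * _); rewrite big_seq_fsetE /=.
  by apply: eq_bigr => k _; rewrite ffunE.
rewrite sum_expc_grid// ifF ?mulr0//; apply/negP => Ndiv; move/negP: ff0; apply.
have absle : `|\sum_(k : A) sgn3 (f k) * (val k)%:Z| < N%:Z.
  apply: le_lt_trans (ler_norm_sum _ _ _) _.
  apply: (@le_lt_trans _ _ (\sum_(k : A) (val k)%:Z)).
    apply: ler_sum => k _; rewrite normrM ler_piMl// /sgn3.
    by case: ifP => // _; case: ifP.
  have -> : \sum_(k : A) (val k)%:Z = (\sum_(k <- A) k)%N%:Z.
    by rewrite big_seq_fsetE /= (big_morph Posz PoszD (erefl 0%:Z)).
  by rewrite ltz_nat.
have s0 : \sum_(k : A) sgn3 (f k) * (val k)%:Z = 0.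
  apply/eqP; rewrite -absz_eq0; apply/negPn/negP; rewrite -lt0n => sp.
  move: Ndiv; rewrite dvdzE /= => /(dvdn_leq sp).
  by move: absle; rewrite -abszE ltz_nat ltnNge => /negP.
pose eta (k : nat) : int := if insub k is Some k' then sgn3 (f k') else 0.
have etaE (k : A) : eta (val k) = sgn3 (f k).
  by rewrite /eta valK.
have eta0 : forall k, k \in A -> eta k = 0.
  apply: qA.
    move=> k _; rewrite /eta; case: insub => [k'|]//.
    by rewrite /sgn3; case: ifP => // _; case: ifP.
  by rewrite big_seq_fsetE /= -[RHS]s0; apply: eq_bigr => k _; rewrite etaE.
apply/eqP/ffunP => k; rewrite ffunE.
have := eta0 _ (valP k); rewrite etaE /sgn3.
by case: ifP => [/eqP//|_]; case: ifP.
Qed.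

End Grid.

(** * Subgaussian estimates on a grid *)

Section Exponential.
Context {R : realType}.
Implicit Types (x y t : R).

Lemma expR_jensen (I : Type) (r : seq I) (P : pred I) (w a : I -> R) :
  (forall i, P i -> 0 <= w i) -> \sum_(i <- r | P i) w i = 1 ->
  expR (\sum_(i <- r | P i) w i * a i) <= \sum_(i <- r | P i) w i * expR (a i).
Proof.
move=> w0 w1; set m := \sum_(i <- r | P i) w i * a i.
have -> : expR m = \sum_(i <- r | P i) w i * (expR m * (1 + (a i - m))).
  transitivity (expR m * (\sum_(i <- r | P i) w i * (1 - m) + m)).
    by rewrite -mulr_suml w1 mul1r subrK mulr1.
  rewrite /m -big_split /= mulr_sumr; apply: eq_bigr => i _; rewrite -/m; ring.
apply: ler_sum => i Pi; rewrite ler_wpM2l ?w0//.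
rewrite -[in leRHS](subrK m (a i)) [in leRHS]addrC expRD.
by rewrite ler_wpM2l ?expR_ge0// expR_ge1Dx.
Qed.

Lemma expR_convex x y t : 0 <= t <= 1 ->
  expR ((1 - t) * x + t * y) <= (1 - t) * expR x + t * expR y.
Proof.
move=> /andP[t0 t1].
pose w (b : bool) : R := if b then t else 1 - t.
pose a (b : bool) : R := if b then y else x.
have := @expR_jensen bool [:: false; true] predT w a.
rewrite !big_cons !big_nil /= /w /a !addr0; apply; last by rewrite subrK.
by case => _; lra.
Qed.

(** For small [y], [e^y <= 1/(1-y)] gives [cosh y <= 1/(1-y^2) <= 1 + 2y^2]. The bound spreads to
    all [x] by [cosh y <= cosh(y/2)^4], since [2y^2] is four times [2(y/2)^2]. *)
Lemma coshR_le x : (expR x + expR (- x)) / 2 <= expR (2 * x ^+ 2).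
Proof.
have base y : `|y| <= 2^-1 -> (expR y + expR (- y)) / 2 <= expR (2 * y ^+ 2).
  move=> y2.
  have yy : - 2^-1 <= y <= 2^-1 by rewrite -ler_norml.
  have y2' : y ^+ 2 <= 2^-1.
    rewrite -real_normK ?num_real//.
    have := normr_ge0 y; set z := `|y| in y2 * => z0; nra.
  have e1 : expR y <= (1 - y)^-1.
    rewrite -[leLHS]invrK lef_pV2 ?posrE ?invr_gt0 ?expR_gt0//; last by lra.
    by rewrite -expRN expR_ge1Dx.
  have e2 : expR (- y) <= (1 + y)^-1.
    rewrite expRN lef_pV2 ?posrE ?expR_gt0//; last by lra.
    by rewrite expR_ge1Dx.
  apply: le_trans (expR_ge1Dx _).
  apply: (@le_trans _ _ (((1 - y)^-1 + (1 + y)^-1) / 2)); first by lra.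
  have -> : ((1 - y)^-1 + (1 + y)^-1) / 2 = (1 - y ^+ 2)^-1.
    by field; apply/and3P; split; apply/eqP; nra.
  have p : 0 < 1 - y ^+ 2 by lra.
  rewrite -(ler_pM2l p) divff ?gt_eqF//.
  have := sqr_ge0 y; set z := y ^+ 2 in y2' *; nra.
have step y : (expR y + expR (- y)) / 2 <=
    ((expR (y / 2) + expR (- (y / 2))) / 2) ^+ 4.
  have -> : expR y = expR (y / 2) ^+ 2.
    by rewrite -expRM_natr; congr expR; field.
  have -> : expR (- y) = expR (- (y / 2)) ^+ 2.
    by rewrite -expRM_natr; congr expR; field.
  have : expR (y / 2) * expR (- (y / 2)) = 1 by rewrite -expRD subrr expR0.
  set a := expR _; set b := expR _ => ab.
  have -> : (a ^+ 2 + b ^+ 2) / 2 = 2 * ((a + b) / 2) ^+ 2 - 1.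
    have -> : 2 * ((a + b) / 2) ^+ 2 = (a ^+ 2 + b ^+ 2) / 2 + a * b by field.
    by rewrite ab; ring.
  set c := (a + b) / 2.
  have -> : c ^+ 4 = (c ^+ 2) ^+ 2 by rewrite -exprM.
  by have := sqr_ge0 (c ^+ 2 - 1); set d := c ^+ 2; rewrite sqrrB1; lra.
have main n : forall y, `|y| <= 2 ^+ n / 2 ->
    (expR y + expR (- y)) / 2 <= expR (2 * y ^+ 2).
  elim: n => [|n IH] y yn.
    by apply: base; rewrite expr0 mul1r in yn.
  apply: le_trans (step y) _.
  have h : `|y / 2| <= 2 ^+ n / 2.
    rewrite normrM normfV (ger0_norm (_ : 0 <= 2))//.
    by rewrite ler_pM2r ?invr_gt0//; rewrite exprS in yn; lra.
  have := IH _ h; set c := _ / 2 => ch.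
  have -> : expR (2 * y ^+ 2) = expR (2 * (y / 2) ^+ 2) ^+ 4.
    by rewrite -expRM_natr; congr expR; field.
  apply: lerXn2r => //; rewrite nnegrE ?expR_ge0//.
  by rewrite divr_ge0// addr_ge0// expR_ge0.
apply: (main (Num.bound `|2 * x|)).
rewrite ler_pdivlMr//.
have -> : `|x| * 2 = `|2 * x| by rewrite normrM ger0_norm// mulrC.
have z0 : 0 <= `|2 * x| by rewrite normr_ge0.
apply: le_trans (ltW (archi_boundP z0)) _.
by rewrite -natrX ler_nat ltnW// ltn_expl.
Qed.

(** The chord of the exponential over [[-r, r]]. Being affine in [x], it turns a product of
    exponentials of real parts into a Riesz product. *)
Lemma expR_chord x r : `|x| <= r ->
  expR x <= (expR r + expR (- r)) / 2 + (expR r - expR (- r)) / 2 / r * x.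
Proof.
move=> xr; have r0 : 0 <= r by apply: le_trans xr.
have [r00|rn0] := eqVneq r 0.
  move: xr; rewrite r00 normr_le0 => /eqP ->.
  by rewrite oppr0 mulr0 expR0 addr0; lra.
have rp : 0 < r by rewrite lt_def rn0.
have := @expR_convex r (- r) ((1 - x / r) / 2).
have -> : (1 - (1 - x / r) / 2) * r + (1 - x / r) / 2 * - r = x.
  by field.
have -> : (1 - (1 - x / r) / 2) * expR r + (1 - x / r) / 2 * expR (- r)
   = (expR r + expR (- r)) / 2 + (expR r - expR (- r)) / 2 / r * x by field.
apply; have : -1 <= x / r <= 1.
  by rewrite ler_pdivlMr// ler_pdivrMr// mulN1r mul1r -ler_norml.
by lra.
Qed.

End Exponential.

Section GridMean.
Context {R : realType}.
Implicit Types (x y t : R) (g : R -> R) (N : nat).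

(** Stands in for the integral over the circle, with which it agrees on trigonometric polynomials of
    degree below [N]. *)
Definition gmean N g : R := N%:R^-1 * \sum_(y < N) g ((y : nat)%:R / N%:R).

Lemma ler_gmean N g1 g2 : (forall x, g1 x <= g2 x) -> gmean N g1 <= gmean N g2.
Proof.
by move=> g12; rewrite /gmean ler_wpM2l ?invr_ge0//; apply: ler_sum.
Qed.

Lemma eq_gmean N g1 g2 : g1 =1 g2 -> gmean N g1 = gmean N g2.
Proof. by move=> g12; congr (_ * _); apply: eq_bigr. Qed.

Lemma gmeanD N g1 g2 : gmean N (fun x => g1 x + g2 x) = gmean N g1 + gmean N g2.
Proof. by rewrite /gmean big_split mulrDr. Qed.

Lemma gmeanZ N t g : gmean N (fun x => t * g x) = t * gmean N g.
Proof. by rewrite /gmean -mulr_sumr mulrCA. Qed.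

Lemma gmean_sum N (I : Type) (r : seq I) (P : pred I) (g : I -> R -> R) :
  gmean N (fun x => \sum_(i <- r | P i) g i x) = \sum_(i <- r | P i) gmean N (g i).
Proof. by rewrite /gmean exchange_big /= mulr_sumr. Qed.

Lemma gmean_cst N t : (0 < N)%N -> gmean N (fun=> t) = t.
Proof.
move=> N0; rewrite /gmean sumr_const card_ord -[t *+ N]mulr_natl mulrA mulVf.
  by rewrite mul1r.
by rewrite pnatr_eq0 -lt0n.
Qed.

Lemma gmean_shift N g (j : nat) : (0 < N)%N -> (forall x, g (x + 1) = g x) ->
  gmean N (fun x => g (x + j%:R / N%:R)) = gmean N g.
Proof.
move=> N0 gp; elim: j => [|j IH].
  by apply: eq_gmean => x; rewrite mul0r addr0.
rewrite -IH /gmean; congr (_ * _).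
have NR0 : (N%:R : R) != 0 by rewrite pnatr_eq0 -lt0n.
case: N N0 NR0 {IH} => // N _ NR0.
rewrite big_ord_recr big_ord_recl /= addrC; congr (_ + _).
  rewrite -[RHS]gp mul0r add0r; congr g.
  rewrite -[j.+1%:R]natr1.
  have -> : (N%:R : R) = N.+1%:R - 1 by rewrite -natr1 addrK.
  by field.
apply: eq_bigr => i _; congr g.
by rewrite /bump /= add1n -[j.+1%:R]natr1 -[i.+1%:R]natr1; field.
Qed.

Definition subgaussian N (g : R -> R) (s : R) : Prop :=
  forall t, gmean N (fun x => expR (t * g x)) <= expR ((t * s) ^+ 2).

(** Nothing relates the [g i] to one another, so the scales themselves add up, not their squares:
    Jensen's inequality with weights [s i / S]. *)
Lemma subgaussian_sum N (I : Type) (r : seq I) (P : pred I) (g : I -> R -> R)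
    (s : I -> R) :
  (0 < N)%N -> (forall i, P i -> 0 < s i) -> (forall i, P i -> subgaussian N (g i) (s i)) ->
  subgaussian N (fun x => \sum_(i <- r | P i) g i x) (\sum_(i <- r | P i) s i).
Proof.
move=> N0 s0 gs t; set S := \sum_(i <- r | P i) s i.
have S0 : 0 <= S by apply: sumr_ge0 => i Pi; exact/ltW/s0.
have [S00|Sn0] := eqVneq S 0.
  have hP : has P r = false.
    apply/negP => hP; move: S00; apply/eqP; rewrite gt_eqF//.
    rewrite /S; elim: r hP {S S0} => //= i r IH.
    rewrite big_cons; case: ifPn => [Pi _|_ /= hP]; last exact: IH.
    by apply: ltr_pwDl; [exact: s0|apply: sumr_ge0 => j Pj; exact/ltW/s0].
  rewrite S00 mulr0 expr0n /= expR0.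
  rewrite -[leRHS](gmean_cst 1 N0) ler_gmean// => x.
  by rewrite big_hasC ?hP// mulr0 expR0.
pose w i := s i / S.
apply: (@le_trans _ _ (gmean N (fun x =>
    \sum_(i <- r | P i) w i * expR (t * S / s i * g i x)))).
  apply: ler_gmean => x.
  have -> : t * \sum_(i <- r | P i) g i x =
            \sum_(i <- r | P i) w i * (t * S / s i * g i x).
    rewrite mulr_sumr; apply: eq_bigr => i /s0 si; rewrite /w; field.
    by rewrite Sn0 gt_eqF.
  apply: expR_jensen => [i /s0 si|]; first by rewrite /w divr_ge0// ltW.
  by rewrite -mulr_suml divff.
rewrite gmean_sum.
have -> : expR ((t * S) ^+ 2) = \sum_(i <- r | P i) w i * expR ((t * S) ^+ 2).
  by rewrite -!mulr_suml divff// mul1r.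
apply: ler_sum => i Pi; rewrite gmeanZ ler_wpM2l//.
  by rewrite /w divr_ge0// ltW// s0.
have := gs i Pi (t * S / s i); rewrite divfK//.
by rewrite gt_eqF// s0.
Qed.

Lemma subgaussian_scale N g s t : subgaussian N g s ->
  subgaussian N (fun x => t * g x) (t * s).
Proof. by move=> gs u; under eq_gmean do rewrite mulrA; rewrite mulrA; exact: gs. Qed.

Lemma sum_geo_le (L : nat) : \sum_(i < L) (4 / 5 : R) ^+ i <= 5.
Proof.
have := subrX1 (4 / 5 : R) L.
have : 0 <= (4 / 5 : R) ^+ L by rewrite exprn_ge0.
by lra.
Qed.

(* [e^(y^2/2)] is dominated by the Gaussian superposition of the exponentials
   [e^(i y)] over integers [i], which avoids integrating over a Gaussian. *)
Lemma expR_sqr_le y (L : nat) : 0 <= y <= L%:R ->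
  expR (y ^+ 2 / 2) <= 2 * \sum_(i < L.+1) expR (- (i%:R ^+ 2) / 2) * expR (i%:R * y).
Proof.
move=> /andP[y0 yL]; pose i := Num.truncn y.
have /andP[iy yi] := truncn_itv y0; rewrite -/i in iy yi.
have iL : (i < L.+1)%N.
  by rewrite ltnS -(ler_nat R); apply: le_trans yL.
rewrite (bigD1 (Ordinal iL)) //= mulrDr -[leLHS]addr0 lerD//; last first.
  by rewrite mulr_ge0// sumr_ge0// => j _; rewrite mulr_ge0 ?expR_ge0.
rewrite -expRD.
have -> : y ^+ 2 / 2 = (y - i%:R) ^+ 2 / 2 + (- (i%:R ^+ 2) / 2 + i%:R * y) by field.
rewrite [leLHS]expRD ler_wpM2r ?expR_ge0//.
have h : (y - i%:R) ^+ 2 / 2 <= 2^-1.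
  have d0 : 0 <= y - i%:R by rewrite subr_ge0.
  have d1 : y - i%:R <= 1 by rewrite lerBlDl; rewrite -natr1 in yi; exact: ltW.
  set d := y - _ in d0 d1 *; nra.
apply: (@le_trans _ _ (expR 2^-1)); first by rewrite ler_expR.
rewrite -[expR _]invrK -expRN invf_ple ?posrE ?expR_gt0//.
by apply: le_trans (expR_ge1Dx _); lra.
Qed.

(** In the Gaussian superposition the weight [e^(-i^2/2)] beats the subgaussian bound [e^(i^2/4)].
    Term [i] is at most [4 e^(-i^2/4) <= 4 (4/5)^i], and the total is [4 * 5 = 20]. *)
Lemma subgaussian_sqr N g (s : R) : (0 < N)%N -> s ^+ 2 <= 4^-1 -> subgaussian N g s ->
  gmean N (fun x => expR (g x ^+ 2 / 2)) <= 20.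
Proof.
move=> N0 s2 gs.
(* On a finite grid [g] is bounded, so finitely many [i] suffice in the superposition. *)
have [L gL] : exists L : nat, forall y : 'I_N, `|g ((y : nat)%:R / N%:R)| <= L%:R.
  exists (Num.bound (\sum_(y < N) `|g ((y : nat)%:R / N%:R)|)) => y.
  have S0 : 0 <= \sum_(y < N) `|g ((y : nat)%:R / N%:R)| by apply: sumr_ge0.
  apply: le_trans (ltW (archi_boundP S0)).
  rewrite (bigD1 y) //= lerDl; exact: sumr_ge0.
pose c (i : nat) : R := expR (- (i%:R ^+ 2) / 2).
apply: (@le_trans _ _ (gmean N (fun x => \sum_(i < L.+1)
   (2 * c i) * (expR (i%:R * g x) + expR (- i%:R * g x))))).
  rewrite /gmean ler_wpM2l ?invr_ge0//; apply: ler_sum => y _.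
  set z := g _.
  have zL : 0 <= `|z| <= L%:R by rewrite normr_ge0 gL.
  rewrite -[z ^+ 2]real_normK ?num_real//.
  apply: le_trans (expR_sqr_le zL) _.
  rewrite mulr_sumr; apply: ler_sum => i _; rewrite -/(c i) mulrA.
  rewrite ler_wpM2l ?mulr_ge0 ?expR_ge0//.
  have [z0|z0] := leP 0 z; first by rewrite ger0_norm// lerDl expR_ge0.
  by rewrite ltr0_norm// mulrN -mulNr lerDr expR_ge0.
rewrite gmean_sum.
apply: (@le_trans _ _ (\sum_(i < L.+1) 4 * (4 / 5 : R) ^+ i)); last first.
  by rewrite -mulr_sumr; have := sum_geo_le L.+1; lra.
apply: ler_sum => i _; rewrite gmeanZ gmeanD.
have h1 := gs i%:R; have h2 := gs (- i%:R).
rewrite mulNr sqrrN in h2.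
have e1 : c i * expR ((i%:R * s) ^+ 2) <= (4 / 5) ^+ i.
  rewrite /c -expRD.
  apply: (@le_trans _ _ (expR (- (4^-1) * i%:R))).
    rewrite ler_expR exprMn.
    have : (i%:R : R) <= i%:R ^+ 2 by rewrite -natrX ler_nat; case: (nat_of_ord i) => // j; rewrite leq_pmulr.
    have : (0 : R) <= i%:R by [].
    have := sqr_ge0 s.
    set I := (i%:R : R); set u := s ^+ 2 in s2 *; set v := I ^+ 2; nra.
  rewrite expRM_natr; apply: lerXn2r; rewrite ?nnegrE ?expR_ge0//.
  rewrite expRN invf_ple ?posrE ?expR_gt0//.
  by apply: le_trans (expR_ge1Dx _); lra.
have c0 : 0 <= c i by exact: expR_ge0.
set E := expR _ in h1 h2 e1.
have : c i * (gmean N (fun x => expR (i%:R * g x)) +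
   gmean N (fun x => expR (- i%:R * g x))) <= c i * (E + E).
  by rewrite ler_wpM2l// lerD.
by rewrite mulrDr; lra.
Qed.

End GridMean.

(** * One dyadic block, and the passage from one scale to the next *)

Section Core.
Context {R : realType}.
Implicit Types (x y t : R) (A : {fset nat}) (b : nat -> R[i]).

Lemma ReD (z1 z2 : R[i]) : complex.Re (z1 + z2) = complex.Re z1 + complex.Re z2.
Proof. by case: z1 => ? ?; case: z2. Qed.

Lemma ReZ t (z : R[i]) : complex.Re (t%:C%C * z) = t * complex.Re z.
Proof. by case: z => u v /=; rewrite mul0r subr0. Qed.

Lemma Re_sum (I : Type) (r : seq I) (P : pred I) (F : I -> R[i]) :
  complex.Re (\sum_(i <- r | P i) F i) = \sum_(i <- r | P i) complex.Re (F i).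
Proof. exact: (big_morph _ ReD). Qed.

Lemma normc_ge0 (z : R[i]) : 0 <= normc z.
Proof. by case: z => u v /=; exact: sqrtr_ge0. Qed.

Lemma sqr_normcE (z : R[i]) : normc z ^+ 2 = complex.Re z ^+ 2 + complex.Im z ^+ 2.
Proof. by case: z => u v /=; rewrite sqr_sqrtr// addr_ge0 ?sqr_ge0. Qed.

Lemma normc_geRe (z : R[i]) : `|complex.Re z| <= normc z.
Proof.
rewrite -(ler_pXn2r (n := 2)) ?nnegrE ?normc_ge0// sqr_normcE real_normK ?num_real//.
by rewrite lerDl sqr_ge0.
Qed.

Lemma normc_geIm (z : R[i]) : `|complex.Im z| <= normc z.
Proof.
rewrite -(ler_pXn2r (n := 2)) ?nnegrE ?normc_ge0// sqr_normcE real_normK ?num_real//.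
by rewrite lerDr sqr_ge0.
Qed.

Lemma normc_real t : normc t%:C%C = `|t|.
Proof. by rewrite /= expr0n addr0 sqrtr_sqr. Qed.

Lemma affine_ReE t u (z : R[i]) : (t + u * complex.Re z)%:C%C =
  t%:C%C + (u / 2)%:C%C * z + (u / 2)%:C%C * conjc z.
Proof.
by case: z => p q; apply/eqP; rewrite eq_complex /=; apply/andP; split; apply/eqP; field.
Qed.

Definition rtrig A b x : R := \sum_(k <- A) complex.Re (b k * expc k x).

(** Bounding each factor by its chord yields a Riesz product, whose mean is the product of its
    constant terms [cosh |b_k|]. *)
Lemma gmean_expR_block A N b : quasi_independent A -> (\sum_(k <- A) k < N)%N ->
  gmean N (fun x => expR (rtrig A b x)) <= expR (2 * \sum_(k <- A) normc (b k) ^+ 2).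
Proof.
move=> qA AN.
pose r k := normc (b k).
pose al k := (expR (r k) + expR (- r k)) / 2.
pose be k := (expR (r k) - expR (- r k)) / 2 / r k.
apply: (@le_trans _ _ (gmean N (fun x =>
   \prod_(k <- A) (al k + be k * complex.Re (b k * expc k x))))).
  apply: ler_gmean => x; rewrite /rtrig expR_sum; apply: ler_prod => k _.
  rewrite expR_ge0 /=; apply: expR_chord.
  apply: le_trans (normc_geRe _) _.
  by rewrite ComplexField.Normc.normcM normc_expc mulr1.
have -> : gmean N (fun x =>
   \prod_(k <- A) (al k + be k * complex.Re (b k * expc k x))) = \prod_(k <- A) al k.
  have N0 : (N%:R : R) != 0 by rewrite pnatr_eq0 -lt0n (leq_ltn_trans _ AN).
  apply: (mulfI N0); rewrite /gmean mulrA divff// mul1r.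
  apply: (@complexI R); rewrite rmorph_sum rmorphM rmorph_nat rmorph_prod /=.
  rewrite -(sum_riesz_grid (fun k => (al k)%:C%C)
    (fun k => (be k / 2)%:C%C * b k) (fun k => (be k / 2)%:C%C * conjc (b k)) qA AN).
  apply: eq_bigr => y _; rewrite rmorph_prod; apply: eq_bigr => k _.
  rewrite [LHS](affine_ReE (al k) (be k)) [conjc (_ * _)]rmorphM expcN.
  by rewrite !mulrA.
rewrite mulr_sumr expR_sum; apply: ler_prod => k _; apply/andP; split.
  by rewrite /al divr_ge0// addr_ge0 ?expR_ge0.
exact: coshR_le.
Qed.

Lemma subgaussian_block A N b (s : R) : quasi_independent A ->
  (\sum_(k <- A) k < N)%N -> \sum_(k <- A) normc (b k) ^+ 2 <= s ^+ 2 ->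
  subgaussian N (rtrig A b) (2 * s).
Proof.
move=> qA AN bs t.
have := @gmean_expR_block A N (fun k => t%:C%C * b k) qA AN.
have -> : gmean N (fun x => expR (rtrig A (fun k => t%:C%C * b k) x)) =
          gmean N (fun x => expR (t * rtrig A b x)).
  apply: eq_gmean => x; rewrite /rtrig mulr_sumr; congr expR.
  by apply: eq_bigr => k _; rewrite -mulrA ReZ.
move/le_trans; apply; rewrite ler_expR.
under eq_bigr do rewrite ComplexField.Normc.normcM normc_real exprMn real_normK ?num_real//.
rewrite -mulr_sumr !exprMn.
have := sqr_ge0 t; have := sqr_ge0 s; set S := \sum_(k <- A) _ in bs *.
set u := t ^+ 2; set v := s ^+ 2 in bs *; nra.
Qed.

(** One of the two truncated differences is 0, so the exponent is [|u - n|]. *)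
Definition decay (u n : nat) : R := 2^-1 ^+ ((u - n) + (n - u)).

Lemma decayC u n : decay u n = decay n u.
Proof. by rewrite /decay addnC. Qed.

Lemma decay_gt0 u n : 0 < decay u n.
Proof. by rewrite exprn_gt0// invr_gt0. Qed.

Lemma sum_decay_le (M n : nat) : \sum_(u < M) decay u n <= 3.
Proof.
(* Separate bounds before and after the peak [u = n], sharp enough to be carried by induction on
   [M]. *)
suff h : \sum_(u < M) decay u n <=
    if (M <= n)%N then 2^-1 ^+ (n - M) else 3 - 2 * 2^-1 ^+ (M - n).
  apply: le_trans h _; case: ifP => _.
    have : (2^-1 : R) ^+ (n - M) <= 1 by rewrite exprn_ile1 ?invr_ge0 ?invf_le1 ?ler1n.
    lra.
  have : 0 <= (2^-1 : R) ^+ (M - n) by rewrite exprn_ge0 ?invr_ge0.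
  lra.
elim: M => [|M IH].
  by rewrite big_ord0 leq0n exprn_ge0 ?invr_ge0.
rewrite big_ord_recr /=; move: IH; rewrite /decay.
have [Mn|nM] := leqP M n; last first.
  rewrite ifF; last by apply/negbTE; rewrite -ltnNge ltnS ltnW.
  have -> : (n - M = 0)%N by lia.
  rewrite addn0.
  have -> : (M.+1 - n = (M - n).+1)%N by lia.
  rewrite exprS; lra.
have [->|Mnn] := eqVneq M n.
  rewrite ltnn !subnn addn0 subSnn expr0 expr1; lra.
rewrite ifT; last by rewrite ltn_neqAle Mnn.
have -> : (M - n = 0)%N by lia.
have -> : (n - M = (n - M.+1).+1)%N by lia.
rewrite add0n exprS; lra.
Qed.

(** Cauchy-Schwarz for weights of total at most 3, read off from the nonnegative weighted sum of the
    [(3 s_n - X)^2]. *)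
Lemma sqr_sum_decay_le (M u : nat) (s : nat -> R) :
  (\sum_(n < M) decay u n * s n) ^+ 2 <= 3 * \sum_(n < M) decay u n * s n ^+ 2.
Proof.
set X := \sum_(n < M) _.
have h0 : 0 <= \sum_(n < M) decay u n * (3 * s n - X) ^+ 2.
  by apply: sumr_ge0 => n _; rewrite mulr_ge0 ?sqr_ge0// ltW// decay_gt0.
have e : \sum_(n < M) decay u n * (3 * s n - X) ^+ 2 =
   9 * (\sum_(n < M) decay u n * s n ^+ 2) - 6 * X * X + X ^+ 2 * \sum_(n < M) decay u n.
  transitivity (\sum_(n < M) (9 * (decay u n * s n ^+ 2) +
      (- (6 * X)) * (decay u n * s n) + X ^+ 2 * decay u n)).
    apply: eq_bigr => n _; ring.
  by rewrite !big_split /= -!mulr_sumr -/X mulNr.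
have h3 : \sum_(n < M) decay u n <= 3.
  by under eq_bigr do rewrite decayC; exact: sum_decay_le.
rewrite e in h0.
have := sqr_ge0 X.
move: h0 h3; set S := \sum_(n < M) _; set T := \sum_(n < M) _; nra.
Qed.

Definition mesh (j : nat) : R := 2^-1 ^+ j.

Lemma mesh_gt0 j : 0 < mesh j.
Proof. by rewrite exprn_gt0// invr_gt0. Qed.

Lemma mesh0 : mesh 0 = 1.
Proof. by rewrite /mesh expr0. Qed.

Lemma meshD i j : mesh (i + j) = mesh i * mesh j.
Proof. by rewrite /mesh exprD. Qed.

Lemma meshK j : mesh j * 2 ^+ j = 1.
Proof. by rewrite /mesh -exprMn mulVf ?expr1n. Qed.

Lemma meshS j : mesh j.+1 * 2 = mesh j.
Proof. by rewrite /mesh exprS mulrC mulrA divff// mul1r. Qed.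

(* [avgc M u k * e_k] is the mean of [e_k] over the [2^(M-u)] consecutive grid
   points following the current one, and [incc M u k * e_k] is half the
   difference of the means over the two halves of such a window. *)
Definition avgc (M u k : nat) : R[i] :=
  \prod_(u <= j < M) ((1 + expc k (mesh j.+1)) / 2).

Definition incc (M u k : nat) : R[i] :=
  avgc M u.+1 k * ((1 - expc k (mesh u.+1)) / 2).

Lemma avgcS M u k : (u < M)%N ->
  avgc M u k = avgc M u.+1 k * ((1 + expc k (mesh u.+1)) / 2).
Proof. by move=> uM; rewrite /avgc big_ltn// mulrC. Qed.

(** With [z = e_k(mesh j.+1)], [(1 + z)(1 - z) = 1 - z^2] and [z^2 = e_k(mesh j)], so the product
    over scales collapses: the geometric sum formula for a window mean. *)
Lemma avgc_telescope M u k : (u <= M)%N ->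
  avgc M u k * (1 - expc k (mesh M)) =
  (mesh (M - u))%:C%C * (1 - expc k (mesh u)).
Proof.
move=> uM; rewrite -(subKn uM); move: (M - u)%N (leq_subr u M) => {uM}d.
elim: d => [|d IH] dM.
  by rewrite subn0 /avgc big_geq// subnn mesh0 (rmorph1 (real_complex R)) !mul1r.
have dM' := ltnW dM.
have e : (M - d = (M - d.+1).+1)%N by lia.
rewrite avgcS ?ltn_subrL//; last by rewrite (leq_trans _ dM).
rewrite -e mulrAC IH// !subKn//.
have -> : expc k (mesh (M - d.+1)) = expc k (mesh (M - d) : R) ^+ 2.
  by rewrite -expcMn -meshS -e mulrC.
have -> : (mesh d.+1)%:C%C = (mesh d)%:C%C / 2 :> R[i].
  by rewrite -(meshS d) rmorphM /= rmorph_nat mulfK// pnatr_eq0.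
by field.
Qed.

(** At [u = 0] the window is a full period. The right side of the telescoped identity vanishes
    there, while [0 < k < 2^M] keeps the factor [1 - e_k(mesh M)] away from 0. *)
Lemma avgc0 M k : (0 < k)%N -> (k < 2 ^ M)%N -> avgc M 0 k = 0.
Proof.
move=> k0 kM; have := @avgc_telescope M 0 k (leq0n _).
rewrite mesh0 expc_1 subrr mulr0 => /eqP.
rewrite mulf_eq0 subr_eq0 => /orP[/eqP//|/eqP/esym e].
have := @expc_grid_neq1 R (2 ^ M) k.
rewrite natrX -exprVn -/(mesh M) e eqxx expn_gt0 => /(_ isT) h.
have /h // : ~~ ((2 ^ M)%N%:Z %| k%:Z)%Z.
by apply/negP; rewrite dvdzE /= => /(dvdn_leq k0); rewrite leqNgt kM.
Qed.

Lemma normc_half (z : R[i]) : normc (z / 2) = normc z / 2.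
Proof.
rewrite ComplexField.Normc.normcM ComplexField.Normc.normcV.
by rewrite -[2 : R[i]](rmorph_nat (real_complex R)) normc_real ger0_norm.
Qed.

Lemma normc_avgc_le1 M u k : normc (avgc M u k) <= 1.
Proof.
rewrite /avgc; elim/big_ind: _ => [|z1 z2 h1 h2|j _].
- by rewrite ComplexField.Normc.normc1.
- by rewrite ComplexField.Normc.normcM mulr_ile1 ?normc_ge0.
- rewrite normc_half ler_pdivrMr// mul1r.
  apply: le_trans (le_normcD _ _) _.
  by rewrite ComplexField.Normc.normc1 normc_expc.
Qed.

Lemma normc_incc_le M u k n : (u < M)%N -> (2 ^ n <= k < 2 ^ n.+1)%N ->
  (2 * k <= 2 ^ M)%N -> normc (incc M u k) <= 8 * decay u n.
Proof.
move=> uM /andP[nk kn] kM.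
have k0 : (0 < k)%N by apply: leq_trans nk; rewrite expn_gt0.
have kr : (0 : R) < k%:R by rewrite ltr0n.
have nkr : (2 : R) ^+ n <= k%:R by rewrite -natrX ler_nat.
have knr : (k%:R : R) <= 2 * 2 ^+ n by rewrite -exprS -natrX ler_nat ltnW.
(* Up to half a period, [|1 - e_k(mesh M)|] is bounded below linearly. *)
have kMr : k%:R * mesh M <= 2^-1 :> R.
  rewrite /mesh exprVn ler_pdivrMr ?exprn_gt0//.
  have : (2%:R * k%:R : R) <= 2 ^+ M by rewrite -natrM -natrX ler_nat.
  lra.
rewrite /incc ComplexField.Normc.normcM normc_half.
have [un|nu] := leqP n u.
  (* the increment is small since the window is much shorter than the period *)
  have h := @normc_1Bexpc_le R k (mesh u.+1) (ltW (mulr_gt0 kr (mesh_gt0 _))).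
  have m2 : mesh u.+1 * 2 ^+ n = 2^-1 * decay u n.
    have -> : decay u n = mesh (u - n) by rewrite /decay (eqP un) addn0.
    by rewrite -{1}(subnK un) -addSn meshD -mulrA meshK mulr1 /mesh exprS.
  apply: (@le_trans _ _ (1 * (8 * (k%:R * mesh u.+1) / 2))).
    apply: ler_pM; rewrite ?normc_ge0 ?divr_ge0 ?normc_ge0 ?normc_avgc_le1//.
    by rewrite ler_pM2r ?invr_gt0.
  have : k%:R * mesh u.+1 <= 2 * 2 ^+ n * mesh u.+1 by rewrite ler_pM2r ?mesh_gt0.
  have -> : 2 * 2 ^+ n * mesh u.+1 = decay u n.
    by rewrite -mulrA (mulrC (2 ^+ n)) m2 mulrA divff// mul1r.
  have := decay_gt0 u n; lra.
(* the average is small since the window is much longer than the period *)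
have h1 : normc (1 - expc k (mesh u.+1)) <= 2.
  apply: le_trans (le_normcD _ _) _.
  by rewrite ComplexField.Normc.normc1 normcN normc_expc.
have tele := @avgc_telescope M u.+1 k uM.
have h2 : normc (avgc M u.+1 k) * (2 * (k%:R * mesh M)) <= mesh (M - u.+1) * 2.
  apply: (@le_trans _ _ (normc (avgc M u.+1 k) * normc (1 - expc k (mesh M)))).
    rewrite ler_wpM2l ?normc_ge0// normc_1Bexpc_ge// kMr andbT.
    by rewrite mulr_ge0// ltW// mesh_gt0.
  rewrite -ComplexField.Normc.normcM tele ComplexField.Normc.normcM normc_real.
  by rewrite gtr0_norm ?mesh_gt0// ler_pM2l ?mesh_gt0.
have e1 : mesh (M - u.+1) = mesh M * 2 ^+ u.+1.
  by rewrite -{2}(subnK uM) meshD -mulrA meshK mulr1.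
have e2 : decay u n * 2 ^+ n = 2 ^+ u.
  have -> : decay u n = mesh (n - u) by rewrite /decay; have -> : (u - n = 0)%N by lia.
  by rewrite -{2}(subnK (ltnW nu)) exprD mulrA meshK mul1r.
have h3 : normc (avgc M u.+1 k) * k%:R <= 2 * 2 ^+ u.
  rewrite -(ler_pM2r (mesh_gt0 M)) -mulrA.
  rewrite e1 exprS in h2; lra.
have h4 : normc (avgc M u.+1 k) <= 2 * decay u n.
  have p2 : (0 : R) < 2 ^+ n by rewrite exprn_gt0.
  rewrite -(ler_pM2r p2) -mulrA e2.
  by apply: le_trans h3; rewrite ler_wpM2l ?normc_ge0.
have := normc_ge0 (avgc M u.+1 k); have := decay_gt0 u n.
have := normc_ge0 (1 - expc k (mesh u.+1)).
move: h1 h4; set X := normc _; set Y := normc _; nra.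
Qed.

Lemma rtrig_period A b x : rtrig A b (x + 1) = rtrig A b x.
Proof. by apply: eq_bigr => k _; rewrite expc_period. Qed.

Lemma rtrigD A b b' x :
  rtrig A (fun k => b k + b' k) x = rtrig A b x + rtrig A b' x.
Proof. by rewrite /rtrig -big_split /=; apply: eq_bigr => k _; rewrite mulrDl ReD. Qed.

Lemma rtrig_shift A b x y :
  rtrig A b (x + y) = rtrig A (fun k => b k * expc k y) x.
Proof. by apply: eq_bigr => k _; rewrite expcDx mulrA mulrAC. Qed.

Lemma eq_rtrig A b b' x : {in A, b =1 b'} -> rtrig A b x = rtrig A b' x.
Proof. by move=> bb; apply: eq_big_seq => k /bb ->. Qed.

(** Let [F] be the coarser mean and [G] the increment. A shift by half a window turns [F + G] into
    [F - G], so averaging the two replaces [e^(lG)] by [cosh(lG) <= e^(2 l^2 G^2)]. Convexity of the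
    exponential with weights [1 - w] and [w] then separates [F], whose parameter grows to [l/(1-w)],
    from the Gaussian-type mean of [G^2], which is at most 20. *)
Lemma gmean_scale_step A b M u (l w s : R) : (u < M)%N -> 0 <= l <= 2 ->
  0 < w < 1 -> (8 * s) ^+ 2 <= w ->
  subgaussian (2 ^ M) (rtrig A (fun k => b k * incc M u k)) s ->
  gmean (2 ^ M) (fun x => expR (l * rtrig A (fun k => b k * avgc M u.+1 k) x)) <=
  (1 - w) * gmean (2 ^ M)
      (fun x => expR (l / (1 - w) * rtrig A (fun k => b k * avgc M u k) x)) + w * 20.
Proof.
move=> uM /andP[l0 l2] /andP[w0 w1] sw sg.
have N0 : (0 < 2 ^ M)%N by rewrite expn_gt0.
set F1 := rtrig A (fun k => b k * avgc M u.+1 k).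
set F := rtrig A (fun k => b k * avgc M u k).
set G := rtrig A (fun k => b k * incc M u k) in sg.
have e1 x : F1 x = F x + G x.
  rewrite -rtrigD; apply: eq_rtrig => k _.
  by rewrite (avgcS _ uM) /incc; field.
have e2 x : F1 (x + (2 ^ (M - u.+1))%N%:R / (2 ^ M)%N%:R) = F x - G x.
  have -> : (2 ^ (M - u.+1))%N%:R / (2 ^ M)%N%:R = mesh u.+1 :> R.
    rewrite !natrX -{2}(subnK uM) exprD invfM mulrA divff ?expf_neq0// mul1r.
    by rewrite /mesh exprVn.
  rewrite -[F x](addrK (G x)) -e1 /F1 rtrig_shift.
  apply/eqP; rewrite -subr_eq opprK -subr_eq0 opprD opprK addrA; apply/eqP.
  have -> : rtrig A (fun k => b k * avgc M u.+1 k * expc k (mesh u.+1)) x =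
     F1 x - G x - G x.
    rewrite e1 addrK; apply/eqP; rewrite -subr_eq opprK; apply/eqP.
    rewrite -rtrigD; apply: eq_rtrig => k _; rewrite (avgcS _ uM) /incc.
    by field.
  rewrite /F1; ring.
(* Normalised so that [w Y^2/2 = 2 (lG)^2]. With [l <= 2] and [(8s)^2 <= w] the squared scale of [Y]
   is at most [16 s^2/w <= 1/4]. *)
pose Y x := 2 * l / Num.sqrt w * G x.
have sw0 : 0 < Num.sqrt w by rewrite sqrtr_gt0.
have hY : gmean (2 ^ M) (fun x => expR (Y x ^+ 2 / 2)) <= 20.
  apply: (subgaussian_sqr N0 _ (subgaussian_scale (2 * l / Num.sqrt w) sg)).
  rewrite !exprMn exprVn (sqr_sqrtr (ltW w0)).
  rewrite mulrAC ler_pdivrMr//.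
  move: sw; rewrite exprMn.
  have : l ^+ 2 <= 2 ^+ 2 by rewrite lerXn2r ?nnegrE.
  have := sqr_ge0 s; have := sqr_ge0 l.
  set a := l ^+ 2; set c := s ^+ 2; nra.
have per x : expR (l * F1 (x + 1)) = expR (l * F1 x) by rewrite /F1 rtrig_period.
have -> : gmean (2 ^ M) (fun x => expR (l * F1 x)) =
   2^-1 * gmean (2 ^ M) (fun x => expR (l * F x) * (expR (l * G x) + expR (- (l * G x)))).
  set E1 := gmean _ _; set E2 := gmean _ _.
  suff : E1 + E1 = E2 by lra.
  rewrite {2}/E1 -(gmean_shift (2 ^ (M - u.+1)) N0 per) -gmeanD.
  apply: eq_gmean => x; rewrite e1 e2 [RHS]mulrDr -!expRD; congr (expR _ + expR _); ring.
rewrite -gmeanZ.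
apply: (@le_trans _ _ (gmean (2 ^ M) (fun x =>
  (1 - w) * expR (l / (1 - w) * F x) + w * expR (Y x ^+ 2 / 2)))); last first.
  by rewrite gmeanD !gmeanZ lerD2l ler_pM2l.
apply: ler_gmean => x.
have w1' : 1 - w != 0 by rewrite gt_eqF// subr_gt0.
apply: (@le_trans _ _ (expR ((1 - w) * (l / (1 - w) * F x) + w * (Y x ^+ 2 / 2)))); last first.
  by apply: expR_convex; rewrite !ltW.
have -> : (1 - w) * (l / (1 - w) * F x) + w * (Y x ^+ 2 / 2) = l * F x + 2 * (l * G x) ^+ 2.
  rewrite /Y !exprMn exprVn (sqr_sqrtr (ltW w0)); field.
  by rewrite w1' gt_eqF.
rewrite expRD mulrCA ler_pM2l ?expR_gt0// mulrC.
exact: coshR_le.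
Qed.

End Core.

(** * The exponential estimate for several dyadic blocks *)

Section Psi1.
Context {R : realType}.
Implicit Types (x y t : R) (A : {fset nat}) (b : nat -> R[i]).

Definition block (A : {fset nat}) n : {fset nat} :=
  [fset k in A | trunc_log 2 k == n]%fset.

Lemma mem_block A n k : (k \in block A n) = (k \in A) && (trunc_log 2 k == n).
Proof. by rewrite !inE. Qed.

Lemma sum_block (V : nmodType) A M (F : nat -> V) :
  (forall k, k \in A -> (0 < k < 2 ^ M)%N) ->
  \sum_(k <- A) F k = \sum_(n < M) \sum_(k <- block A n) F k.
Proof.
move=> AM; under [RHS]eq_bigr do rewrite /block big_fset /=.
rewrite (exchange_big_dep xpredT)//=; apply: eq_big_seq => k /AM /andP[k0 kM].
have lk : (trunc_log 2 k < M)%N.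
  rewrite -(@ltn_exp2l 2)//; apply: leq_ltn_trans kM.
  by have /andP[] := @trunc_log_bounds 2 k isT k0.
by rewrite (big_pred1 (Ordinal lk))//.
Qed.

Lemma leq_sum_fset A k : k \in A -> (k <= \sum_(j <- A) j)%N.
Proof. by move=> kA; rewrite (big_fsetD1 k)//= leq_addr. Qed.

Lemma prod_1B_ge (M : nat) (w : nat -> R) : (forall i, (i < M)%N -> 0 <= w i <= 1) ->
  1 - \sum_(i < M) w i <= \prod_(i < M) (1 - w i) /\ 0 <= \prod_(i < M) (1 - w i) <= 1.
Proof.
elim: M => [|M IH] w01; first by rewrite !big_ord0 subr0 lexx ler01.
have [|h1 /andP[h2 h3]] := IH; first by move=> i iM; exact/w01/ltnW.
have /andP[w0 w1] := w01 M (ltnSn M).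
rewrite !big_ord_recr /=.
have : 0 <= \sum_(i < M) w i.
  by apply: sumr_ge0 => i _; have /andP[] := w01 i (ltnW (ltn_ord i)).
move: h1 h2 h3; set S := \sum_(i < M) _; set P := \prod_(i < M) _ => h1 h2 h3 S0.
split; first by nra.
by apply/andP; split; nra.
Qed.

(* The exponential estimate behind both conclusions: by dyadic martingale-like
   differences, the tails of [rtrig A b] are controlled by its l^2 norm as soon
   as every dyadic block of [A] is quasi-independent. *)
Theorem gmean_expR_rtrig_le A b M :
  (forall k, k \in A -> (0 < k)%N) ->
  (forall n, quasi_independent (block A n)) ->
  (2 * \sum_(k <- A) k < 2 ^ M)%N ->
  \sum_(k <- A) normc (b k) ^+ 2 <= 10 ^- 6 ->
  gmean (2 ^ M) (fun x => expR (rtrig A b x)) <= 20.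
Proof.
move=> A0 qA AM b2.
have N0 : (0 < 2 ^ M)%N by rewrite expn_gt0.
have kM k : k \in A -> (2 * k <= 2 ^ M)%N.
  move=> kA; apply: leq_trans (ltnW AM).
  by rewrite leq_mul2l leq_sum_fset.
have kM1 k : k \in A -> (0 < k < 2 ^ M)%N.
  move=> kA; rewrite A0//=; apply: leq_trans (kM k kA).
  by rewrite mul2n -addnn -ltn_subLR// subnn A0.
(* Added to the energy of every block, empty ones included, to make all scales [be n] and shares
   [w u] positive. The total added is at most [10^-6]. *)
pose c : R := 10 ^- 6 / M.+1%:R.
have c0 : 0 < c by rewrite /c divr_gt0// ?invr_gt0.
pose be n := Num.sqrt (\sum_(k <- block A n) normc (b k) ^+ 2 + c).
have be2 n : be n ^+ 2 = \sum_(k <- block A n) normc (b k) ^+ 2 + c.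
  rewrite sqr_sqrtr// addr_ge0 ?(ltW c0)//.
  by apply: sumr_ge0 => k _; exact: sqr_ge0.
have be0 n : 0 < be n.
  rewrite sqrtr_gt0 ltr_wpDl//.
  by apply: sumr_ge0 => k _; exact: sqr_ge0.
have sbe : \sum_(n < M) be n ^+ 2 <= 2 * 10 ^- 6.
  under eq_bigr do rewrite be2.
  rewrite big_split /= -(sum_block _ kM1) sumr_const card_ord.
  have : c *+ M <= 10 ^- 6.
    rewrite -[c *+ M]mulr_natr /c -mulrA ler_piMr ?invr_ge0 ?exprn_ge0//.
    by rewrite mulrC ler_pdivrMr// mul1r ler_nat.
  by move: b2; lra.
pose X u := \sum_(n < M) decay u n * be n.
pose s u := \sum_(n < M) 2 * (8 * decay u n * be n).
have sE u : s u = 16 * X u.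
  by rewrite /s /X mulr_sumr; apply: eq_bigr => n _; ring.
pose w u := (8 * s u) ^+ 2.
(* [w u = (128 X u)^2]. Two uses of the total 3 of the weights give [128^2 * 9 * 2 * 10^-6], about
   0.3: this is what [10^-6] is chosen for. *)
have sw : \sum_(u < M) w u <= 2^-1.
  apply: (@le_trans _ _ (\sum_(u < M) 128 ^+ 2 * 3 * \sum_(n < M) decay u n * be n ^+ 2)).
    apply: ler_sum => u _; rewrite /w sE.
    have := sqr_sum_decay_le M u be; rewrite -/(X u); lra.
  rewrite -mulr_sumr exchange_big /=.
  apply: (@le_trans _ _ (128 ^+ 2 * 3 * \sum_(n < M) 3 * be n ^+ 2)).
    rewrite ler_pM2l//; apply: ler_sum => n _.
    by rewrite -mulr_suml ler_wpM2r ?sqr_ge0// sum_decay_le.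
  by rewrite -mulr_sumr; lra.
have w0 u : (u < M)%N -> 0 < w u.
  move=> uM; rewrite /w sE exprn_gt0// mulr_gt0// mulr_gt0//.
  rewrite /X (bigD1 (Ordinal uM)) //= ltr_pwDl//.
    by rewrite mulr_gt0// decay_gt0.
  by apply: sumr_ge0 => n _; rewrite mulr_ge0// ltW// decay_gt0.
have w1 u : (u < M)%N -> w u <= 2^-1.
  move=> uM; apply: le_trans sw; rewrite (bigD1 (Ordinal uM)) //= lerDl.
  by apply: sumr_ge0 => n _; exact: sqr_ge0.
have sg u : (u < M)%N ->
    subgaussian (2 ^ M) (rtrig A (fun k => b k * incc M u k)) (s u).
  move=> uM.
  have -> : rtrig A (fun k => b k * incc M u k) =
      fun x => \sum_(n < M) rtrig (block A n) (fun k => b k * incc M u k) x.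
    by apply/funext => x; rewrite /rtrig (sum_block _ kM1).
  apply: subgaussian_sum => // n _.
    by rewrite mulr_gt0// mulr_gt0// mulr_gt0// decay_gt0.
  apply: subgaussian_block => //.
    apply: leq_ltn_trans (leq_ltn_trans (leq_pmull _ _) AM) => //.
    rewrite /block big_fset /= big_mkcond /=; apply: leq_sum => k _.
    by case: ifP.
  rewrite exprMn be2 mulrDr.
  apply: (@le_trans _ _ ((8 * decay u n) ^+ 2 * \sum_(k <- block A n) normc (b k) ^+ 2)).
    rewrite mulr_sumr big_seq [leRHS]big_seq; apply: ler_sum => k.
    rewrite mem_block => /andP[kA /eqP kn].
    rewrite ComplexField.Normc.normcM exprMn mulrC ler_wpM2r ?sqr_ge0//.
    rewrite lerXn2r ?nnegrE ?normc_ge0//.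
      by rewrite mulr_ge0// ltW// decay_gt0.
    apply: normc_incc_le => //; last exact: kM.
    by rewrite -kn; apply: (@trunc_log_bounds 2 k) => //; exact: A0.
  by rewrite lerDl mulr_ge0 ?sqr_ge0// ltW.
have w01 u : (u < M)%N -> 0 <= w u <= 1.
  by move=> uM; rewrite ltW ?w0//= (le_trans (w1 u uM))//; lra.
(* The range of [l] shrinks by [1 - w u] at each scale to make room for the growth of the parameter,
   and [(1 - w) 20 + w 20 = 20] keeps the bound. As the product stays at least 1/2, [l = 1] is
   allowed at the finest scale. *)
have main u : (u <= M)%N -> forall l, 0 <= l <= 2 * \prod_(i < u) (1 - w i) ->
    gmean (2 ^ M) (fun x => expR (l * rtrig A (fun k => b k * avgc M u k) x)) <= 20.
  elim: u => [_ l _|u IH uM l /andP[l0 l2]].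
    apply: (@le_trans _ _ (gmean (2 ^ M) (fun=> 1))); last by rewrite gmean_cst//; lra.
    apply: ler_gmean => x; rewrite /rtrig big_seq big1 ?mulr0 ?expR0// => k kA.
    have /andP[k0 k1] := kM1 k kA.
    by rewrite avgc0// mulr0 mul0r.
  have wu0 := w0 u uM; have wu1 := w1 u uM.
  have [] := @prod_1B_ge u.+1 w.
    by move=> i iu; apply: w01; apply: leq_trans uM.
  move=> _ /andP[_ p1].
  have l2' : l <= 2 by apply: le_trans l2 _; lra.
  have wu : 0 < w u < 1 by apply/andP; split=> //; lra.
  apply: le_trans (@gmean_scale_step _ A b M u l (w u) (s u) uM _ wu (lexx _) (sg u uM)) _.
    by rewrite l0 l2'.
  have : gmean (2 ^ M) (fun x =>
     expR (l / (1 - w u) * rtrig A (fun k => b k * avgc M u k) x)) <= 20.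
    apply: IH; first exact: ltnW.
    rewrite divr_ge0//=; last by lra.
    by rewrite ler_pdivrMr; [move: l2; rewrite big_ord_recr /= mulrA|lra].
  set E := gmean _ _; nra.
have [] := prod_1B_ge w01; move=> h _.
have hl : (0 : R) <= 1 <= 2 * \prod_(i < M) (1 - w i).
  by rewrite ler01 /=; move: h sw; lra.
apply: le_trans (main M (leqnn M) 1 hl); apply: ler_gmean => x.
rewrite mul1r ler_expR le_eqVlt; apply/orP; left; apply/eqP.
by apply: eq_rtrig => k _; rewrite /avgc big_geq// mulr1.
Qed.

End Psi1.

(** * Random Riesz products and the Rider property *)

Section SignMean.
Context {R : realType} {I : finType}.
Implicit Types (t c al : I -> R) (s : {ffun I -> bool}).

Definition sgb (e : bool) : R := if e then 1 else -1.

Lemma sum_signs_prod (F : I -> bool -> R) :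
  \sum_(s : {ffun I -> bool}) \prod_i F i (s i) = \prod_i (F i true + F i false).
Proof.
rewrite -(bigA_distr_bigA F) /=; apply: eq_bigr => i _.
by rewrite (bigD1 true) //= (big_pred1 false)// => -[].
Qed.

(** For [|t i| <= 1], the density relative to uniform signs of independent signs with means [t i].
    The formulas below are its moments. *)
Definition riesz t s : R := \prod_i (1 + sgb (s i) * t i).

Lemma pow2E : 2 ^+ #|I| = \prod_(i : I) 2 :> R.
Proof. by rewrite prodr_const. Qed.

Lemma sum_signs_riesz t (D : {set I}) :
  \sum_(s : {ffun I -> bool}) (\prod_(i in D) sgb (s i)) * riesz t s = 2 ^+ #|I| * \prod_(i in D) t i.
Proof.
transitivity (\sum_(s : {ffun I -> bool}) \prod_i
    ((if i \in D then sgb (s i) else 1) * (1 + sgb (s i) * t i))).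
  by apply: eq_bigr => s _; rewrite big_split -big_mkcond.
rewrite (sum_signs_prod (fun i e =>
  (if i \in D then sgb e else 1) * (1 + sgb e * t i))).
rewrite [in RHS]big_mkcond pow2E -big_split /=; apply: eq_bigr => i _.
by rewrite /sgb; case: ifP => _; ring.
Qed.

Lemma sum_signs_riesz2 t t' :
  \sum_(s : {ffun I -> bool}) riesz t s * riesz t' s = 2 ^+ #|I| * \prod_i (1 + t i * t' i).
Proof.
transitivity (\sum_(s : {ffun I -> bool}) \prod_i
    ((1 + sgb (s i) * t i) * (1 + sgb (s i) * t' i))).
  by apply: eq_bigr => s _; rewrite big_split.
rewrite (sum_signs_prod (fun i e => (1 + sgb e * t i) * (1 + sgb e * t' i))).
rewrite pow2E -big_split /=; apply: eq_bigr => i _.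
by rewrite /sgb; ring.
Qed.

Lemma sum_signs_lin t al :
  \sum_(s : {ffun I -> bool}) (\sum_i sgb (s i) * al i) * riesz t s = 2 ^+ #|I| * \sum_i al i * t i.
Proof.
under eq_bigr do rewrite mulr_suml.
rewrite exchange_big /= mulr_sumr; apply: eq_bigr => i _.
transitivity (al i * \sum_(s : {ffun I -> bool}) (\prod_(j in [set i]%SET) sgb (s j)) * riesz t s).
  by rewrite mulr_sumr; apply: eq_bigr => s _; rewrite big_set1; ring.
by rewrite sum_signs_riesz big_set1; ring.
Qed.

Lemma sum_signs_sqr t al :
  \sum_(s : {ffun I -> bool}) (\sum_i sgb (s i) * al i) ^+ 2 * riesz t s =
  2 ^+ #|I| * (\sum_i \sum_j al i * al j * (if i == j then 1 else t i * t j)).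
Proof.
transitivity (\sum_i \sum_j al i * al j * \sum_(s : {ffun I -> bool}) sgb (s i) * sgb (s j) * riesz t s).
  under [RHS]eq_bigr do under eq_bigr do rewrite mulr_sumr.
  under [RHS]eq_bigr do rewrite exchange_big /=.
  rewrite [RHS]exchange_big /=; apply: eq_bigr => s _.
  rewrite expr2 big_distrlr /= mulr_suml; apply: eq_bigr => i _.
  by rewrite mulr_suml; apply: eq_bigr => j _; ring.
rewrite mulr_sumr; apply: eq_bigr => i _.
rewrite mulr_sumr; apply: eq_bigr => j _.
have [<-|ij] := eqVneq i j.
  transitivity (al i * al i * \sum_(s : {ffun I -> bool}) (\prod_(j in finset.set0) sgb (s j)) * riesz t s).
    congr (_ * _); apply: eq_bigr => s _; rewrite big_set0; congr (_ * _).
    by rewrite /sgb; case: (s i); ring.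
  by rewrite sum_signs_riesz big_set0; ring.
transitivity (al i * al j * \sum_(s : {ffun I -> bool}) (\prod_(k in [set i; j]%SET) sgb (s k)) * riesz t s).
  by congr (_ * _); apply: eq_bigr => s _; rewrite big_setU1 ?finset.inE//= big_set1.
by rewrite sum_signs_riesz big_setU1 ?finset.inE//= big_set1; ring.
Qed.

Lemma riesz_ge0 t s : (forall i, `|t i| <= 1) -> 0 <= riesz t s.
Proof.
move=> t1; apply: prodr_ge0 => i _; have := t1 i; rewrite ler_norml => /andP[h1 h2].
by rewrite /sgb; case: (s i); lra.
Qed.

Definition mean (Y : finType) (f : Y -> R) : R := #|Y|%:R^-1 * \sum_y f y.

Lemma ler_mean (Y : finType) (f g : Y -> R) : (forall y, f y <= g y) -> mean f <= mean g.
Proof. by move=> fg; rewrite /mean ler_wpM2l ?invr_ge0//; apply: ler_sum. Qed.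

Lemma meanZ (Y : finType) (k : R) (f : Y -> R) : mean (fun y => k * f y) = k * mean f.
Proof. by rewrite /mean -mulr_sumr mulrCA. Qed.

Lemma meanD (Y : finType) (f g : Y -> R) : mean (fun y => f y + g y) = mean f + mean g.
Proof. by rewrite /mean big_split /= mulrDr. Qed.

Lemma mean_cst (Y : finType) (k : R) : (0 < #|Y|)%N -> mean (fun _ : Y => k) = k.
Proof.
move=> Y0; rewrite /mean sumr_const -[k *+ _]mulr_natl mulrA mulVf ?mul1r//.
by rewrite pnatr_eq0 -lt0n.
Qed.

Lemma exchange_mean (Y Z : finType) (f : Y -> Z -> R) :
  mean (fun y => mean (f y)) = mean (fun z => mean (f^~ z)).
Proof. by rewrite /mean -!mulr_sumr exchange_big /= mulrCA. Qed.

Lemma eq_mean (Y : finType) (f g : Y -> R) : f =1 g -> mean f = mean g.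
Proof. by move=> fg; congr (_ * _); apply: eq_bigr. Qed.

Lemma card_signs : #|{ffun I -> bool}| = (2 ^ #|I|)%N.
Proof. by rewrite card_ffun card_bool. Qed.

Lemma mean_signsE (f : {ffun I -> bool} -> R) : mean f = 2 ^- #|I| * \sum_(s : {ffun I -> bool}) f s.
Proof. by rewrite /mean card_signs natrX. Qed.

(* The random Riesz products [riesz (c * x)] are tested against the random
   polynomials [Z].  Only the second moment of their masses [h] is controlled,
   so [Z] is first truncated at the height [L] via [min(Z, L) >= Z - Z^2/(4L)],
   and the masses exceeding [lam] are absorbed by [(L/lam) h^2]. *)
Lemma sign_duality (Y : finType) (x : I -> Y -> R) al c
    (g : {ffun I -> bool} -> R) (m K : R) :
  (0 < #|Y|)%N ->
  (forall i y, `|x i y| <= 1) -> (forall i, 0 <= al i) ->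
  (forall i, 0 <= c i <= 1) -> m = \sum_i al i * c i -> 1 <= K ->
  \sum_i al i ^+ 2 <= K * m ^+ 2 ->
  mean (fun y => \sum_i al i * c i * x i y ^+ 2) = m / 2 ->
  mean (fun y => mean (fun y' => \prod_i (1 + c i ^+ 2 * (x i y * x i y')))) <= 20 ->
  (forall s, 0 <= g s) ->
  (forall s y, \sum_i sgb (s i) * (al i * x i y) <= g s) ->
  m <= 2 ^+ 11 * (K + 1) * mean g.
Proof.
move=> Y0 x1 al0 c01 mE K1 alK meanm mean2 g0 gZ.
have m0 : 0 <= m.
  by rewrite mE; apply: sumr_ge0 => i _; have /andP[? _] := c01 i; exact: mulr_ge0.
have Eg0 : 0 <= mean g.
  by rewrite /mean mulr_ge0 ?invr_ge0// sumr_ge0.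
have [m00|mn0] := eqVneq m 0.
  by rewrite m00 mulr_ge0// mulr_ge0 ?exprn_ge0// addr_ge0// (le_trans _ K1).
have mp : 0 < m by rewrite lt_def mn0.
(* The main term is [m/2]. This [L] brings the truncation loss [(K+1) m^2/(4L)] to [m/4], and this
   [lam] makes [20 L/lam] at most [m/8]. What is left gives [m/8 <= lam * mean g]. *)
pose L := (K + 1) * m; pose lam := 2 ^+ 8 * (K + 1).
have L0 : 0 < L by rewrite mulr_gt0//; lra.
have lam0 : 0 < lam by rewrite /lam mulr_gt0 ?exprn_gt0//; lra.
pose t y i := c i * x i y.
have t1 y i : `|t y i| <= 1.
  rewrite /t normrM mulr_ile1 ?normr_ge0//.
  by have /andP[? ?] := c01 i; rewrite ger0_norm.
pose Z s y := \sum_i sgb (s i) * (al i * x i y).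
pose h s := mean (fun y => riesz (t y) s).
have h0 s : 0 <= h s.
  by rewrite /h /mean mulr_ge0 ?invr_ge0// sumr_ge0// => y _; exact: riesz_ge0.
have key s : mean (fun y => (Z s y - Z s y ^+ 2 / (4 * L)) * riesz (t y) s)
     <= lam * g s + L / lam * h s ^+ 2.
  apply: (@le_trans _ _ (mean (fun y => Num.min (g s) L * riesz (t y) s))).
    apply: ler_mean => y; rewrite ler_wpM2r ?riesz_ge0//.
    have L40 : 0 < 4 * L by lra.
    have q0 : 0 <= Z s y ^+ 2 / (4 * L) by rewrite divr_ge0 ?sqr_ge0// ltW.
    rewrite le_min; apply/andP; split.
      have := gZ s y; rewrite -/(Z s y); lra.
    rewrite lerBlDr -lerBlDl ler_pdivlMr//.
    have := sqr_ge0 (Z s y - 2 * L); nra.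
  rewrite meanZ -/(h s).
  have gL : Num.min (g s) L <= g s by rewrite ge_min lexx.
  have LL : Num.min (g s) L <= L by rewrite ge_min lexx orbT.
  have mg0 : 0 <= Num.min (g s) L by rewrite le_min g0 ltW.
  have [hl|hl] := leP (h s) lam.
    apply: (@le_trans _ _ (lam * g s)).
      rewrite mulrC; apply: ler_pM => //; exact: h0.
    by rewrite lerDl mulr_ge0 ?sqr_ge0// divr_ge0// ltW.
  apply: (@le_trans _ _ (L / lam * h s ^+ 2)); last first.
    by rewrite lerDr mulr_ge0 ?g0// ltW.
  apply: (@le_trans _ _ (L * h s)); first by rewrite ler_wpM2r.
  rewrite -mulrA ler_pM2l// mulrC ler_pdivlMr// expr2 ler_wpM2l//; exact: ltW.
have Ekey := ler_mean key.
have E1 : mean (fun s => mean (fun y => Z s y * riesz (t y) s)) = m / 2.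
  rewrite exchange_mean -meanm; apply: eq_mean => y.
  rewrite mean_signsE sum_signs_lin mulrA mulVf ?mul1r ?expf_neq0//.
  by apply: eq_bigr => i _; rewrite /t; ring.
(* The diagonal contributes at most [sum al_i^2 <= K m^2]. Off it the terms
   [al_i c_i al_j c_j x_i^2 x_j^2] sum to at most [m^2]. *)
have E2 : mean (fun s => mean (fun y => Z s y ^+ 2 * riesz (t y) s)) <= (K + 1) * m ^+ 2.
  rewrite exchange_mean -[leRHS](mean_cst _ Y0); apply: ler_mean => y.
  rewrite mean_signsE sum_signs_sqr mulrA mulVf ?mul1r ?expf_neq0//.
  rewrite mulrDl mul1r.
  apply: (@le_trans _ _ (\sum_i al i ^+ 2 + \sum_i \sum_j (al i * c i) * (al j * c j))).
    rewrite -big_split /=; apply: ler_sum => i _.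
    rewrite (bigD1 i) //= eqxx mulr1 lerD//.
      rewrite -[leRHS]mulr1 -expr2 exprMn ler_wpM2l ?sqr_ge0//.
      by rewrite -real_normK ?num_real// exprn_ile1.
    rewrite [leRHS](bigD1 i) //= -[leLHS]add0r lerD//.
      by have /andP[? _] := c01 i; rewrite mulr_ge0// mulr_ge0.
    apply: ler_sum => j ji; rewrite ifF; last by rewrite eq_sym (negbTE ji).
    have -> : al i * x i y * (al j * x j y) * (t y i * t y j) =
       (al i * c i * (al j * c j)) * ((x i y) ^+ 2 * (x j y) ^+ 2) by rewrite /t; ring.
    have /andP[ci _] := c01 i; have /andP[cj _] := c01 j.
    rewrite ler_piMr ?mulr_ge0//.
    by rewrite mulr_ile1 ?sqr_ge0// -real_normK ?num_real// exprn_ile1.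
  rewrite lerD// -big_distrlr /= -mE expr2.
  by rewrite lexx.
(* Squaring the mass doubles the point into [y], [y']; averaging over the signs first leaves
   [prod (1 + c_i^2 x_i(y) x_i(y'))]. *)
have E3 : mean (fun s => h s ^+ 2) <= 20.
  have -> : mean (fun s => h s ^+ 2) = mean (fun y => mean (fun y' =>
      \prod_i (1 + c i ^+ 2 * (x i y * x i y')))).
    transitivity (mean (fun s => mean (fun y => mean (fun y' =>
        riesz (t y) s * riesz (t y') s)))).
      apply: eq_mean => s; rewrite expr2 {1}/h mulrC -meanZ; apply: eq_mean => y.
      by rewrite mulrC -meanZ.
    apply: etrans (exchange_mean _) _; apply: eq_mean => y.
    apply: etrans (exchange_mean _) _; apply: eq_mean => y'.
    rewrite mean_signsE sum_signs_riesz2 mulrA mulVf ?mul1r ?expf_neq0//.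
    by apply: eq_bigr => i _; rewrite /t; congr (1 + _); ring.
  by [].
have RE : mean (fun s => lam * g s + L / lam * h s ^+ 2) =
    lam * mean g + L / lam * mean (fun s => h s ^+ 2).
  by rewrite meanD; congr (_ + _); exact: meanZ.
move: Ekey; rewrite RE.
have -> : mean (fun s => mean (fun y => (Z s y - Z s y ^+ 2 / (4 * L)) * riesz (t y) s))
   = m / 2 + - (4 * L)^-1 *
      mean (fun s => mean (fun y => Z s y ^+ 2 * riesz (t y) s)).
  rewrite -E1 -meanZ -meanD; apply: eq_mean => s.
  rewrite -meanZ -meanD; apply: eq_mean => y; rewrite mulrBl; congr (_ + _).
  by rewrite [RHS]mulNr; congr (- _); rewrite [RHS]mulrCA mulrA.
set X := mean _ in E2 *; set H := mean _ in E3 *; set G := mean _ in Eg0 *.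
move=> Ekey.
have q1 : (4 * L)^-1 * X <= m / 4.
  rewrite mulrC ler_pdivrMr; last by lra.
  apply: le_trans E2 _; rewrite /L; nra.
have q2 : L / lam * H <= m / 8.
  apply: (@le_trans _ _ (L / lam * 20)).
    by rewrite ler_wpM2l// divr_ge0// ltW.
  have -> : L / lam = m / 2 ^+ 8.
    rewrite /L /lam; field; apply/eqP; lra.
  lra.
have : m / 8 <= lam * G by lra.
rewrite /lam; lra.
Qed.

End SignMean.

(** * The 4/3 inequality for uniform signs *)

Section RiderSigns.
Context {R : realType}.
Implicit Types (x t : R) (A : {fset nat}) (a b : nat -> R[i]).

Lemma le_normc_sum (I : Type) (r : seq I) (P : pred I) (F : I -> R[i]) :
  normc (\sum_(i <- r | P i) F i) <= \sum_(i <- r | P i) normc (F i).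
Proof.
elim/big_rec2: _ => [|i z u _ h]; first by rewrite ComplexField.Normc.normc0.
by apply: le_trans (le_normcD _ _) _; rewrite lerD2l.
Qed.

Lemma normc_trigpoly_le A a x : normc (trigpoly A a x) <= \sum_(k <- A) normc (a k).
Proof.
apply: le_trans (le_normc_sum _ _ _) _; apply: ler_sum => k _.
by rewrite ComplexField.Normc.normcM normc_expc mulr1.
Qed.

Lemma normc_le_supnorm A a x : normc (trigpoly A a x) <= supnorm (trigpoly A a).
Proof.
apply: ub_le_sup; last by exists x.
by exists (\sum_(k <- A) normc (a k)) => _ [y _ <-]; exact: normc_trigpoly_le.
Qed.

Lemma supnorm_ge0 A a : 0 <= supnorm (trigpoly A a).
Proof. exact: le_trans (normc_ge0 _) (normc_le_supnorm A a 0). Qed.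

Lemma Re_trigpoly A a x : complex.Re (trigpoly A a x) = rtrig A a x.
Proof. exact: Re_sum. Qed.

Lemma mulRe (z z' : R[i]) : complex.Re z * complex.Re z' =
  (complex.Re (z * z') + complex.Re (z * conjc z')) / 2.
Proof. by case: z => u v; case: z' => u' v' /=; field. Qed.

Lemma mulcJ (z : R[i]) : z * conjc z = (normc z ^+ 2)%:C%C.
Proof.
rewrite sqr_normcE; case: z => u v /=.
by apply/eqP; rewrite eq_complex /=; apply/andP; split; apply/eqP; ring.
Qed.

Lemma mean_gmean N (g : R -> R) :
  mean (fun y : 'I_N => g ((y : nat)%:R / N%:R)) = gmean N g.
Proof. by rewrite /mean card_ord. Qed.

Lemma gmean_Re_expc N (z : R[i]) (k : nat) : (0 < k < N)%N ->
  gmean N (fun x => complex.Re (z * expc k x)) = 0.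
Proof.
move=> /andP[k0 kN].
rewrite /gmean -Re_sum -mulr_sumr sum_expc_grid; last exact: leq_ltn_trans kN.
rewrite ifF ?mulr0 ?mulr0//=.
by apply/negP; rewrite dvdzE /= => /(dvdn_leq k0); rewrite leqNgt kN.
Qed.

(** The value 1 off [A] is a default that [trigpoly A] never reads. *)
Definition extsign A (s : {ffun A -> bool}) (k : nat) : R :=
  if insub k is Some k' then sgb (s k') else 1.

Lemma extsignE A (s : {ffun A -> bool}) (k : A) : extsign s (val k) = sgb (s k).
Proof. by rewrite /extsign valK. Qed.

(** The equality case of Holder's inequality for the exponents 4/3 and 4: with [r_k = |a_k|^(1/3)]
    and [c_k] proportional to [r_k], both [sum |a_k| c_k] and [sum c_k^4] are multiples of
    [rho^4 = sum r_k^4 = sum |a_k|^(4/3)]. The left side is [rho^3]. *)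
Theorem rider_signs A a :
  (forall k, k \in A -> (0 < k)%N) ->
  (forall n, quasi_independent (block A n)) ->
  (\sum_(k <- A) normc (a k) `^ (4 / 3)) `^ (4 / 3)^-1 <=
  2 ^+ 5 * (2 ^+ 11 * (2 ^+ 10 + 1)) *
    mean (fun s : {ffun A -> bool} =>
            supnorm (trigpoly A (fun k => (extsign s k)%:C%C * a k))).
Proof.
move=> A0 qA.
pose al k := normc (a k).
pose r k := al k `^ 3^-1.
pose S := \sum_(k <- A) r k ^+ 4.
pose rho := S `^ 4^-1.
have al0 k : 0 <= al k by exact: normc_ge0.
have r0 k : 0 <= r k by exact: powR_ge0.
have r3 k : r k ^+ 3 = al k.
  by rewrite -powR_mulrn// -powRrM mulVf ?pnatr_eq0// powRr1.
have S0 : 0 <= S by apply: sumr_ge0 => k _; rewrite exprn_ge0.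
have rho0 : 0 <= rho by exact: powR_ge0.
have rho4 : rho ^+ 4 = S.
  by rewrite -powR_mulrn// -powRrM mulVf ?pnatr_eq0// powRr1.
have -> : (\sum_(k <- A) normc (a k) `^ (4 / 3)) `^ (4 / 3)^-1 = rho ^+ 3.
  have -> : \sum_(k <- A) normc (a k) `^ (4 / 3) = S.
    apply: eq_bigr => k _; rewrite -powR_mulrn// -powRrM; congr (_ `^ _).
    by rewrite mulrC.
  by rewrite -powR_mulrn// -powRrM; congr (_ `^ _); field.
have G0 : 0 <= mean (fun s : {ffun A -> bool} =>
            supnorm (trigpoly A (fun k => (extsign s k)%:C%C * a k))).
  by rewrite /mean mulr_ge0 ?invr_ge0// sumr_ge0// => s _; exact: supnorm_ge0.
have [rho00|rhon0] := eqVneq rho 0.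
  by rewrite rho00 expr0n /= mulr_ge0// mulr_ge0 ?exprn_ge0// mulr_ge0 ?exprn_ge0.
have rhop : 0 < rho by rewrite lt_def rhon0.
have rrho k : k \in A -> r k <= rho.
  move=> kA; rewrite -(ler_pXn2r (n := 4)) ?nnegrE// rho4.
  by rewrite /S (big_fsetD1 k)//= lerDl sumr_ge0// => j _; rewrite exprn_ge0.
(* Then [sum c_k^4 = 2^-20], just below [10^-6]. *)
pose c k := 2^-1 ^+ 5 * r k / rho.
(* The phase of [a k]. Division by 0 makes it 0 when [a k = 0], so [|v k| <= 1] always, with
   equality only when [al k] is nonzero. *)
pose v k := a k / (al k)%:C%C.
have vE k : (al k)%:C%C * v k = a k.
  rewrite /v; have [ak|ak] := eqVneq (al k) 0.
    by rewrite ak mul0r; apply/esym/ComplexField.Normc.eq0_normc.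
  by rewrite mulrC divfK// fmorph_eq0.
have v1 k : normc (v k) <= 1.
  rewrite /v ComplexField.Normc.normcM ComplexField.Normc.normcV normc_real.
  rewrite ger0_norm// -/(al k); have [->|ak] := eqVneq (al k) 0; first by rewrite mul0r.
  by rewrite divff.
have vn k : al k != 0 -> normc (v k) = 1.
  move=> ak; rewrite /v ComplexField.Normc.normcM ComplexField.Normc.normcV normc_real.
  by rewrite ger0_norm// divff.
clearbody v.
pose M := (2 * \sum_(k <- A) k)%N.
have AM : (2 * \sum_(k <- A) k < 2 ^ M)%N by rewrite ltn_expl.
pose N := (2 ^ M)%N.
have N0 : (0 < N)%N by rewrite expn_gt0.
pose x (i : A) (y : 'I_N) := complex.Re (v (val i) * expc (val i) ((y : nat)%:R / N%:R : R)).
have kN (k : A) : (0 < 2 * val k < N)%N.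
  rewrite muln_gt0 /= A0 ?(valP k)//=; apply: leq_ltn_trans AM.
  by rewrite leq_mul2l /= leq_sum_fset// (valP k).
have c4 : \sum_(k <- A) c k ^+ 4 <= 10 ^- 6.
  have -> : \sum_(k <- A) c k ^+ 4 = (2^-1 ^+ 5) ^+ 4 * rho ^- 4 * S.
    by rewrite /S mulr_sumr; apply: eq_bigr => k _; rewrite /c; field.
  rewrite -rho4 divfK ?expf_neq0//; lra.
have psi1 b : {in A, forall k, normc (b k) <= 1} ->
    gmean N (fun x => expR (rtrig A (fun k => (c k ^+ 2)%:C%C * b k) x)) <= 20.
  move=> b1; apply: gmean_expR_rtrig_le => //.
  apply: le_trans c4; rewrite big_seq [leRHS]big_seq; apply: ler_sum => k kA.
  rewrite ComplexField.Normc.normcM normc_real ger0_norm ?sqr_ge0//.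
  rewrite exprMn -exprM ler_piMr ?exprn_ge0 ?divr_ge0 ?mulr_ge0 ?exprn_ge0 ?invr_ge0//.
  by rewrite exprn_ile1 ?normc_ge0 ?b1.
pose m := \sum_(i : A) al (val i) * c (val i).
have mE : m = 2^-1 ^+ 5 * rho ^+ 3.
  have -> : m = \sum_(k <- A) al k * c k by rewrite big_seq_fsetE.
  transitivity (2^-1 ^+ 5 / rho * S); last by rewrite -rho4; field.
  by rewrite /S mulr_sumr; apply: eq_bigr => k _; rewrite /c -r3; field.
have h1 : (0 < #|'I_N|)%N by rewrite card_ord.
have h2 (i : A) (y : 'I_N) : `|x i y| <= 1.
  apply: le_trans (normc_geRe _) _.
  by rewrite ComplexField.Normc.normcM normc_expc mulr1.
have h3 (i : A) : 0 <= c (val i) <= 1.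
  rewrite /c divr_ge0 ?mulr_ge0 ?exprn_ge0 ?invr_ge0//= ler_pdivrMr// mul1r.
  by have := rrho _ (valP i); have := r0 (val i); lra.
have h4 : 1 <= 2 ^+ 10 :> R by rewrite exprn_ege1// ler1n.
(* [|a_k|^2 = r_k^6 <= rho^2 r_k^4] sums to at most [rho^6], and [m = 2^-5 rho^3]; hence
   [K = 2^10]. *)
have h5 : \sum_(i : A) al (val i) ^+ 2 <= 2 ^+ 10 * m ^+ 2.
  have -> : 2 ^+ 10 * m ^+ 2 = rho ^+ 2 * S by rewrite mE -rho4; field.
  have -> : \sum_(i : A) al (val i) ^+ 2 = \sum_(k <- A) al k ^+ 2.
    by rewrite [RHS]big_seq_fsetE.
  rewrite /S mulr_sumr.
  rewrite big_seq [leRHS]big_seq; apply: ler_sum => k kA.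
  have -> : al k ^+ 2 = r k ^+ 2 * r k ^+ 4 by rewrite -r3; ring.
  by rewrite ler_wpM2r ?exprn_ge0// lerXn2r ?nnegrE// rrho.
have h6 : mean (fun y => \sum_(i : A) al (val i) * c (val i) * x i y ^+ 2) = m / 2.
  (* The square of the real part is 1/2 plus half of a term of frequency [2k], which averages to 0
     because [2k < N]. *)
  have sq (i : A) (y : 'I_N) : al (val i) * c (val i) * x i y ^+ 2 =
     al (val i) * c (val i) / 2 +
     complex.Re ((al (val i) * c (val i) / 2)%:C%C * (v (val i)) ^+ 2 * expc (2 * val i)%N%:Z ((y : nat)%:R / N%:R)).
    rewrite -[X in complex.Re X]mulrA ReZ PoszM expc_muln -exprMn.
    rewrite /x expr2 mulRe mulcJ -expr2 /= ComplexField.Normc.normcM normc_expc mulr1.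
    have [->|ak] := eqVneq (al (val i)) 0; first by ring.
    by rewrite vn//; field.
  pose Q z := \sum_(i : A) complex.Re ((al (val i) * c (val i) / 2)%:C%C *
    (v (val i)) ^+ 2 * expc (2 * val i)%N%:Z (z : R)).
  transitivity (mean (fun y : 'I_N => m / 2 + Q ((y : nat)%:R / N%:R))).
    apply: eq_mean => y; rewrite /m mulr_suml -big_split /=.
    by apply: eq_bigr => i _; exact: sq.
  rewrite meanD mean_cst// mean_gmean gmean_sum big1 ?addr0// => i _.
  by rewrite gmean_Re_expc.
have h7 : mean (fun y => mean (fun y' => \prod_(i : A)
    (1 + c (val i) ^+ 2 * (x i y * x i y')))) <= 20.
  rewrite -[leRHS](mean_cst _ h1); apply: ler_mean => y.
  (* For fixed [y], a product of two real parts is half the sum of two real parts, one with the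
     phases added and one with them subtracted. Convexity of the exponential separates the two
     polynomials in [y'], whose coefficients are both at most [c_k^2] in modulus. *)
  pose bp k := (c k ^+ 2)%:C%C * (v k ^+ 2 * expc k ((y : nat)%:R / N%:R : R)).
  pose bq k := (c k ^+ 2)%:C%C * (v k * conjc (v k * expc k ((y : nat)%:R / N%:R : R))).
  apply: (@le_trans _ _ (gmean N (fun z =>
      2^-1 * expR (rtrig A bp z) + 2^-1 * expR (rtrig A bq z)))); last first.
    rewrite gmeanD !gmeanZ.
    have := psi1 (fun k => v k ^+ 2 * expc k ((y : nat)%:R / N%:R : R)).
    have := psi1 (fun k => v k * conjc (v k * expc k ((y : nat)%:R / N%:R : R))).
    rewrite -/bp -/bq => hq hp.
    have {}hp : gmean N (fun z => expR (rtrig A bp z)) <= 20.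
      apply: hp => k _; rewrite expr2 !ComplexField.Normc.normcM normc_expc mulr1.
      by rewrite mulr_ile1 ?normc_ge0.
    have {}hq : gmean N (fun z => expR (rtrig A bq z)) <= 20.
      apply: hq => k _; rewrite ComplexField.Normc.normcM mulr_ile1 ?normc_ge0//.
      have -> (z : R[i]) : normc (conjc z) = normc z by case: z => ? ? /=; rewrite sqrrN.
      by rewrite ComplexField.Normc.normcM normc_expc mulr1.
    lra.
  rewrite -mean_gmean; apply: ler_mean => y'.
  apply: (@le_trans _ _ (expR (\sum_(i : A) c (val i) ^+ 2 * (x i y * x i y')))).
    rewrite expR_sum; apply: ler_prod => i _; rewrite expR_ge1Dx andbT.
    have : `|c (val i) ^+ 2 * (x i y * x i y')| <= 1.
      have /andP[c0 c1] := h3 i.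
      rewrite normrM mulr_ile1 ?normr_ge0//; last by rewrite normrM mulr_ile1 ?normr_ge0.
      by rewrite normrX exprn_ile1 ?normr_ge0// ger0_norm.
    by rewrite ler_norml; lra.
  have -> : \sum_(i : A) c (val i) ^+ 2 * (x i y * x i y') =
     (1 - 2^-1) * rtrig A bp ((y' : nat)%:R / N%:R) + 2^-1 * rtrig A bq ((y' : nat)%:R / N%:R).
    have -> : 1 - 2^-1 = 2^-1 :> R by field.
    rewrite -mulrDr -rtrigD /rtrig big_seq_fsetE /= mulr_sumr; apply: eq_bigr => i _.
    set e' := expc _ _; set k := fsval i.
    have -> : (bp k + bq k) * e' = (c k ^+ 2)%:C%C *
       ((v k * e') * (v k * expc k ((y : nat)%:R / N%:R : R)) +
        (v k * e') * conjc (v k * expc k ((y : nat)%:R / N%:R : R))).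
      rewrite /bp /bq; ring.
    rewrite ReZ ReD [x i y * _]mulrC /x mulRe.
    by rewrite [RHS]mulrCA; congr (_ * _); rewrite mulrC.
  have -> : 2^-1 * expR (rtrig A bp ((y' : nat)%:R / N%:R)) +
            2^-1 * expR (rtrig A bq ((y' : nat)%:R / N%:R)) =
     (1 - 2^-1) * expR (rtrig A bp ((y' : nat)%:R / N%:R)) +
            2^-1 * expR (rtrig A bq ((y' : nat)%:R / N%:R)).
    by congr (_ * _ + _); field.
  by apply: expR_convex; lra.
have h8 (s : {ffun A -> bool}) :
  0 <= supnorm (trigpoly A (fun k => (extsign s k)%:C%C * a k)) by exact: supnorm_ge0.
have h9 (s : {ffun A -> bool}) (y : 'I_N) : \sum_(i : A) sgb (s i) * (al (val i) * x i y) <=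
    supnorm (trigpoly A (fun k => (extsign s k)%:C%C * a k)).
  apply: le_trans (normc_le_supnorm _ _ ((y : nat)%:R / N%:R)).
  apply: le_trans (le_trans (ler_norm _) (normc_geRe _)).
  rewrite Re_trigpoly le_eqVlt; apply/orP; left; apply/eqP.
  rewrite /rtrig big_seq_fsetE /=; apply: eq_bigr => i _.
  by rewrite -mulrA ReZ extsignE -[a _]vE -mulrA ReZ.
have := @sign_duality R A 'I_N x (fun i => al (val i)) (fun i => c (val i))
  (fun s => supnorm (trigpoly A (fun k => (extsign s k)%:C%C * a k))) m (2 ^+ 10).
move=> /(_ h1 h2 (fun i => al0 _) h3 erefl h4 h5 h6 h7 h8 h9).
rewrite mE.
set G := mean _; set K := 2 ^+ 11 * _ => h.
have -> : rho ^+ 3 = 2 ^+ 5 * (2^-1 ^+ 5 * rho ^+ 3) by field.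
by rewrite -[leRHS]mulrA ler_pM2l// exprn_gt0.
Qed.

End RiderSigns.

(** * Integration on the circle *)

Section CircleIntegral.
Context {R : realType}.
Implicit Types (f g : R -> R).
Local Notation cmu := (circle_measure R).

Lemma circle_measureE (A : set R) :
  cmu A = lebesgue_measure (A `&` `[0, 1[%classic).
Proof. by []. Qed.

Lemma circle_measureT : cmu setT = 1%E.
Proof.
by rewrite circle_measureE setTI lebesgue_measure_itv /= lte_fin ltr01 oppr0 adde0.
Qed.

Lemma circle_integralE (g : measurableTypeR R -> \bar R) : measurable_fun setT g ->
  (\int[cmu]_x g x = \int[@lebesgue_measure R]_(x in `[0%R, 1%R[) g x)%E.
Proof.
move=> mg.
have mI : measurable (`[0%R, 1%R[ : set (measurableTypeR R)) by exact: measurable_itv.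
have h (u : measurableTypeR R -> \bar R) : measurable_fun setT u -> (forall x, 0 <= u x)%E ->
    (\int[cmu]_x u x = \int[@lebesgue_measure R]_(x in `[0%R, 1%R[) u x)%E.
  move=> mu u0.
  rewrite (@ge0_negligible_integral _ _ _ cmu setT (~` `[0%R, 1%R[))//.
  - rewrite setDE setTI setCK; apply: eq_measure_integral => A mA AI.
    by rewrite circle_measureE (setIidl AI).
  - exact: measurableC.
  - by rewrite circle_measureE setICl measure0.
rewrite integralE [RHS]integralE !h//.
- exact: measurable_funeneg.
- exact: measurable_funepos.
Qed.

Lemma integrable_circle f (M : R) : measurable_fun setT f ->
  (forall x, `|f x| <= M) -> cmu.-integrable setT (EFin \o f).
Proof.
move=> mf fM; apply: measurable_bounded_integrable => //.
- by rewrite [X in (X < _)%E]circle_measureT ltry.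
- exists M; split; first exact: num_real.
  by move=> y My x _; apply: le_trans (fM x) (ltW My).
Qed.

Lemma integral_circle_FTC (f F : R -> R) : continuous f -> measurable_fun setT f ->
  (forall x : R, is_derive x 1 F (f x)) ->
  Rintegral cmu setT f = F 1 - F 0.
Proof.
move=> cf mf dF.
rewrite /Rintegral circle_integralE; last exact/measurable_EFinP.
rewrite integral_itv_bndo_bndc; last first.
  by apply: (measurable_funS measurableT) => //; exact/measurable_EFinP.
rewrite (@continuous_FTC2 _ f F)//.
- exact: continuous_subspaceT.
- have cF x : {for x, continuous F}.
    by apply: differentiable_continuous; apply/derivable1_diffP; case: (dF x).
  split.
  + by move=> x _; case: (dF x).
  + exact: cvg_at_right_filter (cF 0).
  + exact: cvg_at_left_filter (cF 1).
- by move=> x _; rewrite derive1E; have [_ ->] := dF x.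
Qed.

Lemma continuous_cosM (c : R) : continuous (fun x => cos (c * x)).
Proof.
move=> x; apply: continuous_comp; last exact: continuous_cos.
exact: mulrl_continuous.
Qed.

Lemma continuous_sinM (c : R) : continuous (fun x => sin (c * x)).
Proof.
move=> x; apply: continuous_comp; last exact: continuous_sin.
exact: mulrl_continuous.
Qed.

Lemma Rintegral_cos (c : R) : c != 0 -> cos c = 1 -> sin c = 0 ->
  Rintegral cmu setT (fun x => cos (c * x)) = 0 /\
  Rintegral cmu setT (fun x => sin (c * x)) = 0.
Proof.
move=> c0 c1 s0; split.
- have dF (x : R) : is_derive x 1 (fun x => c^-1 * sin (c * x)) (cos (c * x)).
    by apply: is_derive_eq; rewrite /GRing.scale /= mulr1; field.
  rewrite (integral_circle_FTC _ _ dF).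
  + by rewrite mulr1 mulr0 s0 sin0 subrr.
  + exact: continuous_cosM.
  + by apply: continuous_measurable_fun; exact: continuous_cosM.
- have dF (x : R) : is_derive x 1 (fun x => - c^-1 * cos (c * x)) (sin (c * x)).
    by apply: is_derive_eq; rewrite /GRing.scale /= mulr1; field.
  rewrite (integral_circle_FTC _ _ dF).
  + by rewrite mulr1 mulr0 c1 cos0 subrr.
  + exact: continuous_sinM.
  + by apply: continuous_measurable_fun; exact: continuous_sinM.
Qed.

Definition cintegrable (f : R -> R[i]) : Prop :=
  cmu.-integrable setT (EFin \o (fun x => complex.Re (f x))) /\
  cmu.-integrable setT (EFin \o (fun x => complex.Im (f x))).

Lemma ImD (z1 z2 : R[i]) : complex.Im (z1 + z2) = complex.Im z1 + complex.Im z2.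
Proof. by case: z1 => ? ?; case: z2. Qed.

Lemma complex_ReM (z1 z2 : R[i]) : complex.Re (z1 * z2) =
  complex.Re z1 * complex.Re z2 + (- complex.Im z1) * complex.Im z2.
Proof. by case: z1 => ? ?; case: z2 => ? ?; rewrite /= mulNr. Qed.

Lemma complex_ImM (z1 z2 : R[i]) : complex.Im (z1 * z2) =
  complex.Re z1 * complex.Im z2 + complex.Im z1 * complex.Re z2.
Proof. by case: z1 => ? ?; case: z2. Qed.

Lemma integrable_circleD (f g : R -> R) :
  cmu.-integrable setT (EFin \o f) -> cmu.-integrable setT (EFin \o g) ->
  cmu.-integrable setT (EFin \o (fun x => f x + g x)).
Proof.
move=> hf hg; rewrite (_ : _ \o _ = (EFin \o f) \+ (EFin \o g))%E//.
exact: integrableD.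
Qed.

Lemma integrable_circleZ (k : R) (f : R -> R) :
  cmu.-integrable setT (EFin \o f) ->
  cmu.-integrable setT (EFin \o (fun x => k * f x)).
Proof.
move=> hf; rewrite (_ : _ \o _ = (fun x => k%:E * (EFin \o f) x))%E//.
exact: integrableZl.
Qed.

Lemma cintegrableD (f g : R -> R[i]) : cintegrable f -> cintegrable g ->
  cintegrable (fun x => f x + g x).
Proof.
move=> [f1 f2] [g1 g2]; split.
- under eq_fun do rewrite ReD; exact: integrable_circleD.
- under eq_fun do rewrite ImD; exact: integrable_circleD.
Qed.

Lemma cintegrableZ (z : R[i]) (f : R -> R[i]) : cintegrable f -> cintegrable (fun x => z * f x).
Proof.
move=> [f1 f2]; split.
- under eq_fun do rewrite complex_ReM; apply: integrable_circleD; exact: integrable_circleZ.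
- under eq_fun do rewrite complex_ImM; apply: integrable_circleD; exact: integrable_circleZ.
Qed.

Lemma circle_integralD (f g : R -> R[i]) : cintegrable f -> cintegrable g ->
  circle_integral (fun x => f x + g x) = circle_integral f + circle_integral g.
Proof.
move=> [f1 f2] [g1 g2]; rewrite /circle_integral.
under eq_Rintegral do rewrite ReD.
rewrite RintegralD//.
under [X in (_ +i* X)%C = _]eq_Rintegral do rewrite ImD.
by rewrite RintegralD.
Qed.

Lemma circle_integralZ (z : R[i]) (f : R -> R[i]) : cintegrable f ->
  circle_integral (fun x => z * f x) = z * circle_integral f.
Proof.
move=> [f1 f2]; rewrite /circle_integral.
under eq_Rintegral do rewrite complex_ReM.
rewrite RintegralD//; try exact: integrable_circleZ.
rewrite !RintegralZl//.
under [X in (_ +i* X)%C = _]eq_Rintegral do rewrite complex_ImM.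
rewrite RintegralD//; try exact: integrable_circleZ.
rewrite !RintegralZl//.
by case: z => u v /=; rewrite mulNr.
Qed.

Lemma cintegrable_expc n : cintegrable (expc n).
Proof.
split; apply: (@integrable_circle _ 1).
- by apply: continuous_measurable_fun; exact: continuous_cosM.
- by move=> x; exact: cos_max.
- by apply: continuous_measurable_fun; exact: continuous_sinM.
- by move=> x; exact: sin_max.
Qed.

Lemma Rintegral_circle_cst (c : R) : Rintegral cmu setT (fun=> c) = c.
Proof.
by rewrite Rintegral_cst// /fine circle_measureT mulr1.
Qed.

Lemma circle_integral_expc n :
  circle_integral (expc n) = if n == 0 then 1 else 0 :> R[i].
Proof.
have [->|n0] := eqVneq n 0.
  rewrite /circle_integral; under eq_Rintegral do rewrite expc0 /=.
  rewrite Rintegral_circle_cst.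
  under eq_Rintegral do rewrite expc0 /=.
  by rewrite Rintegral_circle_cst.
have [] := @Rintegral_cos (2 * pi * n%:~R).
- by rewrite !mulf_neq0 ?intr_eq0// gt_eqF// pi_gt0.
- by have /(congr1 (@complex.Re R)) := expc_1 (R := R) n; rewrite /= mulr1.
- by have /(congr1 (@complex.Im R)) := expc_1 (R := R) n; rewrite /= mulr1.
by rewrite /circle_integral /= => -> ->.
Qed.

(** Frequencies may be negative and may repeat, so that products and conjugates are computed on
    lists without collecting terms. *)
Definition trigsum (s : seq (int * R[i])) (x : R) : R[i] := \sum_(u <- s) u.2 * expc u.1 x.

Lemma cintegrable_trigsum s : cintegrable (trigsum s).
Proof.
elim: s => [|u s IH].
  rewrite (_ : trigsum [::] = fun x => 0 * expc 0 x); last first.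
    by apply/funext => x; rewrite /trigsum big_nil mul0r.
  exact: (cintegrableZ 0 (cintegrable_expc 0)).
rewrite (_ : trigsum _ = fun x => u.2 * expc u.1 x + trigsum s x); last first.
  by apply/funext => x; rewrite /trigsum big_cons.
by apply: cintegrableD => //; exact: (cintegrableZ _ (cintegrable_expc _)).
Qed.

Lemma circle_integral_trigsum s :
  circle_integral (trigsum s) = \sum_(u <- s | u.1 == 0) u.2.
Proof.
elim: s => [|u s IH].
  rewrite (_ : trigsum [::] = fun x => 0 * expc 0 x); last first.
    by apply/funext => x; rewrite /trigsum big_nil mul0r.
  by rewrite circle_integralZ ?mul0r ?big_nil//; exact: cintegrable_expc.
rewrite (_ : trigsum _ = fun x => u.2 * expc u.1 x + trigsum s x); last first.
  by apply/funext => x; rewrite /trigsum big_cons.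
rewrite circle_integralD; last 2 first.
- exact: (cintegrableZ _ (cintegrable_expc _)).
- exact: cintegrable_trigsum.
rewrite IH circle_integralZ; last exact: cintegrable_expc.
rewrite circle_integral_expc big_cons.
by case: ifP => _; rewrite ?mulr1// mulr0 add0r.
Qed.

Lemma fourier_trigpoly (A : {fset nat}) (a : nat -> R[i]) k : k \in A ->
  fourier (trigpoly A a) k%:Z = a k.
Proof.
move=> kA; rewrite /fourier.
rewrite (_ : (fun x => _) = trigsum [seq (j%:Z - k%:Z, a j) | j <- A]); last first.
  apply/funext => x; rewrite /trigsum big_map /trigpoly mulr_suml.
  by apply: eq_bigr => j _; rewrite /= expcD mulrA.
rewrite circle_integral_trigsum big_map big_mkcond /= (big_fsetD1 k)//= subrr eqxx.
rewrite big_seq big1 ?addr0// => j.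
by rewrite !inE => /andP[jk _]; rewrite subr_eq0 eqz_nat (negbTE jk).
Qed.

End CircleIntegral.

(** * From uniform signs to arbitrary Rademacher sequences *)

Section IntegralLowerBound.
Context d (T : measurableType d) (R : realType) (mu : {measure set T -> \bar R}).
Import HBNNSimple.

(* The integral of a nonnegative function, measurable or not, is the supremum
   over the simple functions below it; here [f] is a supremum norm. *)
Lemma sum_indic_le_integral (I : finType) (E : I -> set T) (G : I -> R)
    (f : T -> \bar R) :
  (forall i, measurable (E i)) -> (forall i, 0 <= G i) ->
  (forall x, 0 <= f x)%E ->
  (forall i x, E i x -> (G i)%:E <= f x)%E ->
  (forall i j x, E i x -> E j x -> i = j) ->
  (\sum_i (G i)%:E * mu (E i) <= \int[mu]_x f x)%E.
Proof.
move=> mE G0 f0 Gf Einj.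
pose h := \big[(@add_nnsfun _ T R)/nnsfun0]_(i : I)
  scale_nnsfun (indic_nnsfun R (mE i)) (G0 i).
have hE x : h x = \sum_i G i * \1_(E i) x.
  rewrite /h; elim/big_ind2 : _ => [|u v p q <- <-|i _] //.
have hf x : ((h x)%:E <= f x)%E.
  rewrite hE; have [[i Eix]|nE] := pselect (exists i, E i x).
    rewrite (bigD1 i) //= big1 ?addr0.
      by rewrite indicE mem_set// mulr1; exact: Gf.
    move=> j ji; rewrite indicE memNset ?mulr0// => Ejx.
    by move/eqP: ji; apply; exact: Einj Ejx Eix.
  rewrite big1 ?f0// => i _; rewrite indicE memNset ?mulr0// => Eix.
  by apply: nE; exists i.
have -> : (\sum_i (G i)%:E * mu (E i) = \int[mu]_x (h x)%:E)%E.
  transitivity (\int[mu]_x (\sum_i (G i)%:E * (\1_(E i) x)%:E)%E)%E.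
    rewrite ge0_integral_sum//.
    - apply: eq_bigr => i _; rewrite ge0_integralZl_EFin//.
      + by rewrite integral_indic// setIT.
      + by apply/measurable_EFinP; exact: measurable_indic.
    - move=> i; apply/measurable_EFinP; exact: measurable_funM.
    - by move=> i x _; rewrite -EFinM lee_fin mulr_ge0.
  by apply: eq_integral => x _; rewrite hE sumEFin.
rewrite integralT_nnsfun ge0_integralTE//.
by apply: ereal_sup_ubound; exists h.
Qed.

End IntegralLowerBound.

Section RiderSet.
Context {R : realType}.
Implicit Types (A : {fset nat}) (a : nat -> R[i]).

(** The events prescribing the signs on [A] are disjoint, of probability [2^-|A|] each, and the
    supremum norm is constant on each of them. The inequality is the direction in which the
    expectation dominates simple functions. *)
Lemma mean_supnorm_le_bracket (d : measure_display) (Omega : measurableType d)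
    (P : probability Omega R) (eps : nat -> {RV P >-> R}) A a :
  rademacher eps -> (forall k, k \in A -> (0 < k)%N) ->
  ((mean (fun s : {ffun A -> bool} =>
     supnorm (trigpoly A (fun k => (extsign s k)%:C%C * a k))))%:E <=
   bracket eps A a)%E.
Proof.
move=> [ind e1 eN1] A0.
rewrite /bracket unlock.
pose G (s : {ffun A -> bool}) :=
  supnorm (trigpoly A (fun k => (extsign s k)%:C%C * a k)).
pose E (s : {ffun A -> bool}) : set Omega :=
  \bigcap_(j in [set` A]) (eps j @^-1` [set extsign s j : R]).
have mE s : measurable (E s).
  apply: fin_bigcap_measurable; first exact: finite_fset.
  move=> j _; rewrite -[X in measurable X]setTI.
  have mj : measurable_fun setT (eps j) by exact: measurable_funPT.
  exact: (mj measurableT _ (measurable_set1 _)).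
have PE s : P (E s) = ((2 ^- #|{: A}|)%:E)%E.
  rewrite ind; last 2 first.
  - by move=> k kA; exact: A0.
  - by move=> j _; exact: measurable_set1.
  rewrite (eq_big_seq (fun=> (2^-1)%:E)); last first.
    move=> k kA; have k0 := A0 k kA.
    have -> : extsign s k = sgb (s [` kA]%fset) :> R by exact: (extsignE s [` kA]%fset).
    by rewrite /sgb; case: ifP => _; [exact: e1|exact: eN1].
  by rewrite big_seq_fsetE /= prodEFin prodr_const exprVn.
apply: (@le_trans _ _ (\sum_s (G s)%:E * P (E s))%E).
  under eq_bigr do rewrite PE -EFinM.
  by rewrite sumEFin lee_fin mean_signsE -mulr_suml mulrC.
apply: sum_indic_le_integral => //.
- by move=> s; exact: supnorm_ge0.
- by move=> w; rewrite lee_fin; exact: supnorm_ge0.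
- move=> s w Esw; rewrite lee_fin le_eqVlt; apply/orP; left; apply/eqP.
  rewrite /G; congr supnorm; apply/funext => x; apply: eq_big_seq => k kA.
  by have <- := Esw k kA.
- move=> s s' w Es Es'; apply/ffunP => k.
  have h1 := Es _ (valP k); have h2 := Es' _ (valP k).
  have : sgb (s k) = sgb (s' k) :> R by rewrite -!extsignE -h1 -h2.
  rewrite /sgb; case: (s k); case: (s' k) => // /eqP.
    by rewrite -subr_eq0 opprK -mulr2n pnatr_eq0.
  by rewrite eq_sym -subr_eq0 opprK -mulr2n pnatr_eq0.
Qed.

Definition blockwise_independent (Lambda : set nat) : Prop :=
  Lambda `<=` posnat /\ forall A : {fset nat}, [set` A] `<=` Lambda ->
    forall n, quasi_independent (block A n).

Theorem blockwise_independent_Rider (Lambda : set nat) :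
  blockwise_independent Lambda -> Rider (4 / 3 : R) Lambda.
Proof.
move=> [L0 qL]; exists (2 ^+ 5 * (2 ^+ 11 * (2 ^+ 10 + 1))).
move=> d Omega P eps eps_rad A a AL.
have A0 k : k \in A -> (0 < k)%N by move=> kA; exact/L0/AL.
apply: (@le_trans _ _ ((2 ^+ 5 * (2 ^+ 11 * (2 ^+ 10 + 1)))%:E *
  (mean (fun s : {ffun A -> bool} =>
     supnorm (trigpoly A (fun k => (extsign s k)%:C%C * a k))))%:E)%E); last first.
  apply: lee_pmul => //; last exact: mean_supnorm_le_bracket.
  rewrite lee_fin /mean mulr_ge0 ?invr_ge0// sumr_ge0// => s _.
  exact: supnorm_ge0.
rewrite -EFinM lee_fin.
have -> : \sum_(k <- A) normc (fourier (trigpoly A a) k%:Z) `^ (4 / 3) =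
          \sum_(k <- A) normc (a k) `^ (4 / 3).
  by apply: eq_big_seq => k kA; rewrite fourier_trigpoly.
exact: rider_signs A0 (qL A AL).
Qed.

End RiderSet.

(** * Moments of polynomials and the Fejer kernel *)

Section PolynomialMoments.
Context {R : realType}.
Implicit Types (x t : R) (A : {fset nat}) (a b : nat -> R[i]) (s : seq (int * R[i])).
Local Notation cmu := (circle_measure R).

Lemma trigsumM s s' x : trigsum s x * trigsum s' x =
  trigsum [seq (u.1 + v.1, u.2 * v.2) | u <- s, v <- s'] x.
Proof.
rewrite /trigsum big_allpairs_dep /= mulr_suml; apply: eq_bigr => u _.
rewrite mulr_sumr; apply: eq_bigr => v _; rewrite expcD; ring.
Qed.

Lemma conjc_trigsum s x :
  conjc (trigsum s x) = trigsum [seq (- u.1, conjc u.2) | u <- s] x.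
Proof.
rewrite /trigsum big_map rmorph_sum; apply: eq_bigr => u _ /=.
by rewrite rmorphM expcN.
Qed.

Lemma trigsumX s (n : nat) : exists s', forall x, trigsum s x ^+ n = trigsum s' x.
Proof.
elim: n => [|n [s' IH]].
  by exists [:: (0, 1)] => x; rewrite /trigsum big_seq1 /= expc0 mulr1.
by eexists => x; rewrite exprS IH trigsumM.
Qed.

Lemma trigpolyE A a x : trigpoly A a x = trigsum [seq (k%:Z, a k) | k <- A] x.
Proof. by rewrite /trigsum big_map. Qed.

Lemma gmean_trigsum s (N : nat) : (forall u, u \in s -> (`|u.1| < N)%N) -> (0 < N)%N ->
  gmean N (fun x => complex.Re (trigsum s x)) =
  Rintegral cmu setT (fun x => complex.Re (trigsum s x)).
Proof.
move=> sN N0.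
have -> : Rintegral cmu setT (fun x => complex.Re (trigsum s x)) =
   complex.Re (circle_integral (trigsum s)) by [].
rewrite circle_integral_trigsum /gmean -Re_sum /trigsum exchange_big /=.
under eq_bigr do rewrite -mulr_sumr sum_expc_grid//.
rewrite -ReZ; congr complex.Re.
rewrite mulr_sumr [RHS]big_mkcond big_seq [RHS]big_seq; apply: eq_bigr => u us.
have NR : (N%:R : R[i]) != 0 by rewrite pnatr_eq0 -lt0n.
have -> : (N%:Z %| u.1)%Z = (u.1 == 0).
  apply/idP/eqP => [|->]; last exact: dvdz0.
  rewrite dvdzE /= => Nu; apply/eqP; rewrite -absz_eq0; apply/negPn/negP.
  by rewrite -lt0n => /dvdn_leq/(_ Nu); rewrite leqNgt sN.
case: ifP => _; last by rewrite !mulr0.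
by rewrite mulrCA fmorphV /= rmorph_nat mulVf// mulr1.
Qed.

Lemma gmean_normc_pow A a (s : nat) : exists M0, forall M, (M0 <= M)%N ->
  gmean (2 ^ M) (fun x => normc (trigpoly A a x) ^+ (2 * s)) =
  Rintegral cmu setT (fun x => normc (trigpoly A a x) ^+ (2 * s)).
Proof.
pose s1 := [seq (k%:Z, a k) | k <- A].
have [s2 s2E] := trigsumX [seq (u.1 + v.1, u.2 * v.2) | u <- s1,
  v <- [seq (- u.1, conjc u.2) | u <- s1]] s.
have E x : normc (trigpoly A a x) ^+ (2 * s) = complex.Re (trigsum s2 x).
  rewrite -s2E -trigsumM -conjc_trigsum -trigpolyE mulcJ exprM.
  by rewrite -(rmorphXn (real_complex R)).
exists (\sum_(u <- s2) `|u.1|)%N => M M0M.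
rewrite (eq_gmean _ E) gmean_trigsum ?expn_gt0//.
  by congr fine; apply: eq_integral => x _; rewrite E.
move=> u us; apply: leq_ltn_trans (ltn_expl M (isT : 1 < 2)%N).
apply: leq_trans M0M; rewrite (big_rem u)//=; exact: leq_addr.
Qed.

Lemma trigpolyZ (z : R[i]) A a x :
  trigpoly A (fun k => z * a k) x = z * trigpoly A a x.
Proof. by rewrite /trigpoly mulr_sumr; apply: eq_bigr => k _; rewrite mulrA. Qed.

Lemma rtrig_trigpolyZ (z : R[i]) A a x :
  rtrig A (fun k => z * a k) x = complex.Re (z * trigpoly A a x).
Proof. by rewrite -Re_trigpoly trigpolyZ. Qed.

Lemma exprn_le_expR (n : nat) x : 0 <= x -> x ^+ n <= n`!%:R * expR x.
Proof.
move=> x0; case: n => [|n].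
  by rewrite expr0 fact0 mul1r -expR0 ler_expR.
rewrite mulrC -ler_pdivrMr ?ltr0n ?fact_gt0//.
by apply: le_trans (expR_ge1Dxn n x0); rewrite lerDr.
Qed.

(** From [|z| <= |Re z| + |Im z|], convexity, and [e^(2|u|) <= e^(2u) + e^(-2u)]. The multipliers
    [2, -2, 2i, -2i] have the same modulus and can be absorbed into the coefficients. *)
Lemma expR_normc_le (z : R[i]) : expR (normc z) <=
  (expR (complex.Re (2%:C%C * z)) + expR (complex.Re ((-2)%:C%C * z)) +
   expR (complex.Re ((2 *i)%C * z)) + expR (complex.Re ((-2 *i)%C * z))) / 2.
Proof.
have nz : normc z <= `|complex.Re z| + `|complex.Im z|.
  rewrite -(ler_pXn2r (n := 2)) ?nnegrE ?normc_ge0 ?addr_ge0// sqr_normcE.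
  rewrite sqrrD !real_normK ?num_real// -addrA [_ *+ 2 + _]addrC addrA lerDl.
  by rewrite mulrn_wge0// mulr_ge0.
apply: (@le_trans _ _ (expR ((1 - 2^-1) * (2 * `|complex.Re z|) + 2^-1 * (2 * `|complex.Im z|)))).
  by rewrite ler_expR; lra.
apply: le_trans (expR_convex _ _ _) _; first by lra.
have ea (u : R) : expR (2 * `|u|) <= expR (2 * u) + expR (- 2 * u).
  have [u0|u0] := leP 0 u; first by rewrite ger0_norm// lerDl expR_ge0.
  by rewrite ltr0_norm// mulrN mulNr lerDr expR_ge0.
have := ea (complex.Re z); have := ea (complex.Im z).
rewrite !ReZ.
have -> : complex.Re ((2 *i)%C * z) = - 2 * complex.Im z.
  by case: z {nz} => u v /=; ring.
have -> : complex.Re ((-2 *i)%C * z) = 2 * complex.Im z.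
  by case: z {nz} => u v /=; ring.
lra.
Qed.

(** [x^n <= n! e^x] reduces moments to the exponential estimate. The multipliers of modulus 2
    account for the [/ 4] in the hypothesis, and half of four bounds by 20 for the 40. *)
Lemma integral_normc_pow_le A a (s : nat) :
  (forall k, k \in A -> (0 < k)%N) ->
  (forall n, quasi_independent (block A n)) ->
  \sum_(k <- A) normc (a k) ^+ 2 <= 10 ^- 6 / 4 ->
  Rintegral cmu setT (fun x => normc (trigpoly A a x) ^+ (2 * s)) <=
    40 * (2 * s)`!%:R.
Proof.
move=> A0 qA a2; have [M0 HM0] := gmean_normc_pow A a s.
pose M := (maxn M0 (2 * \sum_(k <- A) k))%N.
rewrite -(HM0 M (leq_maxl _ _)).
have AM : (2 * \sum_(k <- A) k < 2 ^ M)%N.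
  by apply: leq_ltn_trans (leq_maxr M0 _) _; rewrite ltn_expl.
have h (z : R[i]) : normc z ^+ 2 = 4 ->
    gmean (2 ^ M) (fun x => expR (complex.Re (z * trigpoly A a x))) <= 20.
  move=> z2; under eq_gmean do rewrite -rtrig_trigpolyZ.
  apply: gmean_expR_rtrig_le => //.
  under eq_bigr do rewrite ComplexField.Normc.normcM exprMn z2.
  by rewrite -mulr_sumr; lra.
apply: (@le_trans _ _ (gmean (2 ^ M) (fun x => (2 * s)`!%:R *
  (2^-1 * (expR (complex.Re (2%:C%C * trigpoly A a x)) +
   expR (complex.Re ((-2)%:C%C * trigpoly A a x)) +
   expR (complex.Re ((2 *i)%C * trigpoly A a x)) +
   expR (complex.Re ((-2 *i)%C * trigpoly A a x))))))).
  apply: ler_gmean => x.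
  apply: le_trans (exprn_le_expR _ (normc_ge0 _)) _.
  rewrite ler_wpM2l// [2^-1 * _]mulrC; exact: expR_normc_le.
rewrite gmeanZ mulrC ler_wpM2r// gmeanZ !gmeanD.
have := h 2%:C%C; have := h (-2)%:C%C; have := h (2 *i)%C; have := h (-2 *i)%C.
rewrite !sqr_normcE /=.
have e1 : 0 ^+ 2 + 2 ^+ 2 = 4 :> R by ring.
have e2 : (- 0) ^+ 2 + (-2) ^+ 2 = 4 :> R by ring.
have e3 : 2 ^+ 2 + 0 ^+ 2 = 4 :> R by ring.
have e4 : (-2) ^+ 2 + 0 ^+ 2 = 4 :> R by ring.
move=> /(_ e2) h1 /(_ e1) h2 /(_ e4) h3 /(_ e3) h4; lra.
Qed.

End PolynomialMoments.

(** * The Fejer kernel and its convergence at Lebesgue points *)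

Section Fejer.
Context {R : realType}.
Implicit Types (x t : R).
Local Notation cmu := (circle_measure R).
Local Notation lam := (@lebesgue_measure R).

Definition fejer (N : nat) t : R := N%:R^-1 * normc (\sum_(k < N) expc k%:Z t) ^+ 2.

Lemma fejer_ge0 N t : 0 <= fejer N t.
Proof. by rewrite /fejer mulr_ge0 ?invr_ge0 ?sqr_ge0. Qed.

Lemma fejer_le N t : fejer N t <= N%:R.
Proof.
have h : normc (\sum_(k < N) expc k%:Z t) <= N%:R.
  apply: le_trans (le_normc_sum _ _ _) _.
  by under eq_bigr do rewrite normc_expc; rewrite sumr_const card_ord.
have [->|N0] := posnP N; first by rewrite /fejer big_ord0 invr0 mul0r.
rewrite /fejer ler_pdivrMl ?ltr0n// expr2.
by apply: ler_pM; rewrite ?normc_ge0.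
Qed.

Lemma normc_conj (z : R[i]) : normc (conjc z) = normc z.
Proof. by case: z => u v /=; rewrite sqrrN. Qed.

Lemma fejerN N t : fejer N (- t) = fejer N t.
Proof.
rewrite /fejer; under eq_bigr do rewrite expcNx.
by rewrite -(rmorph_sum (@conjc R)) /= normc_conj.
Qed.

Lemma fejer_period N t : fejer N (t + 1) = fejer N t.
Proof. by rewrite /fejer; under eq_bigr do rewrite expc_period. Qed.

Lemma fejer_le_sqr N t : 0 < t <= 2^-1 -> fejer N t <= (N%:R * t ^+ 2)^-1.
Proof.
move=> /andP[t0 t1].
have [->|N0] := posnP N; first by rewrite /fejer big_ord0 mul0r invr0 mul0r.
have N0' : (0 : R) < N%:R by rewrite ltr0n.
rewrite /fejer invfM ler_pM2l ?invr_gt0//.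
set S := \sum_(k < N) _.
have hS : normc S * normc (1 - expc 1 t) <= 2.
  rewrite -ComplexField.Normc.normcM.
  have -> : S * (1 - expc 1 t) = 1 - expc 1 t ^+ N.
    have -> : S = \sum_(k < N) expc 1 t ^+ k.
      by apply: eq_bigr => k _; rewrite -expc_muln mulr1.
    by apply: oppr_inj; rewrite opprB (subrX1 (expc 1 t) N) -mulrN opprB mulrC.
  apply: le_trans (le_normcD _ _) _.
  by rewrite ComplexField.Normc.normc1 normcN -expcMn normc_expc.
have h2 : 2 * t <= normc (1 - expc 1 t).
  by have := @normc_1Bexpc_ge R 1 t; rewrite mul1r; apply; rewrite ltW.
have h3 : normc S * t <= 1 by have := normc_ge0 S; nra.
rewrite -exprVn lerXn2r ?nnegrE ?normc_ge0 ?invr_ge0 ?(ltW t0)//.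
by rewrite -[leRHS]mul1r ler_pdivlMr.
Qed.

Lemma fejer_le_far N t (rho : R) : 0 < rho -> rho <= `|t| <= 1 - rho ->
  fejer N t <= (N%:R * rho ^+ 2)^-1.
Proof.
move=> rho0 /andP[h1 h2].
have [->|N0] := posnP N; first by rewrite /fejer big_ord0 mul0r invr0 mul0r.
have N0' : (0 : R) < N%:R by rewrite ltr0n.
have -> : fejer N t = fejer N `|t|.
  by have [t0|t0] := leP 0 t; [rewrite ger0_norm|rewrite ltr0_norm// fejerN].
set u := `|t| in h1 h2 *.
have main v : rho <= v -> v <= 2^-1 -> fejer N v <= (N%:R * rho ^+ 2)^-1.
  move=> rv v2; have v0 : 0 < v by apply: lt_le_trans rv.
  have v02 : 0 < v <= 2^-1 by rewrite v0.
  apply: le_trans (fejer_le_sqr N v02) _.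
  rewrite lef_pV2 ?posrE ?mulr_gt0 ?exprn_gt0//.
  by rewrite ler_pM2l// lerXn2r ?nnegrE ?(ltW rho0) ?(ltW v0).
have [u2|u2] := leP u 2^-1; first exact: main.
rewrite -(subrK 1 u) fejer_period -fejerN opprB; apply: main; lra.
Qed.

(** On the shell [mesh i.+1 <= |t| < mesh i] the decay [1/(2^n t^2)] is at most [4 * 4^i * 2^-n],
    and inside [|t| < mesh n] the kernel is at most [2^n]. A majorant made of indicators of balls
    lets averages over balls control the convolution. *)
Lemma fejer_le_shells (n i0 : nat) t : (i0 <= n)%N -> (0 < i0)%N -> `|t| < mesh i0 ->
  fejer (2 ^ n) t <= \sum_(i0 <= i < n.+1)
    4 * 2 ^+ i * 2 ^+ i * mesh n * (`|t| < mesh i)%R%:R.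
Proof.
move=> i0n i00 ti0.
pose b i : R := 4 * 2 ^+ i * 2 ^+ i * mesh n * (`|t| < mesh i)%R%:R.
have b0 i : 0 <= b i.
  by rewrite /b mulr_ge0// mulr_ge0 ?(ltW (mesh_gt0 _))// mulr_ge0 ?mulr_ge0 ?exprn_ge0.
have ftt : fejer (2 ^ n) t = fejer (2 ^ n) `|t|.
  by have [t0|t0] := leP 0 t; [rewrite ger0_norm|rewrite ltr0_norm// fejerN].
have [tn|tn] := ltP `|t| (mesh n).
  rewrite big_nat_recr//=; apply: le_trans (fejer_le _ _) _.
  rewrite -[leLHS]add0r; apply: lerD; first by apply: sumr_ge0 => i _; exact: b0.
  rewrite tn mulr1 -mulrA [2 ^+ n * mesh n]mulrC meshK mulr1 natrX.
  by rewrite ler_peMl ?exprn_ge0// ler1n.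
have [i /andP[ii0 iN] /andP[ti iti]] : exists2 i : nat, (i0 <= i < n)%N &
    mesh i.+1 <= `|t| < mesh i.
  elim: n i0n tn {b b0 ftt} => [|n IH] i0n tn.
    by move: i0n ti0; rewrite leqn0 => /eqP ->; rewrite ltNge tn.
  have [i0e|i0ne] := eqVneq i0 n.+1; first by move: ti0; rewrite i0e ltNge tn.
  have i0n' : (i0 <= n)%N by rewrite -ltnS ltn_neqAle i0ne.
  have [tn'|tn'] := ltP `|t| (mesh n).
    by exists n; [rewrite i0n' ltnSn|rewrite tn].
  have [i /andP[h1 h2] h3] := IH i0n' tn'.
  by exists i => //; rewrite h1 ltnW.
rewrite ftt.
have tp : 0 < `|t| by apply: lt_le_trans ti; exact: mesh_gt0.
have m2 j : (0 < j)%N -> mesh j <= 2^-1 :> R.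
  case: j => // j _; rewrite /mesh exprS ler_piMr ?invr_ge0//.
  by rewrite exprn_ile1 ?invr_ge0// invf_le1// ler1n.
apply: le_trans (@fejer_le_sqr _ _ _) _.
  by rewrite tp (le_trans (ltW ti0))// m2.
apply: (@le_trans _ _ (b i)).
  rewrite /b iti mulr1 natrX invfM -exprVn -/(mesh n).
  rewrite mulrC ler_pM2r ?mesh_gt0//.
  rewrite -[leRHS]invrK lef_pV2 ?posrE ?exprn_gt0// ?invr_gt0 ?mulr_gt0 ?exprn_gt0//.
  have -> : (4 * 2 ^+ i * 2 ^+ i)^-1 = mesh i.+1 ^+ 2 :> R.
    by rewrite /mesh exprVn exprVn; congr (_^-1); rewrite (exprS 2 i); set p := 2 ^+ i; ring.
  by rewrite lerXn2r ?nnegrE// ltW// mesh_gt0.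
rewrite (big_rem i) ?mem_index_iota ?ii0 ?ltnS ?(ltnW iN)//= lerDl.
by apply: sumr_ge0 => j _; exact: b0.
Qed.

Lemma fejer_trigsum N t : (0 < N)%N -> (fejer N t)%:C%C =
  trigsum [seq (k.1%:Z - k.2%:Z, N%:R^-1) | k <- [seq (k, l) | k <- iota 0 N, l <- iota 0 N]] t.
Proof.
move=> N0; rewrite /fejer rmorphM /= -mulcJ fmorphV /= rmorph_nat.
rewrite /trigsum big_map big_allpairs_dep /= rmorph_sum /= big_distrlr /= mulr_sumr.
rewrite -(big_mkord predT (fun k => N%:R^-1 * \sum_(l < N) expc k%:Z t * conjc (expc l%:Z t))).
rewrite /index_iota subn0; apply: eq_bigr => k _.
rewrite mulr_sumr -(big_mkord predT (fun l => N%:R^-1 * (expc k%:Z t * conjc (expc l%:Z t)))).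
rewrite /index_iota subn0; apply: eq_bigr => l _.
by rewrite -expcN -expcD.
Qed.

Lemma measurable_fejer N x : measurable_fun setT (fun y : R => fejer N (x - y)).
Proof.
have E (t : R) : fejer N t = N%:R^-1 * ((\sum_(k < N) cos (2 * pi * k%:~R * t)) ^+ 2 +
     (\sum_(k < N) sin (2 * pi * k%:~R * t)) ^+ 2).
  rewrite /fejer sqr_normcE Re_sum (big_morph _ ImD (erefl : complex.Im (0 : R[i]) = 0)).
  by [].
rewrite (_ : (fun y => _) = (fun y : R => N%:R^-1 * ((\sum_(k < N) cos (2 * pi * k%:~R * (x - y))) ^+ 2 +
     (\sum_(k < N) sin (2 * pi * k%:~R * (x - y))) ^+ 2))); last first.
  by apply/funext => y; rewrite E.
have cl (c : R) : continuous (fun y : R => c * (x - y)).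
  move=> y; apply: cvgM; first exact: cvg_cst.
  by apply: cvgB; [exact: cvg_cst|exact: cvg_id].
have mc (c : R) : measurable_fun setT (fun y : R => cos (c * (x - y))).
  apply: continuous_measurable_fun => y.
  apply: (@continuous_comp _ _ _ (fun y => c * (x - y)) cos); first exact: cl.
  exact: continuous_cos.
have ms (c : R) : measurable_fun setT (fun y : R => sin (c * (x - y))).
  apply: continuous_measurable_fun => y.
  apply: (@continuous_comp _ _ _ (fun y => c * (x - y)) sin); first exact: cl.
  exact: continuous_sin.
apply: measurable_funM => //; apply: measurable_funD; apply: measurable_funX.
- exact: (measurable_sum _ (fun k : 'I_N => mc (2 * pi * k%:~R))).
- exact: (measurable_sum _ (fun k : 'I_N => ms (2 * pi * k%:~R))).
Qed.

End Fejer.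

Section FejerConvergence.
Context {R : realType}.
Implicit Types (x t : R).
Local Notation cmu := (circle_measure R).
Local Notation lam := (@lebesgue_measure R).

Lemma conv_trigsum (f : R -> R[i]) s x :
  (forall n, cintegrable (fun y => f y * expc n y)) ->
  circle_integral (fun y => f y * trigsum s (x - y)) =
  \sum_(u <- s) u.2 * fourier f u.1 * expc u.1 x.
Proof.
move=> hf.
have E (u : int * R[i]) y : f y * (u.2 * expc u.1 (x - y)) =
   (u.2 * expc u.1 x) * (f y * expc (- u.1) y).
  rewrite expcDx expcNx -expcN; ring.
suff : cintegrable (fun y => f y * trigsum s (x - y)) /\
  circle_integral (fun y => f y * trigsum s (x - y)) =
  \sum_(u <- s) u.2 * fourier f u.1 * expc u.1 x by case.
elim: s => [|u s [IH1 IH2]].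
  rewrite (_ : (fun y => _) = fun y => 0 * (f y * expc 0 y)); last first.
    by apply/funext => y; rewrite /trigsum big_nil mulr0 mul0r.
  rewrite circle_integralZ// mul0r big_nil; split => //.
  exact: cintegrableZ.
rewrite (_ : (fun y => _) = fun y => (u.2 * expc u.1 x) * (f y * expc (- u.1) y)
    + f y * trigsum s (x - y)); last first.
  by apply/funext => y; rewrite /trigsum big_cons mulrDr E.
have c1 := cintegrableZ (u.2 * expc u.1 x) (hf (- u.1)).
split; first exact: cintegrableD.
by rewrite circle_integralD// IH2 big_cons circle_integralZ// mulrAC.
Qed.

Lemma cintegrable1 n : cintegrable (fun y : R => 1 * expc n y).
Proof. by under eq_fun do rewrite mul1r; exact: cintegrable_expc. Qed.

Lemma Rintegral_fejer N x : (0 < N)%N ->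
  Rintegral cmu setT (fun y => fejer N (x - y)) = 1.
Proof.
move=> N0.
have -> : Rintegral cmu setT (fun y => fejer N (x - y)) =
   complex.Re (circle_integral (fun y : R => 1 * (fejer N (x - y))%:C%C)).
  by apply: eq_Rintegral => y _; rewrite mul1r.
rewrite (_ : (fun y : R => 1 * (fejer N (x - y))%:C%C) = fun y : R => 1 * trigsum
    [seq (k.1%:Z - k.2%:Z, N%:R^-1) | k <- [seq (k, l) | k <- iota 0 N, l <- iota 0 N]] (x - y)); last first.
  by apply/funext => y; rewrite fejer_trigsum.
rewrite conv_trigsum; last exact: cintegrable1.
have four n : fourier (fun=> 1) n = if n == 0 then 1 else 0 :> R[i].
  rewrite /fourier; under eq_fun do rewrite mul1r.
  by rewrite circle_integral_expc oppr_eq0.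
rewrite big_map big_allpairs_dep /=.
have -> : \sum_(k <- iota 0 N) \sum_(l <- iota 0 N) N%:R^-1 *
    fourier (fun=> 1) (k%:Z - l%:Z) * expc (k%:Z - l%:Z) x =
    \sum_(k <- iota 0 N) N%:R^-1 :> R[i].
  apply: eq_big_seq => k kN; rewrite (bigD1_seq k) ?iota_uniq//=.
  rewrite subrr four eqxx expc0 !mulr1 big1 ?addr0// => l lk.
  by rewrite four subr_eq0 eqz_nat eq_sym (negbTE lk) mulr0 mul0r.
rewrite big_const_seq count_predT size_iota iter_addr_0 -[_ *+ N]mulr_natl.
by rewrite mulfV// pnatr_eq0 -lt0n.
Qed.

Lemma integrable_mul_bounded (g h : R -> R) (M : R) : measurable_fun setT g ->
  cmu.-integrable setT (EFin \o g) -> measurable_fun setT h ->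
  (forall y, `|h y| <= M) -> cmu.-integrable setT (EFin \o (fun y => g y * h y)).
Proof.
move=> mg ig mh hM.
apply: (@le_integrable _ _ _ cmu setT measurableT _ (EFin \o (fun y => M * g y))).
- by apply/measurable_EFinP; exact: measurable_funM.
- move=> y _; rewrite lee_fin !normrM mulrC ler_wpM2r//.
  by apply: le_trans (hM y) (ler_norm _).
- exact: integrable_circleZ.
Qed.

(** Away from [x] the kernel is [O(2^-n)]. Near [x], the shell majorant is integrated against
    [|g - g x|], whose integral over a ball of radius [r] is at most [2 r e1] at a Lebesgue
    point. *)
Lemma fejer_cvg (g : R -> R) x : measurable_fun setT g ->
  cmu.-integrable setT (EFin \o g) -> 0 < x < 1 ->
  lebesgue_pt (g \_ `[0, 1[) x ->
  (fun n => Rintegral cmu setT (fun y => g y * fejer (2 ^ n) (x - y))) @ \oo --> g x.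
Proof.
move=> mg ig /andP[x0 x1] lpt.
pose D : set R := `[0, 1[%classic.
have mD : measurable D by exact: measurable_itv.
pose H y := `|g y - g x|.
have mH : measurable_fun setT H.
  by apply: measurableT_comp => //; exact: measurable_funB.
have H0 y : 0 <= H y by exact: normr_ge0.
have iH : cmu.-integrable setT (EFin \o H).
  apply: integrable_norm.
  rewrite (_ : _ \o _ = EFin \o (fun y => g y + (- g x)))//.
  apply: integrable_circleD => //; apply: (@integrable_circle _ _ `|- g x|) => //.
pose W := Rintegral cmu setT H.
have WE : (\int[lam]_(y in D) (H y)%:E = W%:E)%E.
  rewrite -circle_integralE; last exact/measurable_EFinP.
  by rewrite /W /Rintegral fineK//; exact: integrable_fin_num.
have W0 : 0 <= W by apply: Rintegral_ge0.
have locavg (e : R) : 0 < e -> exists2 r0 : R, 0 < r0 & forall r, 0 < r < r0 ->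
    ball x r `<=` D -> (\int[lam]_(y in ball x r) (H y)%:E <= (2 * r * e)%:E)%E.
  move=> e0; move: lpt; rewrite /lebesgue_pt => /fine_cvgP[fin0 cv0].
  have /cvgrPdist_lt/(_ e e0) := cv0.
  move=> ne; have [r0 /= r00 hr] := filterI fin0 ne.
  exists r0 => // r /andP[rp rr0] rD.
  have [fr] : davg (g \_ D) x r \is a fin_num /\ `|0 - fine (davg (g \_ D) x r)| < e.
    by apply: hr => //=; rewrite /ball /= sub0r normrN gtr0_norm.
  rewrite sub0r normrN => de.
  have xD : D x by rewrite /D /= in_itv /= (ltW x0) x1.
  have dE : davg (g \_ D) x r = ((2 * r)^-1%:E * \int[lam]_(y in ball x r) (H y)%:E)%E.
    rewrite /davg /iavg lebesgue_measure_ball ?(ltW rp)// inver.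
    rewrite ifF; last by apply/negbTE; rewrite mulrn_eq0 /= gt_eqF.
    rewrite -[r *+ 2]mulr_natl; congr (_ * _)%E; apply: eq_integral => y.
    rewrite inE => yr /=; rewrite !patchE !mem_set//; exact: rD.
  have r2 : 0 < 2 * r by rewrite mulr_gt0.
  have : (davg (g \_ D) x r <= e%:E)%E.
    rewrite -(fineK fr) lee_fin; apply: le_trans (ltW de); exact: ler_norm.
  by rewrite dE lee_pdivrMl// EFinM.
apply/cvgrPdist_le => e e0.
(* Shell [i] contributes [8 e1 2^-n 2^i], hence all shells together at most [16 e1 = e/2]; the other
   half is for the far part. *)
pose e1 := e / 2 / 16.
have e10 : 0 < e1 by rewrite /e1; lra.
have [r0 r00 hr0] := locavg e1 e10.
(* Keeps the balls inside [[0, 1[], and also keeps [|x - y|] below [1 - mesh i0] for [y] in [[0,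
   1[], away from the next peak of the periodic kernel. *)
pose rho := Num.min r0 (Num.min x (1 - x)).
have rho0 : 0 < rho by rewrite !lt_min r00 x0 subr_gt0.
have [i0 i00 mi0] : exists2 i0 : nat, (0 < i0)%N & mesh i0 < rho.
  exists (Num.bound rho^-1).+1 => //.
  rewrite /mesh exprVn invf_plt ?posrE ?exprn_gt0//.
  apply: lt_trans (archi_boundP (ltW (_ : 0 < rho^-1))) _; first by rewrite invr_gt0.
  by rewrite -natrX ltr_nat (leq_trans _ (ltn_expl _ _)).
have [mr0 mx] : mesh i0 < r0 /\ mesh i0 < x /\ mesh i0 < 1 - x.
  by move: mi0; rewrite !lt_min => /and3P[-> -> ->].
have {mx}[mx mx1] := mx.
have bD i : (i0 <= i)%N -> mesh i <= mesh i0 :> R.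
  by move=> ii; rewrite /mesh ler_wiXn2l ?invr_ge0// invf_le1// ler1n.
have ballD i : (i0 <= i)%N -> ball x (mesh i) `<=` D.
  move=> ii y; rewrite /ball /= => xy.
  have := bD i ii; move: xy; rewrite ltr_norml => /andP[h1 h2] h3.
  by rewrite /D /= in_itv /=; apply/andP; split; lra.
have shell i : (i0 <= i)%N ->
    (\int[lam]_(y in ball x (mesh i)) (H y)%:E <= (2 * mesh i * e1)%:E)%E.
  move=> ii; apply: hr0; last exact: ballD.
  by rewrite mesh_gt0/=; apply: le_lt_trans (bD i ii) _.
pose a n : R := ((2 ^ n)%:R * mesh i0 ^+ 2)^-1.
have a0 n : 0 <= a n by rewrite invr_ge0 mulr_ge0// sqr_ge0.
pose b n i : R := 4 * 2 ^+ i * 2 ^+ i * mesh n.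
have b0 n i : 0 <= b n i.
  by rewrite mulr_ge0 ?(ltW (mesh_gt0 _))// mulr_ge0 ?mulr_ge0 ?exprn_ge0.
have main n : (i0 <= n)%N ->
    `|g x - Rintegral cmu setT (fun y => g y * fejer (2 ^ n) (x - y))| <=
    a n * W + 16 * e1.
  move=> i0n; pose K y := fejer (2 ^ n) (x - y).
  have N0 : (0 < 2 ^ n)%N by rewrite expn_gt0.
  have mK : measurable_fun setT K by exact: measurable_fejer.
  have K0 y : 0 <= K y by exact: fejer_ge0.
  have KN y : `|K y| <= (2 ^ n)%:R by rewrite ger0_norm ?K0// fejer_le.
  have iK : cmu.-integrable setT (EFin \o K) by exact: integrable_circle KN.
  have igK := integrable_mul_bounded mg ig mK KN.
  have iHK := integrable_mul_bounded mH iH mK KN.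
  have eq1 : Rintegral cmu setT (fun y => g y * K y) - g x =
      Rintegral cmu setT (fun y => g y * K y - g x * K y).
    rewrite RintegralB//; last exact: integrable_circleZ.
    by rewrite RintegralZl// Rintegral_fejer// mulr1.
  rewrite distrC eq1.
  have idiff : cmu.-integrable setT (EFin \o (fun y => g y * K y - g x * K y)).
    rewrite (_ : _ \o _ = EFin \o (fun y => g y * K y + (- g x) * K y)); last first.
      by apply/funext => y /=; rewrite mulNr.
    by apply: integrable_circleD => //; exact: integrable_circleZ.
  apply: le_trans (le_normr_Rintegral _ idiff) _ => //.
  under eq_Rintegral do rewrite -mulrBl normrM (ger0_norm (K0 _)) -/(H _).
  rewrite -lee_fin /Rintegral fineK; last by apply: integrable_fin_num.
  rewrite circle_integralE; last exact/measurable_EFinP/measurable_funM.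
  pose T i : R -> \bar R := (fun y => (H y)%:E) \_ (ball x (mesh i)).
  have T0 i y : (0 <= T i y)%E by apply: erestrict_ge0 => z _; rewrite lee_fin.
  have mT i : measurable_fun setT (T i).
    apply/(measurable_restrictT _ _).1 => //; first exact: measurable_ball.
    by apply: measurable_funTS; exact/measurable_EFinP.
  have mbT i : measurable_fun setT (fun y => (b n i)%:E * T i y)%E.
    exact: measurable_funeM.
  apply: (@le_trans _ _ (\int[lam]_(y in D) ((a n)%:E * (H y)%:E +
      \sum_(i0 <= i < n.+1) (b n i)%:E * T i y))%E).
    apply: ge0_le_integral => //.
    - by move=> y _; rewrite lee_fin mulr_ge0.
    - by apply: measurable_funTS; exact/measurable_EFinP/measurable_funM.
    - apply: measurable_funTS; apply: emeasurable_funD.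
        by apply/measurable_EFinP; exact: measurable_funM.
      by apply: emeasurable_sum => i; exact: mbT.
    move=> y; rewrite /D /= in_itv /= => /andP[y0 y1].
    have [far|near] := leP (mesh i0) `|x - y|.
      apply: (@le_trans _ _ ((a n)%:E * (H y)%:E)%E); last first.
        by rewrite leeDl// sume_ge0// => i _; rewrite mule_ge0// lee_fin.
      rewrite -EFinM lee_fin mulrC ler_wpM2r//.
      apply: fejer_le_far; first exact: mesh_gt0.
      by rewrite far /= ler_norml; lra.
    apply: (@le_trans _ _ (\sum_(i0 <= i < n.+1) (b n i)%:E * T i y)%E); last first.
      by rewrite leeDr// -EFinM lee_fin mulr_ge0.
    have -> : (\sum_(i0 <= i < n.+1) (b n i)%:E * T i y =
        (H y * \sum_(i0 <= i < n.+1) b n i * (`|x - y| < mesh i)%R%:R)%:E)%E.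
      rewrite mulr_sumr -sumEFin; apply: eq_bigr => i _.
      rewrite /T patchE; case: ifPn.
        by rewrite inE /ball /= => ->; rewrite mulr1 -EFinM mulrC.
      rewrite notin_setE /ball /= => /negP/negbTE ->.
      by rewrite mule0 !mulr0.
    by rewrite lee_fin ler_wpM2l//; exact: fejer_le_shells.
  rewrite ge0_integralD//; last 4 first.
  - by move=> y _; rewrite -EFinM lee_fin mulr_ge0.
  - by apply: measurable_funTS; apply/measurable_EFinP; exact: measurable_funM.
  - by move=> y _; rewrite sume_ge0// => i _; rewrite mule_ge0// lee_fin.
  - apply: measurable_funTS; by apply: emeasurable_sum => i; exact: mbT.
  rewrite EFinD; apply: leeD.
    rewrite ge0_integralZl_EFin//; first by rewrite WE EFinM.
    - by move=> y _; rewrite lee_fin.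
    - by apply: measurable_funTS; exact/measurable_EFinP.
  rewrite ge0_integral_sum//; last 2 first.
  - by move=> i; apply: measurable_funTS; exact: mbT.
  - by move=> i y _; rewrite mule_ge0// lee_fin.
  apply: (@le_trans _ _ (\sum_(i0 <= i < n.+1) (b n i * (2 * mesh i * e1))%:E)%E).
    rewrite big_nat [leRHS]big_nat; apply: lee_sum => i /andP[ii _].
    rewrite ge0_integralZl_EFin//; last by apply: measurable_funTS; exact: mT.
    rewrite [leRHS]EFinM; apply: lee_wpmul2l; first by rewrite lee_fin.
    apply: le_trans (shell i ii).
    rewrite /T -integral_mkcondr (setIidr (ballD i ii)); exact: lexx.
  rewrite sumEFin lee_fin.
  have -> : \sum_(i0 <= i < n.+1) b n i * (2 * mesh i * e1) =
     8 * e1 * mesh n * \sum_(i0 <= i < n.+1) 2 ^+ i.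
    rewrite mulr_sumr; apply: eq_bigr => i _; rewrite /b.
    transitivity (8 * e1 * mesh n * 2 ^+ i * (mesh i * 2 ^+ i)); first by ring.
    by rewrite meshK mulr1.
  have sg : \sum_(i0 <= i < n.+1) (2 : R) ^+ i <= 2 * 2 ^+ n.
    apply: (@le_trans _ _ (\sum_(0 <= i < n.+1) (2 : R) ^+ i)).
      rewrite [leRHS](big_cat_nat (n := i0))//=; last by rewrite leqW.
      by rewrite lerDr sumr_ge0// => i _; rewrite exprn_ge0.
    rewrite big_mkord; have := subrX1 (2 : R) n.+1.
    have -> : (2 - 1 : R) = 1 by ring.
    by rewrite mul1r => <-; rewrite exprS; lra.
  have -> : 16 * e1 = 8 * e1 * mesh n * (2 * 2 ^+ n).
    transitivity (16 * e1 * (mesh n * 2 ^+ n)); last by ring.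
    by rewrite meshK mulr1.
  by rewrite ler_wpM2l// mulr_ge0 ?(ltW (mesh_gt0 _))//; lra.
have cva : a n * W @[n --> \oo] --> 0.
  have -> : (fun n => a n * W) = (fun n => (mesh i0 ^+ 2)^-1 * W * (2^-1) ^+ n).
    by apply/funext => n; rewrite /a invfM natrX exprVn; ring.
  rewrite -[X in _ --> X](mulr0 ((mesh i0 ^+ 2)^-1 * W)).
  apply: cvgM; first exact: cvg_cst.
  by apply: cvg_expr; rewrite ger0_norm ?invr_ge0// invf_lt1// ltr1n.
have e20 : 0 < e / 2 by rewrite divr_gt0.
move/cvgrPdist_le : cva => /(_ _ e20) cva.
near=> n.
apply: le_trans (main n _) _; first by near: n; exact: nbhs_infty_ge.
have : `|0 - a n * W| <= e / 2 by near: n.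
rewrite sub0r normrN ger0_norm ?mulr_ge0// /e1; lra.
Unshelve. all: by end_near. Qed.

End FejerConvergence.

(** * The Lambda(q) property *)

Section Bessel.
Context {R : realType}.
Implicit Types (f h : R -> R[i]) (x : R).
Local Notation cmu := (circle_measure R).

Lemma powR_normL f (q : R) : q != 0 ->
  (normL q f `^ q = \int[cmu]_x (normc (f x) `^ q)%:E)%E.
Proof.
move=> q0; rewrite /normL powR_Lnorm//; apply: eq_integral => x _.
by rewrite abse_EFin ger0_norm ?normc_ge0.
Qed.

Lemma measurable_normc_pow f (n : nat) :
  measurable_fun setT (fun x => complex.Re (f x)) ->
  measurable_fun setT (fun x => complex.Im (f x)) ->
  measurable_fun setT (fun x => normc (f x) ^+ (2 * n)).
Proof.
move=> m1 m2.
rewrite (_ : (fun x => _) = fun x => (complex.Re (f x) ^+ 2 + complex.Im (f x) ^+ 2) ^+ n).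
  apply: measurable_funX; apply: measurable_funD; exact: measurable_funX.
by apply/funext => x; rewrite exprM sqr_normcE.
Qed.

Lemma L2circle_sqr f : L2circle f ->
  [/\ cmu.-integrable setT (EFin \o (fun x => normc (f x) ^+ 2)),
      normL 2 f \is a fin_num
    & Rintegral cmu setT (fun x => normc (f x) ^+ 2) = fine (normL 2 f) ^+ 2].
Proof.
move=> [_ m1 m2 fin].
have L0 : (0 <= normL 2 f)%E by exact: Lnorm_ge0.
have Lf : normL 2 f \is a fin_num by rewrite ge0_fin_numE.
have E := @powR_normL f 2 (lt0r_neq0 (ltr0n _ 2)).
have E2 : (\int[cmu]_x (normc (f x) ^+ 2)%:E = (fine (normL 2 f) ^+ 2)%:E)%E.
  under eq_integral do rewrite -powR_mulrn ?normc_ge0//.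
  by rewrite -E -(fineK Lf) poweR_EFin powR_mulrn// fine_ge0.
split => //; last by rewrite /Rintegral E2.
apply/integrableP; split.
  by apply/measurable_EFinP; exact: (@measurable_normc_pow f 1).
under eq_integral do rewrite /= ger0_norm ?sqr_ge0//.
by rewrite E2 ltry.
Qed.

Lemma cintegrable_mul_expc f n : cintegrable f -> cintegrable (fun x => f x * expc n x).
Proof.
move=> [i1 i2]; have [c1 c2] := cintegrable_expc (R := R) n.
have m (g : R -> R) : cmu.-integrable setT (EFin \o g) -> measurable_fun setT g.
  by move=> /integrableP[/measurable_EFinP].
have bc x : `|complex.Re (expc n x)| <= 1 :> R.
  by rewrite -(normc_expc n x) normc_geRe.
have bs x : `|complex.Im (expc n x)| <= 1 :> R.
  by rewrite -(normc_expc n x) normc_geIm.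
have bd := integrable_mul_bounded.
split.
- rewrite (_ : (fun x => complex.Re _) = fun x =>
      complex.Re (f x) * complex.Re (expc n x) +
      (- 1) * (complex.Im (f x) * complex.Im (expc n x))); last first.
    by apply/funext => x; rewrite mulN1r -mulNr -complex_ReM.
  apply: integrable_circleD; first exact: (bd _ _ _ 1 (m _ i1) i1 (m _ c1) bc).
  apply: integrable_circleZ; exact: (bd _ _ _ 1 (m _ i2) i2 (m _ c2) bs).
- rewrite (_ : (fun x => complex.Im _) = fun x =>
      complex.Re (f x) * complex.Im (expc n x) +
      complex.Im (f x) * complex.Re (expc n x)); last first.
    by apply/funext => x; rewrite -complex_ImM.
  apply: integrable_circleD; first exact: (bd _ _ _ 1 (m _ i1) i1 (m _ c2) bs).
  exact: (bd _ _ _ 1 (m _ i2) i2 (m _ c1) bc).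
Qed.

Lemma L2circle_cintegrable f : L2circle f -> cintegrable f.
Proof.
move=> fL; have [i2 _ _] := L2circle_sqr fL.
case: fL => _ m1 m2 _.
have i3 : cmu.-integrable setT (EFin \o (fun x => 1 + normc (f x) ^+ 2)).
  by apply: integrable_circleD => //; apply: (@integrable_circle _ _ 1) => // x; rewrite normr1.
have le y : y <= 1 + y ^+ 2 :> R by have := sqr_ge0 (y - 2^-1); nra.
split; apply: le_integrable i3 => //; try exact/measurable_EFinP.
- move=> x _ /=; rewrite lee_fin; apply: le_trans (normc_geRe _) _.
  by apply: le_trans (le _) _; rewrite ler_norm.
- move=> x _ /=; rewrite lee_fin; apply: le_trans (normc_geIm _) _.
  by apply: le_trans (le _) _; rewrite ler_norm.
Qed.

Lemma circle_integral_conj_trigpoly h A a : cintegrable h ->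
  cintegrable (fun x => h x * conjc (trigpoly A a x)) /\
  circle_integral (fun x => h x * conjc (trigpoly A a x)) =
  \sum_(k <- A) conjc (a k) * fourier h k%:Z.
Proof.
move=> ih; rewrite /trigpoly; elim: (enum_fset A) => [|k r [IH1 IH2]].
  rewrite (_ : (fun x => _) = fun x => 0 * h x); last first.
    by apply/funext => x; rewrite big_nil (rmorph0 (@conjc R)) mul0r mulr0.
  by rewrite circle_integralZ// mul0r big_nil; split => //; exact: cintegrableZ.
rewrite (_ : (fun x => _) = fun x => conjc (a k) * (h x * expc (- k%:Z) x) +
   h x * conjc (\sum_(k <- r) a k * expc k%:Z x)); last first.
  apply/funext => x; rewrite big_cons (rmorphD (@conjc R)) (rmorphM (@conjc R)) expcN; ring.
have c1 := cintegrableZ (conjc (a k)) (cintegrable_mul_expc (- k%:Z) ih).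
split; first exact: cintegrableD.
rewrite circle_integralD// IH2 big_cons circle_integralZ//.
exact: cintegrable_mul_expc.
Qed.

Lemma bessel f (A : {fset nat}) : L2circle f ->
  \sum_(k <- A) normc (fourier f k%:Z) ^+ 2 <= fine (normL 2 f) ^+ 2.
Proof.
move=> fL; have [i2 _ E2] := L2circle_sqr fL; have fi := L2circle_cintegrable fL.
pose a k := fourier f k%:Z; pose p := trigpoly A a.
have pi : cintegrable p.
  rewrite (_ : p = trigsum [seq (k%:Z, a k) | k <- A]); first exact: cintegrable_trigsum.
  by apply/funext => x; exact: trigpolyE.
have [j1 e1] := circle_integral_conj_trigpoly A a fi.
have [j2 e2] := circle_integral_conj_trigpoly A a pi.
have e3 : circle_integral (fun x => p x * conjc (p x)) =
    circle_integral (fun x => f x * conjc (p x)).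
  by rewrite e1 e2; apply: eq_big_seq => k kA; rewrite fourier_trigpoly.
have e4 : complex.Re (circle_integral (fun x => f x * conjc (p x))) =
    \sum_(k <- A) normc (a k) ^+ 2.
  rewrite e1; under eq_bigr do rewrite mulrC mulcJ.
  by rewrite -(rmorph_sum (real_complex R)).
rewrite -E2 -subr_ge0 -e4.
have -> : Rintegral cmu setT (fun x => normc (f x) ^+ 2) -
    complex.Re (circle_integral (fun x => f x * conjc (p x))) =
  Rintegral cmu setT (fun x => normc (f x - p x) ^+ 2).
  transitivity (Rintegral cmu setT (fun x => normc (f x) ^+ 2 +
      ((- 2) * complex.Re (f x * conjc (p x)) + complex.Re (p x * conjc (p x))))).
    have k1 := integrable_circleZ (- 2) j1.1.
    rewrite RintegralD//; last by apply: integrable_circleD => //; exact: j2.1.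
    rewrite RintegralD//; last exact: j2.1.
    rewrite RintegralZl//; last exact: j1.1.
    have := congr1 (@complex.Re R) e3; rewrite /circle_integral /= => ->; ring.
  apply: eq_Rintegral => x _; rewrite !sqr_normcE.
  by case: (f x) (p x) => [u1 u2] [v1 v2] /=; ring.
by apply: Rintegral_ge0 => x _; exact: sqr_ge0.
Qed.

End Bessel.

Section FejerMeans.
Context {R : realType}.
Implicit Types (f h : R -> R[i]) (x : R).
Local Notation cmu := (circle_measure R).

(** A difference [k >= 0] is attained by [N - k] pairs: the triangular weights of the Fejer mean. *)
Lemma sum_triangle (V : zmodType) (G : int -> V) (N : nat) :
  (forall k, G (Negz k) = 0) ->
  \sum_(0 <= u < N) \sum_(0 <= v < N) G (u%:Z - v%:Z) =
  \sum_(0 <= k < N) G k%:Z *+ (N - k).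
Proof.
move=> G0.
have z (F : nat -> V) m n : (forall v, (m <= v < n)%N -> F v = 0) ->
    \sum_(m <= v < n) F v = 0.
  by move=> F0; rewrite big_nat big1.
have E u : (u < N)%N -> \sum_(0 <= v < N) G (u%:Z - v%:Z) = \sum_(0 <= k < u.+1) G k%:Z.
  move=> uN; rewrite (big_cat_nat (n := u.+1))//= [X in _ + X]z ?addr0; last first.
    move=> v uv; have -> : (u%:Z - v%:Z) = Negz (v - u.+1) by rewrite NegzE; lia.
    exact: G0.
  rewrite [LHS]big_nat_rev /= [LHS]big_nat [RHS]big_nat.
  by apply: eq_bigr => v h; congr G; lia.
transitivity (\sum_(0 <= u < N) \sum_(0 <= k < N) (if (k <= u)%N then G k%:Z else 0)).
  rewrite big_nat [RHS]big_nat; apply: eq_bigr => u uN; rewrite E; last by [].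
  rewrite [RHS](big_cat_nat (n := u.+1))//= [X in _ = _ + X]z ?addr0; last first.
    by move=> v h; rewrite ifF//; lia.
  rewrite [LHS]big_nat [RHS]big_nat; apply: eq_bigr => k h; rewrite ifT//; lia.
rewrite exchange_big_nat /= big_nat [RHS]big_nat; apply: eq_bigr => k kN.
rewrite (big_cat_nat (n := k))//=; last by lia.
rewrite [X in X + _]z ?add0r; last by move=> v h; rewrite ifF//; lia.
rewrite -[RHS]sumr_const_nat big_nat [RHS]big_nat.
by apply: eq_bigr => v /andP[-> _].
Qed.

(** The weights [(N - k)/N] lie in [[0, 1]], so Bessel's inequality bounds the coefficients, and the
    spectral condition kills the negative frequencies and those outside [Lambda]. *)
Lemma fejer_mean_trigpoly (Lambda : set nat) f (N : nat) : (0 < N)%N ->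
  L2spectrum Lambda f -> exists (A : {fset nat}) (a : nat -> R[i]),
  [/\ [set` A] `<=` Lambda,
     \sum_(k <- A) normc (a k) ^+ 2 <= fine (normL 2 f) ^+ 2
   & forall x, circle_integral (fun y => f y * (fejer N (x - y))%:C%C) = trigpoly A a x].
Proof.
move=> N0 [fL fs]; have fi := L2circle_cintegrable fL.
have f0 n : ~ (exists2 k, Lambda k & Posz k = n) -> fourier f n = 0.
  by move=> h; apply: fs => -[k Lk kn]; apply: h; exists k.
pose A := [fset k in [seq k <- iota 0 N | `[< Lambda k >]]]%fset.
pose a (k : nat) : R[i] := ((N - k)%:R / N%:R)%:C%C * fourier f k%:Z.
exists A, a; split.
- by move=> k /=; rewrite !finmap.inE /= mem_filter => /andP[/asboolP].
- apply: le_trans (bessel A fL); apply: ler_sum => k _.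
  rewrite /a ComplexField.Normc.normcM normc_real ger0_norm; last by rewrite divr_ge0.
  rewrite exprMn ler_piMl ?sqr_ge0// exprn_ile1 ?divr_ge0//.
  by rewrite ler_pdivrMr ?ltr0n// mul1r ler_nat leq_subr.
move=> x.
rewrite (_ : (fun y => _) = fun y => f y * trigsum
    [seq (k.1%:Z - k.2%:Z, N%:R^-1) | k <- [seq (k, l) | k <- iota 0 N, l <- iota 0 N]] (x - y)); last first.
  by apply/funext => y; rewrite fejer_trigsum.
rewrite conv_trigsum; last by move=> n; exact: cintegrable_mul_expc.
rewrite big_map big_allpairs_dep /=.
pose G n := N%:R^-1 * fourier f n * expc n x.
have -> : \sum_(k <- iota 0 N) \sum_(l <- iota 0 N) N%:R^-1 *
    fourier f (k%:Z - l%:Z) * expc (k%:Z - l%:Z) x =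
    \sum_(0 <= u < N) \sum_(0 <= v < N) G (u%:Z - v%:Z).
  by rewrite /index_iota subn0.
rewrite sum_triangle; last by move=> k; rewrite /G f0 ?mulr0 ?mul0r// => -[j].
have pA : perm_eq (enum_fset A) [seq k <- iota 0 N | `[< Lambda k >]].
  apply: uniq_perm; rewrite ?fset_uniq ?filter_uniq ?iota_uniq// => k.
  by rewrite !finmap.inE.
rewrite /trigpoly (perm_big _ pA) big_filter /= /index_iota subn0.
rewrite [RHS]big_mkcond /=; apply: eq_bigr => k _.
case: ifPn => [_|/asboolPn nk]; last first.
  rewrite /G f0 ?mulr0 ?mul0r ?mul0rn// => -[j Lj [jk]]; by rewrite jk in Lj.
have -> : a k = (N - k)%:R * N%:R^-1 * fourier f k%:Z.
  by rewrite /a (rmorphM (real_complex R)) (fmorphV (real_complex R)) !(rmorph_nat (real_complex R)).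
by rewrite -[G k%:Z *+ _]mulr_natl /G !mulrA.
Qed.

End FejerMeans.

(** * From trigonometric polynomials to square integrable functions *)

Section LambdaSet.
Context {R : realType}.
Implicit Types (f h : R -> R[i]) (x : R).
Local Notation cmu := (circle_measure R).
Local Notation lam := (@lebesgue_measure R).

Lemma fejer_cvg_ae (g : R -> R) : measurable_fun setT g ->
  cmu.-integrable setT (EFin \o g) ->
  {ae cmu, forall x,
    (fun n => Rintegral cmu setT (fun y => g y * fejer (2 ^ n) (x - y))) @ \oo --> g x}.
Proof.
move=> mg ig.
pose D : set R := `[0, 1[%classic.
have mD : measurable D by exact: measurable_itv.
have /integrableP[mg1 fin] := ig.
have iD : lam.-integrable setT (EFin \o (g \_ D)).
  rewrite (_ : EFin \o _ = (EFin \o g) \_ D); last first.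
    by apply/funext => y /=; rewrite !patchE; case: ifP.
  apply: (iffLR (@integrable_mkcond _ (measurableTypeR R) R lam D (EFin \o g) mD)).
  apply/integrableP; split; first by apply: measurable_funTS.
  rewrite -circle_integralE//; exact: measurableT_comp.
have [N [mN N0 sN]] := lebesgue_differentiation (open_integrable_locally openT iD).
(* Every neighbourhood of 0 leaves [[0, 1[], so this point is discarded as well; the complement of
   [D] is null for [circle_measure]. *)
exists (N `|` ([set 0] `|` ~` D)); split.
- by apply: measurableU => //; apply: measurableU => //; exact: measurableC.
- rewrite circle_measureE; apply: (@subset_measure0 _ _ _ lam _ (N `|` [set 0])).
  + apply: measurableI => //.
    by apply: measurableU => //; apply: measurableU => //; exact: measurableC.
  + exact: measurableU.
  + by move=> y [[?|[?|nD]] Dy]; [left|right|].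
  + by apply: etrans (measureU0 _ _ _) N0 => //; exact: lebesgue_measure_set1.
move=> x /= nx; apply: contrapT => /not_orP[nN /not_orP[x0 /contrapT xD]].
apply: nx; apply: fejer_cvg => //.
  move: xD x0; rewrite /D /= in_itv /= => /andP[x0 ->] /eqP xn0.
  by rewrite lt_neqAle eq_sym xn0 x0.
by apply: contrapT => h; apply: nN; exact: sN.
Qed.

Lemma cintegrable_trigpoly A a : cintegrable (@trigpoly R A a).
Proof.
rewrite (_ : trigpoly A a = trigsum [seq (k%:Z, a k) | k <- A]); first exact: cintegrable_trigsum.
by apply/funext => x; exact: trigpolyE.
Qed.

Lemma integral_trigpoly_pow_le A a (sigma : R) (s : nat) : 0 < sigma ->
  (forall k, k \in A -> (0 < k)%N) ->
  (forall n, quasi_independent (block A n)) ->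
  \sum_(k <- A) normc (a k) ^+ 2 <= sigma ^+ 2 * (10 ^- 6 / 4) ->
  (\int[cmu]_x (normc (trigpoly A a x) ^+ (2 * s))%:E <=
    (sigma ^+ (2 * s) * (40 * (2 * s)`!%:R))%:E)%E.
Proof.
move=> s0 A0 qA hs.
have [/integrableP[/measurable_EFinP m1 _] /integrableP[/measurable_EFinP m2 _]] :=
  cintegrable_trigpoly A a.
have i : cmu.-integrable setT (EFin \o (fun x => normc (trigpoly A a x) ^+ (2 * s))).
  apply: (@integrable_circle _ _ ((\sum_(k <- A) normc (a k)) ^+ (2 * s))).
    exact: measurable_normc_pow.
  move=> x; rewrite ger0_norm ?exprn_ge0 ?normc_ge0//.
  by rewrite lerXn2r ?nnegrE ?normc_ge0 ?normc_trigpoly_le// sumr_ge0// => k _; rewrite normc_ge0.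
rewrite -[X in (X <= _)%E]fineK; last exact: integrable_fin_num.
rewrite lee_fin.
pose b k := (sigma^-1)%:C%C * a k.
have E x : normc (trigpoly A a x) ^+ (2 * s) =
    sigma ^+ (2 * s) * normc (trigpoly A b x) ^+ (2 * s).
  rewrite -exprMn /b trigpolyZ ComplexField.Normc.normcM normc_real.
  by rewrite ger0_norm ?invr_ge0 ?(ltW s0)// mulrA mulfV ?mul1r// gt_eqF.
have mb : Rintegral cmu setT (fun x => normc (trigpoly A b x) ^+ (2 * s)) <=
    40 * (2 * s)`!%:R.
  apply: integral_normc_pow_le => //.
  have -> : \sum_(k <- A) normc (b k) ^+ 2 = sigma ^- 2 * \sum_(k <- A) normc (a k) ^+ 2.
    rewrite mulr_sumr; apply: eq_bigr => k _.
    by rewrite /b ComplexField.Normc.normcM normc_real exprMn real_normK ?num_real// exprVn.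
  by rewrite ler_pdivrMl// exprn_gt0.
have ib : cmu.-integrable setT (EFin \o (fun x => normc (trigpoly A b x) ^+ (2 * s))).
  rewrite (_ : _ \o _ = EFin \o (fun x => sigma ^- (2 * s) *
     normc (trigpoly A a x) ^+ (2 * s))); first exact: integrable_circleZ.
  by apply/funext => x /=; rewrite E mulrA mulVf ?mul1r// expf_neq0// gt_eqF.
apply: le_trans (_ : sigma ^+ (2 * s) *
  Rintegral cmu setT (fun x => normc (trigpoly A b x) ^+ (2 * s)) <= _).
  by rewrite -RintegralZl// le_eqVlt; apply/orP; left; apply/eqP; apply: eq_Rintegral => x _.
by rewrite ler_pM2l// exprn_gt0.
Qed.

Lemma limn_einf_le (u : nat -> \bar R) (M : \bar R) :
  (forall n, (u n <= M)%E) -> (limn_einf u <= M)%E.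
Proof.
move=> uM; rewrite limn_einf_lim; apply: lime_le; first exact: is_cvg_einfs.
by apply: nearW => n; apply: le_trans (uM n); apply: ereal_inf_lbound; exists n => /=.
Qed.

Lemma L2spectrum_pow_le (Lambda : set nat) f (sigma : R) (s : nat) :
  blockwise_independent Lambda -> L2spectrum Lambda f -> 0 < sigma ->
  fine (normL 2 f) ^+ 2 <= sigma ^+ 2 * (10 ^- 6 / 4) ->
  (\int[cmu]_x (normc (f x) ^+ (2 * s))%:E <=
    (sigma ^+ (2 * s) * (40 * (2 * s)`!%:R))%:E)%E.
Proof.
move=> [L0 LI] fL s0 fs; have [fL2 _] := fL.
have [i1 i2] := L2circle_cintegrable fL2; have [_ m1 m2 _] := fL2.
pose Q n x := circle_integral (fun y => f y * (fejer (2 ^ n) (x - y))%:C%C).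
pose F n x : \bar R := (normc (Q n x) ^+ (2 * s))%:E.
have QE n := fejer_mean_trigpoly (expn_gt0 2 n) fL.
have Qm n : measurable_fun setT (F n).
  have [A [a [_ _ E]]] := QE n.
  have [/integrableP[/measurable_EFinP n1 _] /integrableP[/measurable_EFinP n2 _]] :=
    cintegrable_trigpoly A a.
  apply/measurable_EFinP.
  rewrite (_ : (fun x => _) = fun x => normc (trigpoly A a x) ^+ (2 * s)).
    exact: measurable_normc_pow.
  by apply/funext => x; rewrite -E.
have F0 n x : (0 <= F n x)%E by rewrite lee_fin exprn_ge0// normc_ge0.
have Fle n : (\int[cmu]_x F n x <= (sigma ^+ (2 * s) * (40 * (2 * s)`!%:R))%:E)%E.
  have [A [a [AL aS E]]] := QE n.
  under eq_integral do rewrite /F /Q E.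
  apply: integral_trigpoly_pow_le => //; first by move=> k /AL/L0.
  - exact: LI.
  - exact: le_trans aS fs.
apply: le_trans (limn_einf_le Fle).
have ft := @fatou _ (measurableTypeR R) R cmu setT measurableT F Qm (fun n x _ => F0 n x).
apply: le_trans ft.
apply: ae_ge0_le_integral => //.
- by move=> x _; rewrite lee_fin exprn_ge0// normc_ge0.
- by apply/measurable_EFinP; exact: measurable_normc_pow.
- by move=> x _; rewrite limn_einf_lim; apply: lime_ge;
    [exact: is_cvg_einfs|apply: nearW => n; apply: le_ereal_inf_tmp => _ [m _ <-]].
- apply: measurableT_comp => //; apply: measurable_fun_limn_esup => n.
  by apply: measurableT_comp; [exact: oppe_measurable|exact: Qm].
have c1 := fejer_cvg_ae m1 i1.
have c2 := fejer_cvg_ae m2 i2.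
have FF : Filter (nbhs (almost_everywhere cmu)) by exact: (ae_filter_ringOfSetsType cmu).
apply: filterS2 c1 c2 => x h1 h2 _.
have nE (z : R[i]) : normc z ^+ (2 * s) = (complex.Re z ^+ 2 + complex.Im z ^+ 2) ^+ s.
  by rewrite exprM sqr_normcE.
suff cv : F n x @[n --> \oo] --> (normc (f x) ^+ (2 * s))%:E.
  by rewrite (cvg_limn_einf_sup cv).1.
apply: cvg_EFin; first exact: nearW.
rewrite (_ : fine \o _ = fun n => (complex.Re (Q n x) ^+ 2 + complex.Im (Q n x) ^+ 2) ^+ s); last first.
  by apply/funext => n; exact: nE.
rewrite nE.
have q1 : complex.Re (Q n x) @[n --> \oo] --> complex.Re (f x).
  apply: cvg_trans h1; apply: near_eq_cvg; apply: nearW => n.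
  by apply: eq_Rintegral => y _; case: (f y) => u v /=; rewrite mulr0 subr0.
have q2 : complex.Im (Q n x) @[n --> \oo] --> complex.Im (f x).
  apply: cvg_trans h2; apply: near_eq_cvg; apply: nearW => n.
  by apply: eq_Rintegral => y _; case: (f y) => u v /=; rewrite mulr0 add0r.
have cX (u : nat -> R) (l : R) m : u n @[n --> \oo] --> l -> u n ^+ m @[n --> \oo] --> l ^+ m.
  move=> ul; elim: m => [|m IH]; first by under eq_fun do rewrite expr0; rewrite expr0; exact: cvg_cst.
  by under eq_fun do rewrite exprS; rewrite exprS; exact: cvgM.
by apply: (cX); apply: cvgD; apply: (cX).
Qed.

Theorem blockwise_independent_Lambda (q : R) (Lambda : set nat) : 0 < q ->
  blockwise_independent Lambda -> Lambda_set q Lambda.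
Proof.
move=> q0 LI.
pose s := (Num.bound q).+1.
have qs : q <= (2 * s)%:R.
  apply: le_trans (ltW (archi_boundP (ltW q0))) _; rewrite ler_nat /s; lia.
pose K : R := 1 + 40 * (2 * s)`!%:R.
have K0 : 0 < K by rewrite /K ltr_pwDl// mulr_ge0.
pose C := 2 * 10 ^+ 3 * K `^ q^-1.
have C0 : 0 < C by rewrite /C mulr_gt0 ?powR_gt0// mulr_gt0// exprn_gt0.
exists C => f fL; have [fL2 _] := fL.
have [_ fn _] := L2circle_sqr fL2; have [_ m1 m2 _] := fL2.
pose tau := fine (normL 2 f).
have tau0 : 0 <= tau by apply: fine_ge0; exact: Lnorm_ge0.
(* [tau] may be 0 while the normalisation divides by it; hence a bound for every positive
   [T >= tau], then [T] tending to [tau]. *)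
suff main (T : R) : 0 < T -> tau <= T -> (normL q f <= (C * T)%:E)%E.
  rewrite -(fineK fn) -/tau -EFinM; apply/lee_addgt0Pr => e e0.
  have -> : ((C * tau)%:E + e%:E = (C * (tau + e / C))%:E)%E.
    by rewrite -EFinD mulrDr mulrCA mulfV ?mulr1// gt_eqF.
  have eC : 0 < e / C by rewrite divr_gt0.
  by apply: main; lra.
move=> T0 tT.
(* Makes [sigma^2 * 10^-6 / 4] equal to [T^2]. *)
pose sigma := 2 * 10 ^+ 3 * T.
have s0 : 0 < sigma by rewrite /sigma mulr_gt0// mulr_gt0// exprn_gt0.
have h := @L2spectrum_pow_le Lambda f sigma s LI fL s0.
have {}h : (\int[cmu]_x (normc (f x) ^+ (2 * s))%:E <=
    (sigma ^+ (2 * s) * (40 * (2 * s)`!%:R))%:E)%E.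
  apply: h; have -> : sigma ^+ 2 * (10 ^- 6 / 4) = T ^+ 2 by rewrite /sigma; field.
  by rewrite lerXn2r ?nnegrE ?(ltW T0).
(* A pointwise comparison of the powers [q <= 2s], split at [y = sigma], used in place of the
   monotonicity of [L^q] norms. *)
have pw (y : R) : 0 <= y -> y `^ q <= sigma `^ q + sigma `^ q / sigma ^+ (2 * s) * y ^+ (2 * s).
  move=> y0; have A0 : 0 <= sigma `^ q / sigma ^+ (2 * s).
    by apply: divr_ge0; [exact: powR_ge0|apply: exprn_ge0; exact: ltW].
  have [ys|ys] := leP y sigma.
    apply: (ler_wpDr (mulr_ge0 A0 (exprn_ge0 _ y0))).
    by apply: ge0_ler_powR; rewrite ?nnegrE ?(ltW q0) ?(ltW s0).
  rewrite ler_wpDl ?powR_ge0//.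
  have -> : y = sigma * (y / sigma) by rewrite mulrCA mulfV ?mulr1// gt_eqF.
  have z1 : 1 <= y / sigma by rewrite ler_pdivlMr// mul1r ltW.
  rewrite powRM ?(ltW s0)//; last by rewrite (le_trans _ z1).
  have sn : sigma ^+ (2 * s) != 0 by rewrite expf_neq0// gt_eqF.
  rewrite [(sigma * _) ^+ _]exprMn [leRHS]mulrA (mulfVK sn) ler_pM2l ?powR_gt0//.
  by rewrite -powR_mulrn ?(le_trans _ z1)// ler_powR.
have mn : measurable_fun setT (fun x => normc (f x)).
  rewrite (_ : (fun x => _) = fun x => (normc (f x) ^+ 2) `^ 2^-1); last first.
    apply/funext => x; rewrite -powR_mulrn ?normc_ge0// -powRrM mulfV//.
    by rewrite powRr1// normc_ge0.
  apply: (measurableT_comp (measurable_powR _)).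
  exact: (@measurable_normc_pow _ f 1).
have hq : (\int[cmu]_x (normc (f x) `^ q)%:E <= (sigma `^ q * K)%:E)%E.
  apply: (@le_trans _ _ (\int[cmu]_x ((sigma `^ q)%:E +
     (sigma `^ q / sigma ^+ (2 * s))%:E * (normc (f x) ^+ (2 * s))%:E))%E).
    apply: ge0_le_integral => //.
    - by move=> x _; rewrite lee_fin powR_ge0.
    - apply/measurable_EFinP; apply: (measurableT_comp (measurable_powR _)) => //.
    - by apply: emeasurable_funD => //; apply: measurable_funeM; apply/measurable_EFinP; exact: measurable_normc_pow.
    - by move=> x _; rewrite -EFinM -EFinD lee_fin pw// normc_ge0.
  rewrite ge0_integralD//; last 3 first.
  - by move=> x _; rewrite lee_fin powR_ge0.
  - by move=> x _; rewrite -EFinM lee_fin mulr_ge0 ?divr_ge0 ?powR_ge0 ?exprn_ge0 ?normc_ge0 ?(ltW s0).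
  - by apply: measurable_funeM; apply/measurable_EFinP; exact: measurable_normc_pow.
  rewrite integral_cst// [X in (_ * X)%E]circle_measureT mule1.
  rewrite ge0_integralZl_EFin//; last 3 first.
  - by move=> x _; rewrite lee_fin exprn_ge0// normc_ge0.
  - by apply/measurable_EFinP; exact: measurable_normc_pow.
  - by rewrite divr_ge0 ?powR_ge0// exprn_ge0// ltW.
  apply: le_trans (leeD (lexx _) (lee_wpmul2l _ h)) _.
    by rewrite lee_fin divr_ge0 ?powR_ge0// exprn_ge0// ltW.
  have sn : sigma ^+ (2 * s) != 0 by rewrite expf_neq0// gt_eqF.
  rewrite -EFinM -EFinD lee_fin /K [leRHS]mulrDr mulr1 [sigma `^ q / _ * _]mulrA.
  by rewrite (mulfVK sn).
have E := powR_normL f (lt0r_neq0 q0).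
have nf0 : (0 <= normL q f)%E by exact: Lnorm_ge0.
move: hq; rewrite -E => hq.
have nfin : normL q f \is a fin_num.
  rewrite ge0_fin_numE//; apply: (@lty_poweRy _ _ q); first by rewrite gt_eqF.
  by apply: le_lt_trans hq _; rewrite ltry.
rewrite -(fineK nfin) poweR_EFin lee_fin in hq; rewrite -(fineK nfin) lee_fin.
have n0 : 0 <= fine (normL q f) by exact: fine_ge0.
have -> : C * T = (sigma `^ q * K) `^ q^-1.
  rewrite powRM ?powR_ge0 ?(ltW K0)// -powRrM mulfV ?gt_eqF// powRr1 ?(ltW s0)//.
  rewrite /C /sigma; ring.
have -> : fine (normL q f) = (fine (normL q f) `^ q) `^ q^-1.
  by rewrite -powRrM mulfV ?gt_eqF// powRr1.
by rewrite ge0_ler_powR ?invr_ge0 ?nnegrE ?powR_ge0 ?mulr_ge0 ?powR_ge0 ?(ltW q0) ?(ltW K0).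
Qed.

End LambdaSet.

(** * Random sets *)

Section Events.
Context (R : realType) (d : measure_display) (Omega : measurableType d).
Context (P : probability Omega R).
Implicit Types (J S : {fset nat}) (p : nat -> R).

Definition independent_events J (A : nat -> set Omega) p : Prop :=
  [/\ forall k, k \in J -> measurable (A k), forall k, k \in J -> 0 <= p k
    & forall S, (S `<=` J)%fset ->
        P (\bigcap_(k in [set` S]) A k) = (\prod_(k <- S) p k)%:E].

(** [h] holds the signs of a relation away from its pivot, and [S] is its support. The event asks
    that pivot and support all be selected; it is empty when the computed [k0] is not a new element
    of [J]. *)
Definition relation_event J (A : nat -> set Omega) (h : {ffun J -> 'I_3}) : set Omega :=
  let k0 := `|(\sum_(k : J) sgn3 (h k) * (val k)%:Z)%R|%N in
  let S := [fset k in J | if insub k is Some k' then h k' != 0 else false]%fset in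
  if (k0 \in J) && (k0 \notin S) then
    \bigcap_(k in [set` (k0 |` S)%fset]) A k
  else set0.

(* In a relation any one element [k0], the pivot, is determined by the signs of
   the others: [k0 = |sum eta_k k|].  Leaving it out of the sign patterns gains a
   factor [q] in the union bound. *)
Lemma not_quasi_independent_event J (A : nat -> set Omega) (w : Omega) :
  ~ quasi_independent [fset k in J | `[< A k w >]]%fset ->
  exists h : {ffun J -> 'I_3}, relation_event A h w.
Proof.
set U := [fset k in J | _]%fset.
have UE k : (k \in U) = (k \in J) && `[< A k w >] by rewrite !finmap.inE.
move=> nq; have [eta [etab [etas [k1 k1U k1n]]]] : exists eta : nat -> int,
    (forall k, k \in U -> `|eta k| <= 1) /\
    (\sum_(k <- U) eta k * k%:Z = 0) /\ (exists2 k, k \in U & eta k != 0).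
  apply: contrapT => h; apply: nq => eta e1 e2 k kU; apply/eqP/negPn/negP => ek.
  by apply: h; exists eta; split => //; split => //; exists k.
have k1J : k1 \in J by move: k1U; rewrite UE => /andP[].
(* The relation with the entry of the pivot [k1] erased. The remaining sum is [- eta k1 * k1], whose
   absolute value is [k1] since [eta k1] is 1 or -1. *)
pose h : {ffun J -> 'I_3} := [ffun k : J => if (val k \in U) && (val k != k1) then
   (if eta (val k) == 1 then 1 else if eta (val k) == -1 then 2%:R else 0) else 0].
have hE (k : J) : sgn3 (h k) = if (val k \in U) && (val k != k1) then eta (val k) else 0.
  rewrite /h ffunE; case: ifP => [/andP[kU _]|//].
  move: (eta _) (etab _ kU) => x; rewrite /sgn3.
  case: (eqVneq x 1) => [-> //|n1].
  case: (eqVneq x (-1)) => [-> //|n2] /= e1; lia.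
have sumE : \sum_(k : J) sgn3 (h k) * (val k)%:Z = - (eta k1 * k1%:Z).
  apply/eqP; rewrite -addr_eq0; apply/eqP; rewrite -[RHS]etas.
  rewrite [RHS](bigD1_seq k1)//= addrC; congr (_ + _).
  have pU : perm_eq (enum_fset U) [seq k <- enum_fset J | `[< A k w >]].
    apply: uniq_perm; rewrite ?fset_uniq ?filter_uniq ?fset_uniq// => k.
    by rewrite UE mem_filter andbC.
  rewrite (perm_big _ pU) big_filter_cond /= big_seq_fsetE /= [RHS]big_mkcond /=.
  apply: eq_bigr => k _; rewrite hE UE (valP k) /=.
  by case: ifP => //; rewrite mul0r.
have k0E : `|(\sum_(k : J) sgn3 (h k) * (val k)%:Z)%R|%N = k1.
  rewrite sumE abszN abszM absz_nat -[RHS]mul1n; congr (_ * _)%N.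
  move: k1n (etab _ k1U); move: (eta k1) => x; lia.
exists h; rewrite /relation_event k0E k1J /=.
set S := [fset k in J | _]%fset.
have SE k : k \in S -> (k \in U) && (k != k1).
  rewrite !finmap.inE /= => /andP[kJ].
  case: insubP => // j _ jk; rewrite /h ffunE jk -UE.
  by case: ifP.
rewrite ifT; last by apply/negP => /SE; rewrite eqxx andbF.
have AU k : k \in U -> A k w by rewrite UE => /andP[_ /asboolP].
by move=> k /= /fset1UP[->|/SE/andP[kU _]]; exact: AU.
Qed.

Lemma relation_event_le J A p (q : R) (h : {ffun J -> 'I_3}) :
  independent_events J A p -> (forall k, k \in J -> p k <= q) -> 0 <= q ->
  measurable (relation_event A h) /\
  (P (relation_event A h) <=
    (q * \prod_(k : J) (if h k == 0 then 1 else p (val k)))%:E)%E.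
Proof.
move=> [mA p0 PA] pq q0.
have R0 : (0 <= (q * \prod_(k : J) (if h k == 0 then 1 else p (val k)))%:E)%E.
  rewrite lee_fin mulr_ge0// prodr_ge0// => k _; by case: ifP => // _; apply: p0; exact: valP.
rewrite /relation_event; set k0 := `|_|%N; set S := [fset k in J | _]%fset.
case: ifPn => [/andP[k0J k0S]|_]; last by split => //; rewrite measure0.
have SJ : (S `<=` J)%fset by apply/fsubsetP => k; rewrite !finmap.inE => /andP[].
have kSJ : ((k0 |` S) `<=` J)%fset by rewrite fsubUset fsub1set k0J.
split.
  by apply: fin_bigcap_measurable => // k /= /(fsubsetP kSJ); exact: mA.
rewrite PA// lee_fin big_fsetU1//=.
have -> : \prod_(k <- S) p k = \prod_(k : J) (if h k == 0 then 1 else p (val k)).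
  have pS : perm_eq (enum_fset S) [seq k <- enum_fset J | if insub k is Some k' then h k' != 0 else false].
    apply: uniq_perm; rewrite ?fset_uniq ?filter_uniq ?fset_uniq// => k.
    by rewrite !finmap.inE mem_filter andbC.
  rewrite (perm_big _ pS) big_filter /= big_seq_fsetE /= big_mkcond /=.
  by apply: eq_bigr => k _; rewrite valK; case: eqP.
rewrite ler_wpM2r ?pq// prodr_ge0// => k _; by case: ifP => // _; apply: p0; exact: valP.
Qed.

(** The union bound over patterns factorises: each [k] is either absent, for 1, or present with one
    of two signs, for [2 p k]. The pivot contributes the factor [q]. *)
Lemma not_quasi_independent_prob J A p (q : R) :
  independent_events J A p -> (forall k, k \in J -> p k <= q) -> 0 <= q ->
  exists F : set Omega, [/\ measurable F,
    forall w, ~ quasi_independent [fset k in J | `[< A k w >]]%fset -> F w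
  & (P F <= (q * \prod_(k <- J) (1 + 2 * p k))%:E)%E].
Proof.
move=> IA pq q0; pose E := relation_event A (J := J).
have hE h := relation_event_le h IA pq q0.
exists (\big[setU/set0]_(h : {ffun J -> 'I_3}) E h); split.
- by apply: bigsetU_measurable => h _; exact: (hE h).1.
- move=> w /not_quasi_independent_event[h hw].
  by rewrite -bigcup_seq; exists h => //=; rewrite mem_index_enum.
have sub : (P (\big[setU/set0]_(h : {ffun J -> 'I_3}) E h) <= \sum_(h : {ffun J -> 'I_3}) P (E h))%E.
  suff : measurable (\big[setU/set0]_(h : {ffun J -> 'I_3}) E h) /\
    (P (\big[setU/set0]_(h : {ffun J -> 'I_3}) E h) <= \sum_(h : {ffun J -> 'I_3}) P (E h))%E by case.
  elim/big_ind2 : _ => [|X x Y y [mX hX] [mY hY]|h _]; first by rewrite measure0.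
    split; first exact: measurableU.
    by apply: (@le_trans _ _ (P x + P y)%E); [exact: measureU2|exact: leeD].
  by split; [exact: (hE h).1|].
apply: le_trans sub _.
apply: (@le_trans _ _ (\sum_(h : {ffun J -> 'I_3})
   (q * \prod_(k : J) (if h k == 0 then 1 else p (val k)))%:E)%E).
  by apply: lee_sum => h _; exact: (hE h).2.
rewrite sumEFin lee_fin -mulr_sumr big_seq_fsetE /=.
rewrite -(bigA_distr_bigA (fun (k : J) (j : 'I_3) => if j == 0 then 1 else p (val k))) /=.
rewrite le_eqVlt; apply/orP; left; apply/eqP; congr (_ * _).
apply: eq_bigr => k _; rewrite !big_ord_recl big_ord0 /=; ring.
Qed.

End Events.

(** * Chebyshev's inequality and the Borel-Cantelli lemma *)

Section Chebyshev.
Context (R : realType) (d : measure_display) (Omega : measurableType d).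
Context (P : probability Omega R).

Lemma integral_indics (s : seq (R * set Omega)) :
  (forall u, u \in s -> measurable u.2) ->
  P.-integrable setT (EFin \o (fun w => \sum_(u <- s) u.1 * \1_(u.2) w)) /\
  Rintegral P setT (fun w => \sum_(u <- s) u.1 * \1_(u.2) w) =
  \sum_(u <- s) u.1 * fine (P u.2).
Proof.
elim: s => [_|u s IH ms].
  under eq_fun do rewrite big_nil.
  by split; [exact: integrable0|rewrite big_nil Rintegral_cst// mul0r].
pose S w : R := \sum_(v <- s) v.1 * \1_(v.2) w.
have [iS eS] : P.-integrable setT (EFin \o S) /\
    Rintegral P setT S = \sum_(v <- s) v.1 * fine (P v.2).
  by apply: IH => v vs; apply: ms; rewrite seq.inE vs orbT.
have mu2 : measurable u.2 by apply: ms; rewrite mem_head.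
have iu : P.-integrable setT (EFin \o \1_(u.2)).
  exact: integrable_indic.
have icu : P.-integrable setT (EFin \o (fun w => u.1 * \1_(u.2) w)).
  rewrite (_ : _ \o _ = (fun w => u.1%:E * (EFin \o \1_(u.2)) w))%E//.
  exact: integrableZl.
rewrite (_ : (fun w => _) = fun w => u.1 * \1_(u.2) w + S w); last first.
  by apply/funext => w; rewrite big_cons.
split.
  exact: (integrableD measurableT icu iS).
rewrite RintegralD// eS big_cons RintegralZl//.
by rewrite /Rintegral integral_indic// setIT.
Qed.

(** Pairwise independent indicators have a sum of variance at most its mean. The squared deviation
    is expanded into indicators of the [A k], of their pairwise intersections and of the whole
    space, so its integral is a finite sum. *)
Lemma chebyshev_events (r : seq nat) (A : nat -> set Omega) (p : nat -> R) (a : R) :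
  uniq r -> (forall k, k \in r -> measurable (A k)) ->
  (forall k, k \in r -> P (A k) = (p k)%:E) -> (forall k, k \in r -> 0 <= p k) ->
  (forall k l, k \in r -> l \in r -> k != l -> P (A k `&` A l) = (p k * p l)%:E) ->
  0 < a ->
  measurable [set w | a <= `|\sum_(k <- r) \1_(A k) w - \sum_(k <- r) p k| ] /\
  (P [set w | (a <= `|\sum_(k <- r) \1_(A k) w - \sum_(k <- r) p k|)%R ] <=
    ((\sum_(k <- r) p k) / a ^+ 2)%:E)%E.
Proof.
move=> ur mA PA p0 PAA a0; set m := \sum_(k <- r) p k.
pose Z w : R := \sum_(k <- r) \1_(A k) w.
set F := [set w | _].
have mZ : measurable_fun setT Z.
  rewrite /Z; elim: r {ur PA p0 PAA m F Z} mA => [|k r IH] mA.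
    by under eq_fun do rewrite big_nil; exact: measurable_cst.
  under eq_fun do rewrite big_cons.
  apply: measurable_funD; first by apply: measurable_indic; apply: mA; rewrite mem_head.
  by apply: IH => l lr; apply: mA; rewrite seq.inE lr orbT.
have mF : measurable F.
  rewrite (_ : F = setT `&` (fun w => `|Z w - m|) @^-1` `[a, +oo[%classic).
    apply: measurableT_comp => //; exact: measurable_funB.
  by rewrite setTI; apply/seteqP; split => w; rewrite /F /= in_itv /= andbT.
split => //.
pose s := [seq (1, A u.1 `&` A u.2) | u <- [seq (k, l) | k <- r, l <- r]] ++
   [seq (- (2 * m), A k) | k <- r] ++ [:: (m ^+ 2, setT)].
have ms u : u \in s -> measurable u.2.
  rewrite !mem_cat => /or3P[/mapP[[k l] /allpairsP[[k1 l1] /= [kr lr [-> ->]]] ->]|/mapP[k kr ->]|].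
  - by apply: measurableI; exact: mA.
  - exact: mA.
  - by rewrite mem_seq1 => /eqP -> /=; exact: measurableT.
have [i1 e1] := integral_indics ms.
have E w : \sum_(u <- s) u.1 * \1_(u.2) w = (Z w - m) ^+ 2.
  rewrite !big_cat /= big_seq1 /= indicT mulr1 !big_map big_allpairs_dep /=.
  have -> : \sum_(k <- r) \sum_(l <- r) 1 * \1_(A k `&` A l) w = Z w * Z w :> R.
    rewrite /Z mulr_suml; apply: eq_bigr => k _; rewrite mulr_sumr; apply: eq_bigr => l _.
    by rewrite indicI mul1r.
  rewrite -mulr_sumr -/(Z w); ring.
(* The diagonal pairs give [p k] where independence would give [p k ^ 2], so the double sum is at
   most [m^2 + m]; the other two parts add [- 2 m^2 + m^2]. *)
have V : \sum_(u <- s) u.1 * fine (P u.2) <= m.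
  rewrite !big_cat /= big_seq1 /= probability_setT mulr1 !big_map big_allpairs_dep /=.
  have -> : \sum_(k <- r) - (2 * m) * fine (P (A k)) = - (2 * m) * m.
    by rewrite /m [RHS]mulr_sumr; apply: eq_big_seq => k kr; rewrite PA.
  have : \sum_(k <- r) \sum_(l <- r) 1 * fine (P (A k `&` A l)) <= \sum_(k <- r) (p k * m + p k).
    rewrite big_seq [leRHS]big_seq; apply: ler_sum => k kr.
    rewrite (bigD1_seq k)//= setIid PA// mul1r /= addrC lerD2r.
    rewrite /m mulr_sumr [leRHS](bigD1_seq k)//= ler_wpDl ?mulr_ge0 ?p0//.
    rewrite big_seq_cond [leRHS]big_seq_cond; apply: ler_sum => l /andP[lr lk].
    by rewrite mul1r PAA// eq_sym.
  rewrite big_split /= -mulr_suml -/m; lra.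
have iF : P.-integrable setT (EFin \o \1_F) by exact: integrable_indic.
have aI : a ^+ 2 * fine (P F) <= m.
  have -> : a ^+ 2 * fine (P F) = Rintegral P setT (fun w => a ^+ 2 * \1_F w).
    by rewrite RintegralZl// /Rintegral integral_indic// setIT.
  apply: le_trans V; rewrite -e1.
  apply: le_Rintegral => //.
    rewrite (_ : _ \o _ = (fun w => (a ^+ 2)%:E * (EFin \o \1_F) w))%E//.
    exact: integrableZl.
  move=> w _; rewrite E indicE.
  have [/set_mem|_] := boolP (w \in F); last by rewrite mulr0 sqr_ge0.
  rewrite /F /= -/(Z w) => h; rewrite mulr1 -[(Z w - m) ^+ 2]real_normK ?num_real//.
  by rewrite lerXn2r ?nnegrE ?(ltW a0).
rewrite -[P F]fineK ?fin_num_measure// lee_fin ler_pdivlMr ?exprn_gt0// mulrC//.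
Qed.

Lemma ae_eventually_not (F : nat -> set Omega) (K : R) :
  (forall n, measurable (F n)) ->
  (forall n, (P (F n) <= (K / n.+1%:R ^+ 2)%:E)%E) ->
  {ae P, forall w, exists n0, forall n, (n0 <= n)%N -> ~ F n w}.
Proof.
move=> mF PF.
have h : P (lim_sup_set F) = 0%E.
  apply: lim_sup_set_cvg0 => //.
  have K0 : 0 <= K by have := le_trans (measure_ge0 P _) (PF 0%N); rewrite lee_fin expr1n divr1.
  (* Telescoping: [1/(x+1)^2] is at most [1/x - 1/(x+1)]. *)
  have S k : \sum_(i < k.+1) K / i.+1%:R ^+ 2 <= K * (2 - k.+1%:R^-1).
    elim: k => [|k IH]; first by rewrite big_ord1 expr1n divr1 invr1; lra.
    rewrite big_ord_recr /=; apply: le_trans (lerD IH (lexx _)) _.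
    rewrite -mulrDr ler_wpM2l// -lerBrDl.
    have k0 : (0 : R) < k.+1%:R by rewrite ltr0n.
    have -> : k.+2%:R = k.+1%:R + 1 :> R by rewrite natr1.
    set x : R := k.+1%:R in k0 *.
    rewrite -subr_ge0.
    have -> : 2 - (x + 1)^-1 - (2 - x^-1) - ((x + 1) ^+ 2)^-1 = (x * (x + 1) ^+ 2)^-1.
      by field; rewrite !gt_eqF//; lra.
    by rewrite invr_ge0 mulr_ge0 ?(ltW k0)// sqr_ge0.
  apply: (@le_lt_trans _ _ (K * 2)%:E); last exact: ltry.
  apply: lime_le; first exact: is_cvg_nneseries.
  apply: nearW => k; rewrite big_mkord.
  apply: (@le_trans _ _ (\sum_(i < k) (K / i.+1%:R ^+ 2)%:E)%E).
    by apply: lee_sum => i _; exact: PF.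
  rewrite sumEFin lee_fin; case: k => [|k]; first by rewrite big_ord0 mulr_ge0.
  apply: le_trans (S k) _; rewrite ler_wpM2l// lerBlDl lerDr invr_ge0.
  exact: ler0n.
exists (lim_sup_set F); split => //.
- by apply: bigcap_measurable => // n _; apply: bigcup_measurable.
move=> w /= nw n _; apply: contrapT => h1; apply: nw; exists n => m nm Fm.
by apply: h1; exists m.
Qed.

End Chebyshev.

(** * The weights log k / k over dyadic blocks *)

Section Weights.
Context {R : realType}.

Definition weight (k : nat) : R := ln k%:R / k%:R.

(** The first quarter of the dyadic block of [k]. For blocks 0 and 1 the integer quotient is 0, so
    no positive [k < 4] qualifies. *)
Definition dyadic_head (k : nat) : bool :=
  (k < 2 ^ trunc_log 2 k + 2 ^ trunc_log 2 k %/ 4)%N.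

Lemma ln2_gt0 : 0 < ln 2 :> R.
Proof. by rewrite ln_gt0// ltr1n. Qed.

Lemma ln_expn n : ln (2 ^ n)%:R = n%:R * ln 2 :> R.
Proof. by rewrite natrX lnXn// mulr_natl. Qed.

Lemma weight_ge0 k : (0 < k)%N -> 0 <= weight k.
Proof. by move=> k0; rewrite /weight divr_ge0// ln_ge0// ler1n. Qed.

Lemma weight_le n k : (2 ^ n <= k < 2 ^ n.+1)%N ->
  weight k <= n.+1%:R * ln 2 * 2^-1 ^+ n.
Proof.
move=> /andP[k1 k2]; have k0 : (0 < k)%N by apply: leq_trans k1; rewrite expn_gt0.
rewrite /weight exprVn; apply: ler_pM; rewrite ?invr_ge0//.
- by rewrite ln_ge0// ler1n.
- by rewrite -ln_expn ler_ln ?posrE ?ltr0n ?expn_gt0// ler_nat ltnW.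
- by rewrite -natrX lef_pV2 ?posrE ?ltr0n ?expn_gt0// ler_nat.
Qed.

Lemma weight_ge n k : (2 ^ n <= k < 2 ^ n.+1)%N ->
  n%:R * ln 2 * 2^-1 ^+ n.+1 <= weight k.
Proof.
move=> /andP[k1 k2]; have k0 : (0 < k)%N by apply: leq_trans k1; rewrite expn_gt0.
rewrite /weight exprVn; apply: ler_pM; rewrite ?invr_ge0//.
- by rewrite mulr_ge0// ltW// ln2_gt0.
- by rewrite -ln_expn ler_ln ?posrE ?ltr0n ?expn_gt0// ler_nat.
- by rewrite -natrX lef_pV2 ?posrE ?ltr0n ?expn_gt0// ler_nat ltnW.
Qed.

Lemma sum_weight_le n : \sum_(1 <= k < 2 ^ n) weight k <= ln 2 * n%:R ^+ 2.
Proof.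
suff h : \sum_(1 <= k < 2 ^ n) weight k <= ln 2 * (n%:R * (n%:R + 1) / 2).
  apply: le_trans h _; rewrite ler_wpM2l ?(ltW ln2_gt0)//.
  have : n%:R <= n%:R ^+ 2 :> R by rewrite -natrX ler_nat -mulnn; case: n => // n; rewrite leq_pmulr.
  nra.
elim: n => [|n IH]; first by rewrite expn0 big_geq// !mul0r mulr0.
rewrite (big_cat_nat (n := 2 ^ n)) ?expn_gt0//=; last by rewrite leq_exp2l.
have h : \sum_(2 ^ n <= k < 2 ^ n.+1) weight k <= n.+1%:R * ln 2.
  apply: (@le_trans _ _ (\sum_(2 ^ n <= k < 2 ^ n.+1) n.+1%:R * ln 2 * 2^-1 ^+ n)).
    by rewrite big_nat [leRHS]big_nat; apply: ler_sum => k hk; exact: weight_le.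
  rewrite sumr_const_nat expnS mul2n -addnn addnK -[_ *+ (2 ^ n)%N]mulr_natr natrX exprVn mulfVK ?expf_neq0//.
apply: le_trans (lerD IH h) _; rewrite -(natr1 n); set x : R := n%:R; lra.
Qed.

Lemma dyadic_headE n k : (2 ^ n <= k < 2 ^ n.+1)%N ->
  dyadic_head k = (k < 2 ^ n + 2 ^ n %/ 4)%N.
Proof. by move=> h; rewrite /dyadic_head (@trunc_log_eq _ n). Qed.

(** For [n >= 2], the head of block [n] has [2^n/4] terms of at least [n ln 2 / 2^(n+1)], that is
    [n ln 2 / 8] in all: exactly the increment of the left side. The [- 2] makes it nonpositive up
    to [n = 2], where the induction proper starts. *)
Lemma sum_weight_ge n : ln 2 * (n%:R ^+ 2 - n%:R - 2) / 16 <=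
  \sum_(1 <= k < 2 ^ n | dyadic_head k) weight k.
Proof.
have S0 m : 0 <= \sum_(1 <= k < m | dyadic_head k) weight k.
  by rewrite big_nat_cond sumr_ge0// => k /andP[/andP[k1 _] _]; exact: weight_ge0.
have t0 := ln2_gt0.
elim: n => [|n IH].
  apply: le_trans (S0 _); nra.
have [n2|n2] := ltnP n 2.
  apply: le_trans (S0 _); rewrite -(natr1 n).
  have : n%:R <= 1 :> R by rewrite (ler_nat _ n 1).
  have : 0 <= n%:R :> R by [].
  set x : R := n%:R => x0 x1.
  have : (x + 1) ^+ 2 - (x + 1) - 2 <= 0 by nra.
  nra.
rewrite (big_cat_nat (n := 2 ^ n)) ?expn_gt0//=; last by rewrite leq_exp2l.
have d4 : (4 %| 2 ^ n)%N by rewrite (dvdn_exp2l 2 n2).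
have h : n%:R * ln 2 / 8 <= \sum_(2 ^ n <= k < 2 ^ n.+1 | dyadic_head k) weight k.
  have le2 : (2 ^ n + 2 ^ n %/ 4 <= 2 ^ n.+1)%N.
    by rewrite expnS mul2n -addnn leq_add2l leq_div.
  rewrite (big_cat_nat (n := 2 ^ n + 2 ^ n %/ 4)) ?leq_addr//=.
  apply: ler_wpDr.
    rewrite big_nat_cond sumr_ge0// => k /andP[/andP[k1 _] _]; apply: weight_ge0.
    by apply: leq_trans k1; rewrite addn_gt0 expn_gt0.
  apply: (@le_trans _ _ (\sum_(2 ^ n <= k < 2 ^ n + 2 ^ n %/ 4) n%:R * ln 2 * 2^-1 ^+ n.+1)).
    rewrite sumr_const_nat addKn -[_ *+ (2 ^ n %/ 4)%N]mulr_natr.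
    have -> : (2 ^ n %/ 4)%:R = 2 ^+ n / 4 :> R by rewrite -natrX -{2}(divnK d4) natrM mulfK.
    rewrite le_eqVlt; apply/orP; left; apply/eqP.
    rewrite exprVn exprS; field; exact: expf_neq0.
  rewrite big_nat [leRHS]big_nat_cond.
  rewrite [leRHS](eq_bigl (fun k => (2 ^ n <= k < 2 ^ n + 2 ^ n %/ 4)%N)); last first.
    move=> k; apply/andP/idP => [[]//|hk]; split => //.
    by rewrite (@dyadic_headE n) ?(andP hk).2// (andP hk).1 (leq_trans (andP hk).2).
  apply: ler_sum => k hk; apply: weight_ge.
  by rewrite (andP hk).1 (leq_trans (andP hk).2).
apply: le_trans _ (lerD IH h); rewrite -(natr1 n); set x : R := n%:R; lra.
Qed.

Lemma expR_cube_le (x : R) : 0 < x -> expR (- x) <= 6 / x ^+ 3.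
Proof.
move=> x0; rewrite expRN -[6 / _]invf_div lef_pV2 ?posrE ?expR_gt0 ?divr_gt0 ?exprn_gt0//.
rewrite ler_pdivrMr// mulrC; have := exprn_le_expR 3 (ltW x0).
by rewrite (_ : 3`!%:R = 6).
Qed.

(** With [u = (n+1) ln 2 / 2] the product is at most [e^u] and the pivot factor is
    [2 (n+1) ln 2 e^(-2u)]. The remaining [e^(-u)] is weakened to [6/u^3], which leaves a multiple
    of [1/(n+1)^2], the form used for Borel-Cantelli. *)
Lemma prod_weight_le n :
  n.+1%:R * ln 2 * 2^-1 ^+ n * \prod_(k <- iota (2 ^ n) (2 ^ n %/ 4)) (1 + 2 * weight k) <=
  96 / ln 2 ^+ 2 / n.+1%:R ^+ 2.
Proof.
have t0 := ln2_gt0; set q := n.+1%:R * ln 2 * 2^-1 ^+ n.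
have q0 : 0 <= q by rewrite /q mulr_ge0 ?exprn_ge0// mulr_ge0// ltW.
have E : expR (n.+1%:R * ln 2) = 2 ^+ n.+1 :> R.
  by rewrite expRM_natl lnK ?posrE.
have h : \prod_(k <- iota (2 ^ n) (2 ^ n %/ 4)) (1 + 2 * weight k) <=
    expR (n.+1%:R * ln 2 / 2).
  apply: (@le_trans _ _ (\prod_(k <- iota (2 ^ n) (2 ^ n %/ 4)) expR (2 * q))).
    rewrite big_seq [leRHS]big_seq; apply: ler_prod => k; rewrite mem_iota => /andP[k1 k2].
    have k0 : (0 < k)%N by apply: leq_trans k1; rewrite expn_gt0.
    have w0 := weight_ge0 k0.
    rewrite addr_ge0 ?(mulr_ge0 _ w0)//=.
    apply: le_trans (expR_ge1Dx _) _; rewrite ler_expR ler_pM2l//.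
    apply: weight_le; rewrite k1 (leq_trans k2)//.
    by rewrite expnS mul2n -addnn leq_add2l leq_div.
  rewrite big_const_seq count_predT size_iota iter_mulr_1 -expRM_natl ler_expR.
  have m4 : (2 ^ n %/ 4)%:R <= 2 ^+ n / 4 :> R.
    by rewrite ler_pdivlMr// -natrX -natrM ler_nat leq_trunc_div.
  apply: (@le_trans _ _ (2 ^+ n / 4 * (2 * q))); first by rewrite ler_wpM2r// mulr_ge0.
  rewrite le_eqVlt; apply/orP; left; apply/eqP.
  rewrite /q exprVn; field; exact: expf_neq0.
set u := n.+1%:R * ln 2 / 2 in h.
have u0 : 0 < u by rewrite /u divr_gt0// mulr_gt0.
apply: le_trans (ler_wpM2l q0 h) _.
have -> : q * expR u = 2 * n.+1%:R * ln 2 * expR (- u).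
  have -> : q = 2 * n.+1%:R * ln 2 * (expR (- u) * expR (- u)).
    rewrite -expRD (_ : - u - u = - (n.+1%:R * ln 2)); last by rewrite /u; field.
    by rewrite expRN E /q exprVn exprS; field; exact: expf_neq0.
  rewrite -!mulrA; do 3 congr (_ * _); by rewrite -expRD addNr expR0 mulr1.
apply: le_trans (ler_wpM2l _ (expR_cube_le u0)) _.
  by rewrite !mulr_ge0// ltW.
rewrite le_eqVlt; apply/orP; left; apply/eqP; rewrite /u; field.
by rewrite nat1r pnatr_eq0 /= gt_eqF.
Qed.

End Weights.

Lemma quasi_independentS (A B : {fset nat}) : (B `<=` A)%fset ->
  quasi_independent A -> quasi_independent B.
Proof.
move=> /fsubsetP BA qA eta e1 e2 k kB.
pose eta' k := if k \in B then eta k else 0.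
have <- : eta' k = eta k by rewrite /eta' kB.
apply: qA (BA _ kB).
- by move=> j _; rewrite /eta'; case: ifP => // /e1.
- rewrite -[RHS]e2.
  have pB : perm_eq (enum_fset B) [seq k <- enum_fset A | k \in B].
    apply: uniq_perm; rewrite ?fset_uniq ?filter_uniq ?fset_uniq// => j.
    by rewrite mem_filter; apply/idP/andP => [jB|[]//]; split => //; exact: BA.
  rewrite (perm_big _ pB) big_filter /= [RHS]big_mkcond /=; apply: eq_bigr => j _.
  by rewrite /eta'; case: ifP; rewrite ?mul0r.
Qed.

Lemma limn_einf_ge (R : realType) (u : nat -> \bar R) (c : \bar R) :
  (exists n0, forall n, (n0 <= n)%N -> (c <= u n)%E) -> (c <= limn_einf u)%E.
Proof.
move=> [n0 h]; rewrite limn_einf_lim; apply: lime_ge; first exact: is_cvg_einfs.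
near=> n; apply: le_ereal_inf_tmp => _ [m /= nm <-]; apply: h.
by apply: leq_trans nm; near: n; exact: nbhs_infty_ge.
Unshelve. all: by end_near. Qed.

Lemma leq_counting_upto (E : set nat) (m n : nat) : (m <= n)%N ->
  (counting_upto E m <= counting_upto E n)%N.
Proof.
move=> mn; rewrite /counting_upto [leqRHS](big_cat_nat (n := m.+1))//=.
exact: leq_addr.
Qed.

Lemma counting_upto_sub (E E' : set nat) (M m : nat) :
  (forall k, (M <= k)%N -> E k -> E' k) ->
  (counting_upto E m <= counting_upto E' m + M)%N.
Proof.
move=> EE'; have h : (\sum_(1 <= k < m.+1) (k < M)%N <= M)%N.
  suff : (\sum_(1 <= k < m.+1) (k < M)%N <= minn m M)%N by rewrite leq_min => /andP[].
  elim: m => [|m IH]; first by rewrite big_geq.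
  rewrite big_nat_recr//=; apply: leq_trans (leq_add IH (leqnn _)) _.
  by case: (ltnP m.+1 M) => h; lia.
apply: leq_trans (leq_add (leqnn _) h); rewrite /counting_upto -big_split /=.
apply: leq_sum => k _; have [kM|kM] := ltnP k M; first by case: (k \in E); rewrite addn1.
rewrite addn0; case: (boolP (k \in E)) => // /set_mem Ek.
by rewrite (mem_set (EE' k kM Ek)).
Qed.

(** Both counts grow like the square of [log N], so a general [N] can be squeezed between
    consecutive powers of 2 at the cost of a constant factor, and the loss of [M] elements is
    eventually negligible. *)
Lemma lower_density_gt0 (R : realType) (T T' : set nat) (M n1 : nat) (t : R) :
  0 < t -> T' `<=` T ->
  (forall n, (n1 <= n)%N -> (counting_upto T (2 ^ n).-1)%:R <= 2 * t * n.+1%:R ^+ 2) ->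
  (forall n, (n1 <= n)%N ->
     t * n.+1%:R ^+ 2 / 64 <= (counting_upto T' (2 ^ n).-1 + M)%:R) ->
  (0 < lower_density R T' T)%E.
Proof.
move=> t0 TT hT hT'.
(* With [x = m + 1], [T] has at most [2t (x+1)^2 <= 8 t x^2] elements and [T'] at least
   [t x^2/64 - M >= t x^2/128]; the ratio is [2^-10]. *)
apply: (@lt_le_trans _ _ (2^-1 ^+ 10)%:E); first by rewrite lte_fin exprn_gt0.
apply: limn_einf_ge; pose m0 := maxn n1 (Num.bound (128 * M%:R / t)).
exists (2 ^ m0)%N => N hN; rewrite lee_fin.
have N0 : (0 < N)%N by apply: leq_trans hN; rewrite expn_gt0.
pose m := trunc_log 2 N.
have m0m : (m0 <= m)%N by rewrite /m; apply: trunc_log_max.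
have /andP[mN Nm] : (2 ^ m <= N < 2 ^ m.+1)%N by apply: trunc_log_bounds.
have n1m : (n1 <= m)%N by apply: leq_trans m0m; rewrite leq_maxl.
pose x : R := m.+1%:R.
have x1 : 1 <= x by rewrite ler1n.
have Mx : 128 * M%:R <= t * x ^+ 2.
  have : 128 * M%:R / t <= x.
    apply: le_trans (ltW (archi_boundP _)) _; first by rewrite divr_ge0 ?mulr_ge0// ltW.
    by rewrite /x ler_nat (leq_trans (leq_maxr n1 _))// (leq_trans m0m).
  rewrite ler_pdivrMr//; nra.
have A : (counting_upto T N)%:R <= 2 * t * (x + 1) ^+ 2.
  apply: (@le_trans _ _ (counting_upto T (2 ^ m.+1).-1)%:R).
    by rewrite ler_nat; apply: leq_counting_upto; rewrite -ltnS prednK// expn_gt0.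
  by apply: le_trans (hT m.+1 _) _; [exact: leqW|rewrite /x natr1].
have B : t * x ^+ 2 / 64 <= (counting_upto T' N)%:R + M%:R.
  apply: le_trans (hT' m n1m) _; rewrite natrD lerD2r ler_nat; apply: leq_counting_upto.
  by apply: leq_trans mN; exact: leq_pred.
have C : (counting_upto T' N)%:R <= (counting_upto T N)%:R :> R.
  by rewrite ler_nat -[leqRHS]addn0; apply: counting_upto_sub => k _; exact: TT.
have D : t * x ^+ 2 / 128 <= (counting_upto T' N)%:R by lra.
have tx : 0 < t * x ^+ 2 by rewrite mulr_gt0// exprn_gt0// (lt_le_trans _ x1).
rewrite ler_pdivlMr; last by apply: lt_le_trans C; apply: lt_le_trans D; rewrite divr_gt0.
apply: le_trans D; apply: le_trans (ler_wpM2l _ A) _; first by rewrite exprn_ge0.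
have : (x + 1) ^+ 2 <= 4 * x ^+ 2 by nra.
move=> h; have h2 : t * (x + 1) ^+ 2 <= t * (4 * x ^+ 2) by rewrite ler_pM2l.
lra.
Qed.

(** * Almost sure properties of the random set *)

Section RandomSet.
Context (R : realType) (d : measure_display) (Omega : measurableType d).
Context (P : probability Omega R) (xi : nat -> {RV P >-> R}).
Context (xi_indep : mutually_independent posnat xi).
Context (xi01 : forall k w, (0 < k)%N -> xi k w = 0 \/ xi k w = 1).
Context (xi_mean : forall k, (0 < k)%N -> ('E_P[xi k] = (weight k)%:E)%E).

Let success k : set Omega := [set w | xi k w = 1].

Lemma measurable_success k : measurable (success k).
Proof.
rewrite (_ : success k = setT `&` xi k @^-1` [set 1]); last by rewrite setTI.
by apply: (measurable_funPT (xi k)) => //; exact: measurable_set1.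
Qed.

Lemma prob_success k : (0 < k)%N -> P (success k) = (weight k)%:E.
Proof.
move=> k0; rewrite -xi_mean// -expectation_indic; last exact: measurable_success.
congr ('E_P[_])%E; apply/funext => w; rewrite indicE.
case: (xi01 w k0) => xw.
  by rewrite memNset ?xw// /success /= xw => /eqP; rewrite eq_sym oner_eq0.
by rewrite mem_set ?xw.
Qed.

Lemma prob_successI (S : {fset nat}) : (forall k, k \in S -> (0 < k)%N) ->
  P (\bigcap_(k in [set` S]) success k) = (\prod_(k <- S) weight k)%:E.
Proof.
move=> S0.
have := @xi_indep S (fun=> [set 1]) S0 (fun _ _ => measurable_set1 1).
rewrite (_ : \bigcap_(j in _) _ = \bigcap_(k in [set` S]) success k)// => ->.
rewrite -prodEFin; apply: eq_big_seq => k kS; rewrite -prob_success//; exact: S0.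
Qed.

Lemma ae_dyadic_quasi_independent : {ae P, forall w, exists n0, forall n, (n0 <= n)%N ->
  quasi_independent [fset k in [fset k in iota (2 ^ n) (2 ^ n %/ 4)] | `[< success k w >]]%fset}.
Proof.
pose J n : {fset nat} := [fset k in iota (2 ^ n) (2 ^ n %/ 4)]%fset.
have JE n k : (k \in J n) = (2 ^ n <= k < 2 ^ n + 2 ^ n %/ 4)%N.
  by rewrite !finmap.inE mem_iota.
have J0 n k : k \in J n -> (0 < k)%N.
  by rewrite JE => /andP[k1 _]; apply: leq_trans k1; rewrite expn_gt0.
have IJ n : independent_events P (J n) success weight.
  split => [k _|k /J0/weight_ge0//|S /fsubsetP SJ]; first exact: measurable_success.
  by apply: prob_successI => k /SJ; exact: J0.
pose q n : R := n.+1%:R * ln 2 * 2^-1 ^+ n.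
have q0 n : 0 <= q n.
  by rewrite mulr_ge0 ?exprn_ge0// mulr_ge0// ltW// ln2_gt0.
have wq n k : k \in J n -> weight k <= q n.
  rewrite JE => /andP[k1 k2]; apply: weight_le; rewrite k1 (leq_trans k2)//.
  by rewrite expnS mul2n -addnn leq_add2l leq_div.
have /choice[F hF] n := not_quasi_independent_prob (IJ n) (wq n) (q0 n).
have := @ae_eventually_not _ _ _ P F (96 / ln 2 ^+ 2).
have mF n : measurable (F n) by have [] := hF n.
have PF n : (P (F n) <= (96 / ln 2 ^+ 2 / n.+1%:R ^+ 2)%:E)%E.
  have [_ _ h] := hF n; apply: le_trans h _; rewrite lee_fin.
  apply: le_trans (prod_weight_le n); rewrite le_eqVlt; apply/orP; left; apply/eqP.
  congr (_ * _); apply: perm_big; apply: uniq_perm; rewrite ?fset_uniq ?iota_uniq// => k.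
  by rewrite JE mem_iota.
move=> /(_ mF PF); apply: filterS => w [n0 h]; exists n0 => n nn.
by apply: contrapT => nq; apply: (h n nn); have [_ + _] := hF n; exact.
Qed.

(** The variance is at most the mean, which is at most [ln 2 * n^2]. A deviation of [c (n+1)^2] thus
    has probability [O((n+1)^-2)], summable along the scales [2^n]. *)
Lemma ae_sum_success_near (Q : pred nat) (c : R) : 0 < c ->
  {ae P, forall w, exists n0, forall n, (n0 <= n)%N ->
    `|\sum_(1 <= k < 2 ^ n | Q k) \1_(success k) w - \sum_(1 <= k < 2 ^ n | Q k) weight k|
      < c * n.+1%:R ^+ 2}.
Proof.
move=> c0; pose r n := [seq k <- index_iota 1 (2 ^ n) | Q k].
have r0 n k : k \in r n -> (0 < k)%N.
  by rewrite mem_filter mem_index_iota => /and3P[].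
have a0 n : 0 < c * n.+1%:R ^+ 2 :> R by rewrite mulr_gt0// exprn_gt0.
have pair n k l : k \in r n -> l \in r n -> k != l ->
    P (success k `&` success l) = (weight k * weight l)%:E.
  move=> kr lr kl; have S0 j : j \in [fset k; l]%fset -> (0 < j)%N.
    by rewrite !finmap.inE => /orP[]/eqP->; [exact: r0 kr|exact: r0 lr].
  have := prob_successI S0; rewrite big_fsetU1 ?finmap.inE//= big_seq_fset1 => <-.
  congr (P _); apply/seteqP; split => w.
    by move=> [h1 h2] j /=; rewrite !finmap.inE => /orP[]/eqP->.
  by move=> h; split; apply: h => /=; rewrite !finmap.inE eqxx ?orbT.
have ch n : _ := @chebyshev_events R d Omega P (r n) success weight (c * n.+1%:R ^+ 2)
  (filter_uniq _ (iota_uniq _ _)) (fun k _ => measurable_success k)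
  (fun k kr => prob_success (r0 n k kr)) (fun k kr => weight_ge0 (r0 n k kr)) (@pair n) (a0 n).
have m n : \sum_(k <- r n) weight k <= ln 2 * n%:R ^+ 2 :> R.
  apply: le_trans (sum_weight_le n); rewrite /r big_filter big_mkcond /=.
  rewrite big_nat [leRHS]big_nat; apply: ler_sum => k /andP[k0 _].
  by case: ifP => // _; exact: weight_ge0.
have := @ae_eventually_not _ _ _ P
  (fun n => [set w | c * n.+1%:R ^+ 2 <= `|\sum_(k <- r n) \1_(success k) w - \sum_(k <- r n) weight k|])
  (ln 2 / c ^+ 2) (fun n => (ch n).1).
have PF n : (P [set w | (c * n.+1%:R ^+ 2 <= `|\sum_(k <- r n) \1_(success k) w - \sum_(k <- r n) weight k|)%R ]
   <= (ln 2 / c ^+ 2 / n.+1%:R ^+ 2)%:E)%E.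
  apply: le_trans (ch n).2 _; rewrite lee_fin.
  have n0 : (0 : R) < n.+1%:R by [].
  rewrite ler_pdivrMr ?exprn_gt0//; apply: le_trans (m n) _.
  have -> : ln 2 / c ^+ 2 / n.+1%:R ^+ 2 * (c * n.+1%:R ^+ 2) ^+ 2 = ln 2 * n.+1%:R ^+ 2 :> R.
    by field; rewrite nat1r pnatr_eq0 /= gt_eqF.
  by rewrite ler_pM2l ?ln2_gt0// lerXn2r ?nnegrE// ler_nat.
move=> /(_ PF); apply: filterS => w [n0 h]; exists n0 => n nn.
rewrite ltNge; apply/negP => hn; apply: (h n nn).
by rewrite /= /r !big_filter.
Qed.

End RandomSet.

Theorem theorem5p4 (R : realType) (d : measure_display)
    (Omega : measurableType d) (P : probability Omega R)
    (xi : nat -> {RV P >-> R})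
    (xi_indep : mutually_independent posnat xi)
    (xi01 : forall k w, (0 < k)%N -> xi k w = 0 \/ xi k w = 1)
    (xi_mean : forall k, (0 < k)%N -> ('E_P[xi k] = (ln k%:R / k%:R)%:E)%E) :
  {ae P, forall w,
    let T := [set k : nat | (0 < k)%N /\ xi k w = 1] in
    exists T' : set nat,
      [/\ T' `<=` T,
          (0 < lower_density R T' T)%E,
          Rider (4 / 3 : R) T'
        & forall q : R, 2 < q -> Lambda_set q T']}.
Proof.
have t0 : 0 < ln 2 :> R := ln2_gt0.
have aeq := ae_dyadic_quasi_independent xi_indep xi01 xi_mean.
have aeT := ae_sum_success_near xi_indep xi01 xi_mean predT t0.
have c0 : 0 < ln 2 / 64 :> R by rewrite divr_gt0.
have aeT' := ae_sum_success_near xi_indep xi01 xi_mean dyadic_head c0.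
apply: filterS3 aeq aeT aeT' => w [a ha] [b hb] [c hc].
pose T := [set k : nat | (0 < k)%N /\ xi k w = 1]; rewrite -/T.
(* Heads are known to be quasi-independent from the random rank [a] on only; the discarded initial
   segment becomes the constant [M = 2^a] of the density bound. *)
pose T' := [set k | T k /\ dyadic_head k /\ (2 ^ a <= k)%N].
have TT : T' `<=` T by move=> k [].
exists T'; have TE k : (0 < k)%N -> \1_[set w | xi k w = 1] w = (k \in T)%:R :> R.
  move=> k0; rewrite indicE; congr (_%:R); congr nat_of_bool.
  apply/idP/idP => /set_mem h; apply/mem_set => //.
  by case: h.
have cE n : (counting_upto T (2 ^ n).-1)%:R =
    \sum_(1 <= k < 2 ^ n) \1_[set w | xi k w = 1] w :> R.
  rewrite /counting_upto prednK ?expn_gt0// natr_sum big_nat [RHS]big_nat.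
  by apply: eq_bigr => k /andP[k0 _]; rewrite TE.
have LI : blockwise_independent T'.
  split; first by move=> k [[]].
  move=> A AT n; have [na|an] := ltnP n a.
    rewrite (_ : block A n = fset0); first by move=> eta _ _ k; rewrite finmap.inE.
    apply/fsetP => k; rewrite mem_block finmap.inE; apply/negP => /andP[/AT].
    move=> [[k0 _] [_ ak]] /eqP kn.
    have /andP[_] : (2 ^ trunc_log 2 k <= k < 2 ^ (trunc_log 2 k).+1)%N by exact: trunc_log_bounds.
    by rewrite kn ltnNge (leq_trans _ ak)// leq_exp2l.
  apply: quasi_independentS (ha n an); apply/fsubsetP => k.
  rewrite mem_block => /andP[/AT [[k0 kT] [kh ak]] /eqP kn].
  rewrite !finmap.inE mem_iota; apply/andP; split; last exact/asboolP.
  have /andP[k1 _] : (2 ^ trunc_log 2 k <= k < 2 ^ (trunc_log 2 k).+1)%N by exact: trunc_log_bounds.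
  by move: k1 kh; rewrite /dyadic_head kn => -> ->.
split => //.
- apply: (@lower_density_gt0 R T T' (2 ^ a) (maxn 5 (maxn b c)) (ln 2)) => //.
  + move=> n; rewrite !geq_max => /and3P[n5 nb nc].
    rewrite cE; have := hb n nb; rewrite ltr_norml => /andP[_].
    have := sum_weight_le (R := R) n.
    have : n%:R ^+ 2 <= n.+1%:R ^+ 2 :> R by rewrite lerXn2r ?nnegrE// ler_nat.
    move=> h1 h2 h3.
    have h4 : ln 2 * n%:R ^+ 2 <= ln 2 * n.+1%:R ^+ 2 :> R by rewrite ler_pM2l.
    lra.
  + move=> n; rewrite !geq_max => /and3P[n5 nb nc].
    apply: (@le_trans _ _ (counting_upto [set k | T k /\ dyadic_head k] (2 ^ n).-1)%:R); last first.
      rewrite ler_nat; apply: counting_upto_sub => k ak [Tk hk]; split => //.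
    have -> : (counting_upto [set k | T k /\ dyadic_head k] (2 ^ n).-1)%:R =
       \sum_(1 <= k < 2 ^ n | dyadic_head k) \1_[set w | xi k w = 1] w :> R.
      rewrite /counting_upto prednK ?expn_gt0// natr_sum big_nat [RHS]big_nat_cond.
      rewrite [RHS]big_mkcondr /=; apply: eq_bigr => k /andP[k0 _]; rewrite TE//.
      case: ifP => hk.
        congr (_%:R); congr nat_of_bool.
        by apply/idP/idP => /set_mem; [case=> h _|move=> h]; apply/mem_set.
      rewrite memNset// => -[_]; by rewrite hk.
    have := hc n nc; rewrite ltr_norml => /andP[h1 _].
    have h2 := sum_weight_ge (R := R) n.
    have n5' : (5 : R) <= n%:R by rewrite (ler_nat _ 5).
    (* The expected count [(n^2 - n - 2)/16] less the deviation [(n+1)^2/64] has to be at least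
       [(n+1)^2/64], up to the factor [ln 2]. This is [(n - 5)(n + 1) >= 0], the origin of the rank
       5 and of the deviation constant [ln 2 / 64]. *)
    have h3 : 0 <= ln 2 * ((n%:R - 5) * (n%:R + 1)) :> R.
      by apply: mulr_ge0; [exact: ltW|apply: mulr_ge0; lra].
    move: h1; rewrite -(natr1 n); set x : R := n%:R in h2 h3 n5' *.
    lra.
- exact: blockwise_independent_Rider.
- by move=> q q2; apply: blockwise_independent_Lambda => //; apply: lt_trans q2.
Qed.
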